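(* Let $1\le k\le l$ and $d\ge1$ be natural numbers, let $\Omega\colon S^{d-1}\to G(l,k)$ be a smooth map satisfying the cancellation condition $\bigcap_{\zeta\in S^{d-1}}\Omega(\zeta)=\{0\}$, and let $\alpha\in(0,d)$. Then there is a constant $C$ such that $$\int_{\mathbb{R}^d}\frac{|\mathrm{I}_\alpha[f](x)|}{|x-x_0|^\alpha}\,dx\le C\|f\|_{W_1^\Omega}$$ for every $x_0\in\mathbb{R}^d$ and every $f\in W_1^\Omega$.
   Context: $G(l,k)$ is the complex Grassmannian of $k$-dimensional complex linear subspaces of $\mathbb{C}^l$; $S^{d-1}$ is the unit sphere of $\mathbb{R}^d$; $|\cdot|$ is the Euclidean norm. The Fourier transform is $\hat f(\xi)=\int_{\mathbb{R}^d} f(x)e^{-2\pi i\langle\xi,x\rangle}dx$, with inverse $\mathcal{F}^{-1}$. $W_1^\Omega=\{f\in L_1(\mathbb{R}^d,\mathbb{C}^l):\ \hat f(\xi)\in\Omega(\xi/|\xi|)\ \text{for all }\xi\in\mathbb{R}^d\setminus\{0\}\}$, with norm $\|f\|_{W_1^\Omega}=\|f\|_{L_1(\mathbb{R}^d,\mathbb{C}^l)}$. The Riesz potential is $\mathrm{I}_\alpha[f]=\mathcal{F}^{-1}[|\cdot|^{-\alpha}\hat f]$ (applied coordinatewise). *)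

(* Defs.v *)
From HB Require Import structures.
From mathcomp Require Import all_boot all_order all_algebra.
From mathcomp Require Import all_classical all_reals all_analysis.
From mathcomp.real_closed Require Import complex.
Set Implicit Arguments.
Unset Strict Implicit.
Unset Printing Implicit Defensive.
Import Order.TTheory GRing.Theory Num.Theory.
Import numFieldNormedType.Exports.
Local Open Scope classical_set_scope.
Local Open Scope ring_scope.

(* R^n = 'rV[R]_n carries the sigma-algebra generated by the coordinates, that
   is, its Borel sigma-algebra, as n.-tuple R does in the library. *)
Definition rV_display : measure_display -> measure_display.
Proof. exact. Qed.

Section measurable_rV.
Context {R : realType}.
Variable n : nat.

Let coors : 'I_n -> 'rV[R]_n -> R := fun i x => x ord0 i.

Let rV_set0 : g_sigma_preimage coors set0.
Proof. exact: sigma_algebra0. Qed.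

Let rV_setC A : g_sigma_preimage coors A -> g_sigma_preimage coors (~` A).
Proof. exact: sigma_algebraC. Qed.

Let rV_bigcup (F : _^nat) : (forall i, g_sigma_preimage coors (F i)) ->
  g_sigma_preimage coors (\bigcup_i (F i)).
Proof. exact: sigma_algebra_bigcup. Qed.

HB.instance Definition _ := @isMeasurable.Build
  (rV_display default_measure_display)
  'rV[R]_n (g_sigma_preimage coors) rV_set0 rV_setC rV_bigcup.

End measurable_rV.

Lemma measurable_fun_rVP (R : realType) d (T : measurableType d) n
    (f : T -> 'rV[R]_n) :
  measurable_fun [set: T] f <->
  forall i, measurable_fun [set: T] (fun x => f x ord0 i).
Proof.
apply: (@iff_trans _ (g_sigma_preimage
    (fun i => (fun x : 'rV[R]_n => x ord0 i) \o f) `<=` measurable)).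
  rewrite g_sigma_preimage_comp; split=> [mf A [/= C preC <-]|prefS].
    exact: mf.
  by move=> _ A mA; apply: prefS; exists A.
split=> [coorS i|mf].
- move=> _ A mA.
  apply: coorS; apply: sub_sigma_algebra.
  case: n i => [[] []//|n' i] in f *.
  rewrite -bigcup_mkord_ord.
  exists i; first exact: ltn_ord.
  by exists A => //; rewrite inord_val.
- apply: smallest_sub; first exact: sigma_algebra_measurable.
  case: n => [|n'] in f mf *; first by rewrite big_ord0.
  rewrite -bigcup_mkord_ord; apply: bigcup_sub => i Ii.
  by move=> A [B mB <-]; exact: mf.
Qed.

Section lebesgue_rV.
Variable R : realType.

Definition cons_rV n (p : measurableTypeR R * 'rV[R]_n) : 'rV[R]_n.+1 :=
  \row_i (if unlift ord0 i is Some j then p.2 ord0 j else p.1).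

Definition uncons_rV n (x : 'rV[R]_n.+1) : measurableTypeR R * 'rV[R]_n :=
  (x ord0 ord0, \row_j x ord0 (lift ord0 j)).

Lemma cons_rV0 n (p : measurableTypeR R * 'rV[R]_n) : cons_rV p ord0 ord0 = p.1.
Proof. by rewrite mxE unlift_none. Qed.

Lemma cons_rVS n (p : measurableTypeR R * 'rV[R]_n) j :
  cons_rV p ord0 (lift ord0 j) = p.2 ord0 j.
Proof. by rewrite mxE liftK. Qed.

Lemma cons_rVK n : cancel (@cons_rV n) (@uncons_rV n).
Proof.
move=> [a v]; rewrite /uncons_rV cons_rV0; congr pair.
by apply/rowP => j; rewrite mxE cons_rVS.
Qed.

Lemma uncons_rVK n : cancel (@uncons_rV n) (@cons_rV n).
Proof.
move=> x; apply/rowP => i; case: (unliftP ord0 i) => [j|] ->.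
  by rewrite cons_rVS mxE.
by rewrite cons_rV0.
Qed.

Lemma measurable_coord_rV n (i : 'I_n) :
  measurable_fun [set: 'rV[R]_n] (fun x : 'rV[R]_n => x ord0 i).
Proof. by move/measurable_fun_rVP: (@measurable_id _ 'rV[R]_n setT); exact. Qed.

Lemma measurable_cons_rV n : measurable_fun setT (@cons_rV n).
Proof.
apply/measurable_fun_rVP => i; case: (unliftP ord0 i) => [j|] ->.
  under eq_fun do rewrite cons_rVS.
  apply: (measurableT_comp (measurable_coord_rV j)); exact: measurable_snd.
under eq_fun do rewrite cons_rV0.
exact: measurable_fst.
Qed.

Lemma measurable_uncons_rV n : measurable_fun setT (@uncons_rV n).
Proof.
apply: measurable_fun_pair; first exact: measurable_coord_rV.
apply/measurable_fun_rVP => j.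
under eq_fun do rewrite mxE.
exact: measurable_coord_rV.
Qed.

Section cons_measure.
Variables (n : nat) (mu : {sigma_finite_measure set 'rV[R]_n -> \bar R}).

Definition cons_measure : set 'rV[R]_n.+1 -> \bar R :=
  pushforward (@lebesgue_measure R \x mu)%E (@cons_rV n).

Let mpre A : measurable A -> measurable (@cons_rV n @^-1` A).
Proof. by move=> mA; rewrite -[X in measurable X]setTI; exact: measurable_cons_rV. Qed.

Let cons_measure0 : cons_measure set0 = 0%E.
Proof. by rewrite /cons_measure /pushforward preimage_set0 measure0. Qed.

Let cons_measure_ge0 A : (0 <= cons_measure A)%E.
Proof. by rewrite /cons_measure /pushforward; exact: measure_ge0. Qed.

Let cons_measure_sigma_additive : semi_sigma_additive cons_measure.
Proof.
move=> F mF tF mUF; rewrite /cons_measure /pushforward preimage_bigcup.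
apply: measure_semi_sigma_additive.
- by move=> k; exact: mpre.
- apply/trivIsetP => /= i j _ _ ij; rewrite -preimage_setI.
  by move/trivIsetP : tF => /(_ _ _ _ _ ij) ->//; rewrite preimage_set0.
- by rewrite -preimage_bigcup; exact: mpre.
Qed.

HB.instance Definition _ := isMeasure.Build _ _ _ cons_measure
  cons_measure0 cons_measure_ge0 cons_measure_sigma_additive.

Let cons_measure_sigma_finite : sigma_finite setT cons_measure.
Proof.
have /sigma_finiteP[F [TF ndF Foo]] := sigma_finiteT (@lebesgue_measure R).
have /sigma_finiteP[G [TG ndG Goo]] := sigma_finiteT mu.
exists (fun k => @uncons_rV n @^-1` (F k `*` G k)).
  rewrite -preimage_bigcup predeqE => x; split=> // _ /=.
  have [i _ Fi] : (\bigcup_i F i) (uncons_rV x).1 by rewrite -TF.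
  have [j _ Gj] : (\bigcup_j G j) (uncons_rV x).2 by rewrite -TG.
  exists (maxn i j) => //; split.
    by move: Fi; exact/subsetPset/ndF/leq_maxl.
  by move: Gj; exact/subsetPset/ndG/leq_maxr.
move=> k; have [mF Fk] := Foo k; have [mG Gk] := Goo k; split.
  rewrite -[X in measurable X]setTI; apply: measurable_uncons_rV => //.
  exact: measurableX.
rewrite /cons_measure /pushforward -comp_preimage.
rewrite (_ : _ \o _ = id) ?preimage_id; last first.
  by apply/funext => p; exact: cons_rVK.
by rewrite product_measure1E// lte_mul_pinfty// ge0_fin_numE.
Qed.

HB.instance Definition _ := @Measure_isSigmaFinite.Build _ _ _ cons_measure
  cons_measure_sigma_finite.

End cons_measure.

(* Pinned down by its values on boxes, see lebesgue_rV_box. *)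
Fixpoint lebesgue_rV n : {sigma_finite_measure set 'rV[R]_n -> \bar R} :=
  if n is n'.+1 then cons_measure (lebesgue_rV n') else dirac (0 : 'rV[R]_0).

Lemma measurable_box_rV n (A : 'I_n -> set R) :
  (forall i, measurable (A i)) ->
  measurable [set x : 'rV[R]_n | forall i, A i (x ord0 i)].
Proof.
move=> mA; have -> : [set x : 'rV[R]_n | forall i, A i (x ord0 i)] =
    \big[setI/setT]_(i < n) ((fun x : 'rV[R]_n => x ord0 i) @^-1` A i).
  apply/seteqP; split=> x /=.
    by move=> Ax; elim/big_ind: _ => [//|P Q Px Qx|i _]; [split|exact: Ax].
  by move=> + i; rewrite (bigD1 i)//= => -[].
elim/big_ind: _ => [//|P Q mP mQ|i _]; first exact: measurableI.
by rewrite -[X in measurable X]setTI; exact: measurable_coord_rV.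
Qed.

Lemma lebesgue_rV_box n (A : 'I_n -> set R) :
  (forall i, measurable (A i)) ->
  lebesgue_rV n [set x : 'rV[R]_n | forall i, A i (x ord0 i)] =
  (\prod_(i < n) lebesgue_measure (A i))%E.
Proof.
elim: n A => [|n IHn] A mA.
  by rewrite big_ord0 /= diracE mem_set//= => -[].
rewrite big_ord_recl /= /cons_measure /pushforward.
have -> : @cons_rV n @^-1` [set x : 'rV[R]_n.+1 | forall i, A i (x ord0 i)] =
    A ord0 `*` [set v : 'rV[R]_n | forall i, A (lift ord0 i) (v ord0 i)].
  apply/seteqP; split=> p /=.
    move=> Ap; split; first by rewrite -cons_rV0.
    by move=> i; rewrite -cons_rVS.
  move=> [A0 AS] i; case: (unliftP ord0 i) => [j|] ->.
    by rewrite cons_rVS.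
  by rewrite cons_rV0.
rewrite product_measure1E; [|exact: mA|].
  by congr (_ * _)%E; exact: (IHn (fun i => A (lift ord0 i))).
by apply: (@measurable_box_rV n (fun i => A (lift ord0 i))) => i; exact: mA.
Qed.

End lebesgue_rV.

Section euclidean.
Variables (R : realType) (d : nat).
Implicit Types x y xi : 'rV[R]_d.

Definition dotrV x y : R := \sum_(i < d) x ord0 i * y ord0 i.

(* The library norm `|x| on row vectors is the sup norm. *)
Definition enorm x : R := Num.sqrt (dotrV x x).

Definition sphere := {x : 'rV[R]_d | enorm x == 1}.

Lemma enorm_eq0 x : (enorm x == 0) = (x == 0).
Proof.
rewrite sqrtr_eq0 le_eqVlt ltNge sumr_ge0 ?orbF; last first.
  by move=> i _; rewrite -expr2 sqr_ge0.
rewrite psumr_eq0; last by move=> i _; rewrite -expr2 sqr_ge0.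
apply/allP/eqP => [x0|-> i _]; last by rewrite /= mxE mulr0 eqxx.
apply/rowP => i; rewrite mxE; apply/eqP.
by have := x0 i (mem_index_enum _); rewrite /= mulf_eq0 orbb.
Qed.

Fact direction_subproof xi : xi != 0 -> enorm ((enorm xi)^-1 *: xi) == 1.
Proof.
move=> xi0; have n0 : enorm xi != 0 by rewrite enorm_eq0.
have -> : enorm ((enorm xi)^-1 *: xi) = `|(enorm xi)^-1| * enorm xi.
  rewrite /enorm -sqrtr_sqr -sqrtrM ?sqr_ge0//; congr Num.sqrt.
  by rewrite mulr_sumr; apply: eq_bigr => i _; rewrite !mxE expr2 mulrACA.
by rewrite ger0_norm ?invr_ge0 ?sqrtr_ge0// mulVf.
Qed.

Definition direction xi (xi0 : xi != 0) : sphere :=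
  exist (fun x => enorm x == 1) _ (direction_subproof xi0).

End euclidean.

Section smoothness.
Variables (R : realType) (d : nat).

Definition iter_partial (s : seq 'I_d) (f : 'rV[R]_d -> R) : 'rV[R]_d -> R :=
  foldr (fun i g x => 'D_(delta_mx ord0 i) g x) f s.

Definition smooth_on (U : set 'rV[R]_d) (f : 'rV[R]_d -> R) :=
  forall (s : seq 'I_d) x, U x ->
    {for x, continuous (iter_partial s f)} /\
    forall i, derivable (iter_partial s f) x (delta_mx ord0 i).

Definition csmooth_on (U : set 'rV[R]_d) (f : 'rV[R]_d -> R[i]) :=
  smooth_on U (fun x => complex.Re (f x)) /\
  smooth_on U (fun x => complex.Im (f x)).

Definition schwartz (phi : 'rV[R]_d -> R[i]) :=
  csmooth_on setT phi /\
  forall (s : seq 'I_d) (N : nat), exists B : R, forall x,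
    (1 + enorm x) ^+ N * `|iter_partial s (fun y => complex.Re (phi y)) x| <= B
    /\
    (1 + enorm x) ^+ N * `|iter_partial s (fun y => complex.Im (phi y)) x| <= B.

End smoothness.

Section grassmannian.
Variables (R : realType) (l k : nat).

Definition grassmannian := {V : {vspace 'rV[R[i]]_l} | \dim V == k}.

(* The standard chart of the Grassmannian attached to the columns J: a
   subspace V in its domain has a unique basis, the rows of A, whose J-minor
   is the identity; the entries of A are the coordinates of V. *)
Definition grassmannian_chart (J : 'I_k -> 'I_l) (V : grassmannian)
    (A : 'M[R[i]]_(k, l)) :=
  colsub J A = 1%:M /\ val V = <<[seq row i A | i : 'I_k]>>%VS.

(* Smoothness on the embedded sphere is the existence, near every point, of
   chart coordinates that extend smoothly to an open subset of R^d. *)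
Definition smooth_grassmannian_map d (Omega : sphere R d -> grassmannian) :=
  forall zeta0 : sphere R d,
    exists (U : set 'rV[R]_d) (J : 'I_k -> 'I_l)
           (A : 'rV[R]_d -> 'M[R[i]]_(k, l)),
      [/\ open U, U (val zeta0),
          forall i j, csmooth_on U (fun x => A x i j) &
          forall zeta : sphere R d, U (val zeta) ->
            grassmannian_chart J (Omega zeta) (A (val zeta))].

End grassmannian.

Section fourier.
Variables (R : realType) (d : nat).
Implicit Types (h u g phi : 'rV[R]_d -> R[i]) (xi : 'rV[R]_d).

Local Notation mu := (@lebesgue_rV R d).

Definition cintegral h : R[i] :=
  Complex (\int[mu]_x complex.Re (h x)) (\int[mu]_x complex.Im (h x)).

Definition cexpi (t : R) : R[i] := Complex (cos t) (sin t).

Definition fourier h xi : R[i] :=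
  cintegral (fun x => h x * cexpi (- (2 * pi * dotrV xi x))).

Definition inv_fourier h xi : R[i] :=
  cintegral (fun x => h x * cexpi (2 * pi * dotrV xi x)).

Definition cmeasurable h :=
  measurable_fun setT (fun x => complex.Re (h x)) /\
  measurable_fun setT (fun x => complex.Im (h x)).

(* Measurable functions which define tempered distributions
   phi |-> cintegral (u * phi) through absolutely convergent integrals. *)
Definition tempered_fun u :=
  cmeasurable u /\
  exists N : nat,
    (\int[mu]_x (Normc.normc (u x) / (1 + enorm x) ^+ N)%:E < +oo)%E.

(* g = F^{-1} u in the sense of tempered distributions,
   where <F^{-1} u, phi> = <u, F^{-1} phi> for Schwartz phi. *)
Definition is_distr_inv_fourier u g :=
  [/\ tempered_fun u, tempered_fun g &
      forall phi, schwartz phi ->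
        cintegral (fun x => g x * phi x) =
        cintegral (fun xi => u xi * inv_fourier phi xi)].

End fourier.

Section vector_valued.
Variables (R : realType) (d l : nat).
Implicit Types (f g : 'rV[R]_d -> 'rV[R[i]]_l).

Local Notation mu := (@lebesgue_rV R d).

Definition cenorm (v : 'rV[R[i]]_l) : R :=
  Num.sqrt (\sum_(j < l) Normc.normc (v ord0 j) ^+ 2).

Definition L1_fun f := forall j,
  mu.-integrable setT (fun x => (complex.Re (f x ord0 j))%:E) /\
  mu.-integrable setT (fun x => (complex.Im (f x ord0 j))%:E).

Definition L1_norm f : \bar R := (\int[mu]_x (cenorm (f x))%:E)%E.

Definition vfourier f (xi : 'rV[R]_d) : 'rV[R[i]]_l :=
  \row_j fourier (fun x => f x ord0 j) xi.

Definition W1 k (Omega : sphere R d -> grassmannian R l k) f :=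
  L1_fun f /\
  forall (xi : 'rV[R]_d) (xi0 : xi != 0),
    vfourier f xi \in val (Omega (direction xi0)).

(* g represents the Riesz potential of f; such a g is unique up to null sets. *)
Definition is_riesz_potential (alpha : R) f g := forall j,
  is_distr_inv_fourier
    (fun xi => ((enorm xi `^ (- alpha))%:C)%C * vfourier f xi ord0 j)
    (fun x => g x ord0 j).

End vector_valued.

(* Main.v *)
Require Import Defs.
From HB Require Import structures.
From mathcomp Require Import all_boot all_order all_algebra.
From mathcomp Require Import all_classical all_reals all_analysis.
From mathcomp.real_closed Require Import complex.
From mathcomp Require Import measurable_realfun ring lra.
Set Implicit Arguments.
Unset Strict Implicit.
Unset Printing Implicit Defensive.
Import Order.TTheory GRing.Theory Num.Theory.
Import numFieldNormedType.Exports.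
Local Open Scope classical_set_scope.
Local Open Scope ring_scope.

(** The idea is to correct the Riesz kernel by something that the constraint
    kills. Write [K x = |x|^(alpha - d)], so that [I_alpha f] is a constant
    multiple of [K * f], and take [x0 = 0]. Suppose that a vector [e] of [C^l]
    is the value at the origin of a function [Phi], from [R^d] to [C^l], with
    [|Phi y - e| <= C |y|] and [|Phi y| <= C / |y|], all of whose dilates are
    orthogonal to [f] for the bilinear pairing. Then, up to the constant,

      [e . I_alpha f (x) = int f y . (K (x - y) e - K x Phi (y / |x|)) dy].

    For [|x| >= 2 |y|] the correction removes the leading term of the kernel,
    and what is left is [O(|y| |x|^(alpha - d - 1))]; for [|x| < 2 |y|] the
    two terms are controlled separately, the second one through the decay of
    [Phi]. By homogeneity the integral of [|x|^-alpha |kernel|] in [x] is thus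
    bounded uniformly in [y] ([kernel_bound]), and Tonelli's theorem gives the
    estimate for [e . I_alpha f] ([riesz_coordinate_bound]).

    It remains to see that every [e] arises in this way, uniformly over the
    constrained [f] ([every_vector_orthogonal_limit]). The vectors [e] that do
    arise form a linear subspace, and one annihilated by no nonzero vector [v]
    is the whole space ([separating_subspace]). Given [v], the
    cancellation condition provides a direction [zeta] such that [v] is not in
    [Omega zeta]. Near [zeta] a chart of the Grassmannian turns membership in
    [Omega] into linear equations with smooth coefficients, one of which [v]
    violates at [zeta]. Let [w xi] be the covector of this equation at
    [xi / |xi|], and [Phi] the Fourier transform of [w] times a small Lipschitz
    bump around [zeta]. Orthogonality is then Parseval's formula, [Phi] is
    smooth enough at the origin because the bump has compact support, it
    decays like [1 / |y|] because [w] times the bump is Lipschitz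
    ([fourier_lip_decay]), and [v . Phi 0], the integral of [v . w] times the
    bump, is not zero ([separating_orthogonal_limit]).

    The distributional definition of [I_alpha f] asks for two more facts. It
    has the solution [c K * f] ([riesz_conv_distr]), since the Fourier
    transform of [|xi|^-alpha] is [c K]: both powers are averages of Gaussians
    over dilations ([riesz_identity]). And it has no other up to null sets
    ([distr_inv_fourier_unique]): Gaussians times [exp (- m v^(2 m))] are
    Schwartz functions that converge to Gaussians cut off to boxes, and boxes
    determine an integrable function. *)

(** * Lebesgue measure on R^d under affine maps *)

Section lebesgue_affine.
Variable R : realType.
Implicit Types (a b : R).

Definition affine a b : measurableTypeR R -> measurableTypeR R :=
  fun u => a * u + b.

Lemma measurable_affine a b : measurable_fun setT (affine a b).
Proof. by apply: measurable_funD => //; apply: measurable_funM. Qed.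

(** Lebesgue measure is determined by its values on half-open intervals. For
    [a < 0] the preimage of such an interval is open at the other end. *)
Lemma lebesgue_affine a b (A : set (measurableTypeR R)) : a != 0 ->
  measurable A ->
  lebesgue_measure A = mscale (NngNum (normr_ge0 a))
    (measure_function_pushforward__canonical__measure_function_Measure
      (@lebesgue_measure R) (measurable_affine a b)) A.
Proof.
move=> a0 mA; apply: lebesgue_measure_unique => //= _ [[x y]] _ <-; rewrite /mscale /= /pushforward.
have [a_gt0|a_le0] := ltP 0 a.
  have -> : affine a b @^-1` `]x, y]%classic =
      `](x - b) / a, (y - b) / a]%classic.
    apply/seteqP; split=> u /=; rewrite /affine !in_itv /= ltr_pdivrMr// ler_pdivlMr//
      ltrBlDr lerBrDr (mulrC u) //.
  rewrite !lebesgue_measure_itv/= !lte_fin ltr_pM2r ?invr_gt0// ltrD2r.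
  case: ifPn => _; last by rewrite mule0.
  rewrite -!EFinD -EFinM; congr EFin.
  by rewrite gtr0_norm//; field.
have a_lt0 : a < 0 by rewrite lt_neqAle a0.
have -> : affine a b @^-1` `]x, y]%classic =
    `[(y - b) / a, (x - b) / a[%classic.
  apply/seteqP; split=> u /=; rewrite /affine !in_itv /= ltr_ndivlMr// ler_ndivrMr//
      ltrBlDr lerBrDr (mulrC u) andbC //.
rewrite !lebesgue_measure_itv/= !lte_fin ltr_nM2r ?invr_lt0// ltrD2r.
case: ifPn => _; last by rewrite mule0.
rewrite -!EFinD -EFinM; congr EFin.
by rewrite ltr0_norm//; field.
Qed.

Lemma ge0_integral_affine a b (F : R -> \bar R) : a != 0 ->
  measurable_fun setT F -> (forall u, 0 <= F u)%E ->
  (\int[@lebesgue_measure R]_u F (a * u + b)%R =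
   `|a|^-1%:E * \int[@lebesgue_measure R]_u F u)%E.
Proof.
move=> a0 mF F0.
have ma := measurable_affine a b.
have E : (\int[@lebesgue_measure R]_u F u =
    `|a|%:E * \int[@lebesgue_measure R]_u F (affine a b u))%E.
  rewrite -[X in (_ * X)%E]/(\int[_]_(u in (affine a b) @^-1` setT) (F \o affine a b) u)%E.
  rewrite -ge0_integral_pushforward//.
  rewrite -(@ge0_integral_mscale _ _ _ _ _ measurableT (NngNum (normr_ge0 a)))//.
  apply: eq_measure_integral => A mA _; exact: lebesgue_affine.
by rewrite E muleA -EFinM mulVf ?normr_eq0// mul1e.
Qed.

Variable n : nat.

Lemma ge0_integral_cons_rV (F : 'rV[R]_n.+1 -> \bar R) :
  measurable_fun setT F -> (forall x, 0 <= F x)%E ->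
  (\int[lebesgue_rV R n.+1]_x F x =
   \int[@lebesgue_measure R]_a \int[lebesgue_rV R n]_v F (cons_rV (a, v)))%E.
Proof.
move=> mF F0.
have mc := @measurable_cons_rV R n.
transitivity (\int[pushforward (@lebesgue_measure R \x lebesgue_rV R n)%E
   (@cons_rV R n)]_x F x)%E.
  by apply: eq_measure_integral => A mA _.
rewrite ge0_integral_pushforward// preimage_setT.
rewrite (fubini_tonelli1 (F \o @cons_rV R n))// => [|z]; last exact: F0.
exact: (measurableT_comp mF mc).
Qed.

End lebesgue_affine.

Section measurable_rV.
Context (R : realType) d (T : measurableType d) (n : nat).
Implicit Types (f g : T -> 'rV[R]_n) (h : T -> R).

Lemma measurable_rVD f g : measurable_fun setT f -> measurable_fun setT g ->
  measurable_fun setT (fun t => f t + g t).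
Proof.
move=> /measurable_fun_rVP mf /measurable_fun_rVP mg; apply/measurable_fun_rVP => i.
by under eq_fun do rewrite mxE; exact: measurable_funD.
Qed.

Lemma measurable_rVN f : measurable_fun setT f ->
  measurable_fun setT (fun t => - f t).
Proof.
move=> /measurable_fun_rVP mf; apply/measurable_fun_rVP => i.
by under eq_fun do rewrite mxE; exact: measurable_funN.
Qed.

Lemma measurable_rVB f g : measurable_fun setT f -> measurable_fun setT g ->
  measurable_fun setT (fun t => f t - g t).
Proof. by move=> mf mg; apply: measurable_rVD => //; exact: measurable_rVN. Qed.

Lemma measurable_rVZ h f : measurable_fun setT h -> measurable_fun setT f ->
  measurable_fun setT (fun t => h t *: f t).
Proof.
move=> mh /measurable_fun_rVP mf; apply/measurable_fun_rVP => i.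
by under eq_fun do rewrite mxE; exact: measurable_funM.
Qed.

Lemma measurable_dotrV f g : measurable_fun setT f -> measurable_fun setT g ->
  measurable_fun setT (fun t => dotrV (f t) (g t)).
Proof.
move=> /measurable_fun_rVP mf /measurable_fun_rVP mg.
by apply: measurable_sum => i; exact: measurable_funM.
Qed.

Lemma measurable_enorm f : measurable_fun setT f ->
  measurable_fun setT (fun t => enorm (f t)).
Proof.
move=> mf; apply: (measurableT_comp (f := @Num.sqrt R)).
  by apply: continuous_measurable_fun; exact: sqrt_continuous.
exact: measurable_dotrV.
Qed.

End measurable_rV.

Section lebesgue_rV_affine.
Variable R : realType.

(** Induction on the dimension, one coordinate at a time. *)
Lemma ge0_integral_rV_affine n (a : R) (b : 'rV[R]_n) (F : 'rV[R]_n -> \bar R) :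
  a != 0 -> measurable_fun setT F -> (forall u, 0 <= F u)%E ->
  (\int[lebesgue_rV R n]_u F (a *: u + b)%R =
   (`|a|^-1 ^+ n)%:E * \int[lebesgue_rV R n]_u F u)%E.
Proof.
move=> a0; elim: n b F => [|n IHn] b F mF F0.
  rewrite expr0 mul1e; apply: eq_integral => x _; congr F.
  by apply/rowP => -[].
have mFab : measurable_fun setT (fun u : 'rV[R]_n.+1 => F (a *: u + b)).
  by apply: (measurableT_comp mF); apply: measurable_rVD => //; exact: measurable_rVZ.
rewrite ge0_integral_cons_rV// ge0_integral_cons_rV//.
have mc (s : R) : measurable_fun setT (fun v : 'rV[R]_n => cons_rV (s, v)).
  by apply: (measurableT_comp (@measurable_cons_rV R n)); exact: measurable_fun_pair.
pose b' : 'rV[R]_n := \row_j b ord0 (lift ord0 j).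
pose I := fun s : measurableTypeR R => (\int[lebesgue_rV R n]_v F (cons_rV (s, v)))%E.
have mI : measurable_fun setT I.
  apply: (measurable_fun_fubini_tonelli_F (F \o @cons_rV R n)) => [|z]; last exact: F0.
  exact: (measurableT_comp mF (@measurable_cons_rV R n)).
have I0 s : (0 <= I s)%E by exact: integral_ge0.
transitivity (\int[@lebesgue_measure R]_s
    ((`|a|^-1 ^+ n)%:E * I (affine a (b ord0 ord0) s)))%E.
  apply: eq_integral => s _.
  have E v : a *: cons_rV (s, v) + b =
      cons_rV (affine a (b ord0 ord0) s, a *: v + b').
    apply/rowP => i; rewrite !mxE; case: (unliftP ord0 i) => [j|] -> /=.
      by rewrite ?liftK ?unlift_none/= ?mxE.
    by rewrite ?unlift_none/= ?mxE.
  under eq_integral do rewrite E.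
  rewrite (IHn b' (fun v => F (cons_rV (affine a (b ord0 ord0) s, v))))//.
  exact: (measurableT_comp mF).
have mIa := measurableT_comp mI (measurable_affine a (b ord0 ord0)).
rewrite (ge0_integralZl (f := I \o affine a (b ord0 ord0)) _ measurableT mIa); last 2 first.
- by move=> s _; exact: I0.
- by rewrite lee_fin exprn_ge0// invr_ge0.
rewrite (ge0_integral_affine (b ord0 ord0) a0 mI I0).
by rewrite muleA -EFinM -exprSr.
Qed.

(** The integral is by definition the difference of the integrals of the
    positive and negative parts, possibly infinite. *)
Lemma integral_rV_affine n (a : R) (b : 'rV[R]_n) (F : 'rV[R]_n -> \bar R) :
  a != 0 -> measurable_fun setT F ->
  (\int[lebesgue_rV R n]_u F (a *: u + b)%R =
   (`|a|^-1 ^+ n)%:E * \int[lebesgue_rV R n]_u F u)%E.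
Proof.
move=> a0 mF; rewrite integralE [in RHS]integralE.
have E1 : (\int[lebesgue_rV R n]_x (fun u : 'rV[R]_n => F (a *: u + b)%R)^\+ x =
  (`|a|^-1 ^+ n)%:E * \int[lebesgue_rV R n]_u F^\+ u)%E.
  rewrite -(ge0_integral_rV_affine b a0 (measurable_funepos mF) (funepos_ge0 F)).
  by apply: eq_integral => u _; rewrite !funeposE.
have E2 : (\int[lebesgue_rV R n]_x (fun u : 'rV[R]_n => F (a *: u + b)%R)^\- x =
  (`|a|^-1 ^+ n)%:E * \int[lebesgue_rV R n]_u F^\- u)%E.
  rewrite -(ge0_integral_rV_affine b a0 (measurable_funeneg mF) (funeneg_ge0 F)).
  by apply: eq_integral => u _; rewrite !funenegE.
rewrite E1 E2.
have c0 : 0 < `|a|^-1 ^+ n by rewrite exprn_gt0// invr_gt0 normr_gt0.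
have : (0 <= \int[lebesgue_rV R n]_u F^\- u)%E by exact: integral_ge0.
have : (0 <= \int[lebesgue_rV R n]_u F^\+ u)%E by exact: integral_ge0.
case: (\int[_]_u F^\+ u)%E => [p| |]//; case: (\int[_]_u F^\- u)%E => [q| |]// _ _.
- by rewrite /= -EFinM; congr EFin; ring.
- by rewrite /= gt0_muley ?lte_fin// gt0_muleNy ?lte_fin.
- by rewrite /= gt0_muley ?lte_fin.
- by rewrite /= gt0_muley ?lte_fin// gt0_muleNy ?lte_fin.
Qed.

End lebesgue_rV_affine.

(** * The Euclidean norm *)

Section euclidean_norm.
Variables (R : realType) (n : nat).
Implicit Types (x y z : 'rV[R]_n) (a : R).

Lemma dotrVC x y : dotrV x y = dotrV y x.
Proof. by apply: eq_bigr => i _; rewrite mulrC. Qed.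

Lemma dotrVDl x y z : dotrV (x + y) z = dotrV x z + dotrV y z.
Proof. by rewrite -big_split; apply: eq_bigr => i _; rewrite mxE mulrDl. Qed.

Lemma dotrVDr x y z : dotrV z (x + y) = dotrV z x + dotrV z y.
Proof. by rewrite dotrVC dotrVDl !(dotrVC z). Qed.

Lemma dotrVZl a x y : dotrV (a *: x) y = a * dotrV x y.
Proof. by rewrite mulr_sumr; apply: eq_bigr => i _; rewrite mxE mulrA. Qed.

Lemma dotrVZr a x y : dotrV x (a *: y) = a * dotrV x y.
Proof. by rewrite dotrVC dotrVZl dotrVC. Qed.

Lemma dotrVNl x y : dotrV (- x) y = - dotrV x y.
Proof. by rewrite -scaleN1r dotrVZl mulN1r. Qed.

Lemma dotrVNr x y : dotrV x (- y) = - dotrV x y.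
Proof. by rewrite dotrVC dotrVNl dotrVC. Qed.

Lemma dotrV0r x : dotrV x 0 = 0.
Proof. by apply: big1 => i _; rewrite mxE mulr0. Qed.

Lemma dotrV_ge0 x : 0 <= dotrV x x.
Proof. by apply: sumr_ge0 => i _; rewrite -expr2 sqr_ge0. Qed.

Lemma enorm_ge0 x : 0 <= enorm x. Proof. exact: sqrtr_ge0. Qed.

Lemma enorm_sqr x : enorm x ^+ 2 = dotrV x x.
Proof. by rewrite sqr_sqrtr// dotrV_ge0. Qed.

Lemma enorm0 : enorm (0 : 'rV[R]_n) = 0.
Proof. by apply/eqP; rewrite enorm_eq0. Qed.

Lemma enorm_gt0 x : (0 < enorm x) = (x != 0).
Proof. by rewrite lt_neqAle enorm_ge0 andbT eq_sym enorm_eq0. Qed.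

Lemma enormZ a x : enorm (a *: x) = `|a| * enorm x.
Proof.
rewrite /enorm dotrVZl dotrVZr mulrA -expr2 sqrtrM ?sqr_ge0//.
by rewrite sqrtr_sqr.
Qed.

Lemma enormN x : enorm (- x) = enorm x.
Proof. by rewrite -scaleN1r enormZ normrN1 mul1r. Qed.

Lemma enormB x y : enorm (x - y) = enorm (y - x).
Proof. by rewrite -enormN opprB. Qed.

(** Expand the square of [|y|^2 x - (x . y) y]. *)
Lemma ler_norm_dotrV x y : `|dotrV x y| <= enorm x * enorm y.
Proof.
have [->|y0] := eqVneq y 0; first by rewrite dotrV0r normr0 enorm0 mulr0.
have q0 : 0 < dotrV y y by rewrite -enorm_sqr exprn_gt0// enorm_gt0.
rewrite -(@ler_pXn2r _ 2) ?nnegrE ?mulr_ge0 ?enorm_ge0// exprMn !enorm_sqr.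
rewrite -normrX ger0_norm ?sqr_ge0//.
have := dotrV_ge0 (dotrV y y *: x - dotrV x y *: y).
have -> : dotrV (dotrV y y *: x - dotrV x y *: y) (dotrV y y *: x - dotrV x y *: y) =
    dotrV y y * (dotrV x x * dotrV y y - dotrV x y ^+ 2).
  rewrite !(dotrVDl, dotrVDr, dotrVNl, dotrVNr, dotrVZl, dotrVZr) (dotrVC y x).
  by ring.
by rewrite pmulr_rge0// subr_ge0.
Qed.

Lemma ler_enormD x y : enorm (x + y) <= enorm x + enorm y.
Proof.
rewrite -(@ler_pXn2r _ 2) ?nnegrE ?addr_ge0 ?enorm_ge0// enorm_sqr sqrrD !enorm_sqr.
rewrite !dotrVDl !dotrVDr (dotrVC y x).
have := le_trans (ler_norm _) (ler_norm_dotrV x y); lra.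
Qed.

Lemma ler_enormB x y : enorm x - enorm y <= enorm (x - y).
Proof. by rewrite lerBlDr; have := ler_enormD (x - y) y; rewrite subrK. Qed.

Lemma ler_coord_enorm x i : `|x ord0 i| <= enorm x.
Proof.
rewrite -(@ler_pXn2r _ 2) ?nnegrE ?normr_ge0 ?enorm_ge0// enorm_sqr real_normK ?num_real//.
rewrite /dotrV (bigD1 i)//= -expr2 lerDl sumr_ge0// => j _.
by rewrite -expr2 sqr_ge0.
Qed.

Lemma enorm_le_sum x : enorm x <= \sum_(i < n) `|x ord0 i|.
Proof.
have s0 : 0 <= \sum_(i < n) `|x ord0 i| by apply: sumr_ge0.
rewrite -(@ler_pXn2r _ 2) ?nnegrE ?enorm_ge0// enorm_sqr expr2 mulr_suml.
apply: ler_sum => i _; rewrite -expr2 -real_normK ?num_real// expr2 ler_wpM2l//.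
by rewrite (bigD1 i)//= lerDl sumr_ge0.
Qed.

End euclidean_norm.

(** * Integrability of powers of the norm *)

Section integral_aux.
Context d (T : measurableType d) (R : realType) (mu : {measure set T -> \bar R}).
Implicit Types F G : T -> R.
Local Open Scope ereal_scope.

Lemma le_integral_fin F G : measurable_fun setT F -> measurable_fun setT G ->
  (forall x, 0 <= F x)%R -> (forall x, F x <= G x)%R ->
  \int[mu]_x (F x)%:E <= \int[mu]_x (G x)%:E.
Proof.
move=> mF mG F0 FG; apply: ge0_le_integral => //.
- by move=> x _; rewrite lee_fin.
- exact/measurable_EFinP.
- exact/measurable_EFinP.
- by move=> x _; rewrite lee_fin.
Qed.

Lemma ge0_integralZ_fin F (k : R) : (0 <= k)%R -> measurable_fun setT F ->
  (forall x, 0 <= F x)%R ->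
  \int[mu]_x (k * F x)%:E = k%:E * \int[mu]_x (F x)%:E.
Proof.
move=> k0 mF F0; under eq_integral do rewrite EFinM.
rewrite ge0_integralZl//; first exact/measurable_EFinP.
by move=> x _; rewrite lee_fin.
Qed.

Lemma ge0_integralD_fin F G : measurable_fun setT F -> measurable_fun setT G ->
  (forall x, 0 <= F x)%R -> (forall x, 0 <= G x)%R ->
  \int[mu]_x (F x + G x)%:E = \int[mu]_x (F x)%:E + \int[mu]_x (G x)%:E.
Proof.
move=> mF mG F0 G0; under eq_integral do rewrite EFinD.
rewrite ge0_integralD//.
- by move=> x _; rewrite lee_fin.
- exact/measurable_EFinP.
- by move=> x _; rewrite lee_fin.
- exact/measurable_EFinP.
Qed.

Lemma measurable_lt_nat F G : measurable_fun setT F -> measurable_fun setT G ->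
  measurable_fun setT (fun x => (F x < G x)%R%:R : R).
Proof.
move=> mF mG; have -> : (fun x => (F x < G x)%R%:R : R) =
    (fun x => if (F x < G x)%R then 1%R else 0%R).
  by apply/funext => x; case: ifP.
by apply: measurable_fun_ifT => //; exact: measurable_fun_ltr.
Qed.

Lemma measurable_le_nat F G : measurable_fun setT F -> measurable_fun setT G ->
  measurable_fun setT (fun x => (F x <= G x)%R%:R : R).
Proof.
move=> mF mG; have -> : (fun x => (F x <= G x)%R%:R : R) =
    (fun x => if (F x <= G x)%R then 1%R else 0%R).
  by apply/funext => x; case: ifP.
by apply: measurable_fun_ifT => //; exact: measurable_fun_ler.
Qed.

Lemma measurable_funpow F a : measurable_fun setT F ->
  measurable_fun setT (fun x => F x `^ a)%R.
Proof. by move=> mF; apply: (measurableT_comp (measurable_powR _)). Qed.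

End integral_aux.

Section powers.
Variables (R : realType) (n : nat).
Notation mu := (lebesgue_rV R n).
Implicit Types (x y : 'rV[R]_n) (a s r : R).

Lemma measurable_enormT : measurable_fun setT (@enorm R n).
Proof. exact: measurable_enorm. Qed.

Lemma lebesgue_ball_lty r : (\int[mu]_x (enorm x <= r)%R%:R%:E < +oo)%E.
Proof.
have mB : measurable [set x : 'rV[R]_n | (enorm x <= r)%R].
  rewrite (_ : [set _ | _] = (@enorm R n) @^-1` `]-oo, r]%classic); last first.
    by apply/seteqP; split => x /=; rewrite in_itv.
  by rewrite -[X in measurable X]setTI; exact: measurable_enormT.
have -> : (\int[mu]_x (enorm x <= r)%R%:R%:E)%E =
    mu [set x : 'rV[R]_n | (enorm x <= r)%R].
  rewrite -[X in _ = mu X]setIT -integral_indic//; apply: eq_integral => x _.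
  by rewrite indicE; congr ((nat_of_bool _)%:R%:E); apply/idP/idP; rewrite inE.
pose A := fun i : 'I_n => `[- r, r]%classic : set R.
have mA i : measurable (A i) by exact: measurable_itv.
apply: (@le_lt_trans _ _ (mu [set x | forall i, A i (x ord0 i)])).
  apply: le_measure; rewrite ?inE//; first exact: measurable_box_rV.
  move=> x /= xr i; rewrite /A /= in_itv /= -ler_norml.
  exact: le_trans (ler_coord_enorm _ _) xr.
rewrite (lebesgue_rV_box mA) ltey_eq; apply/orP; left.
apply: prode_fin_num => i _; rewrite /A lebesgue_measure_itv/=.
by case: ifP.
Qed.

(** Sum of a geometric series: the k-th term contributes
    [(c |a|^-n)^k] times the integral of [G]. *)
Lemma integral_dilations_lty (F G : 'rV[R]_n -> R) a c : a != 0 -> 0 < c ->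
  c * `|a|^-1 ^+ n < 1 ->
  measurable_fun setT F -> measurable_fun setT G ->
  (forall x, 0 <= F x) -> (forall x, 0 <= G x) ->
  (\int[mu]_x (G x)%:E < +oo)%E ->
  (forall x, exists k : nat, F x <= c ^+ k * G (a ^+ k *: x)) ->
  (\int[mu]_x (F x)%:E < +oo)%E.
Proof.
move=> a0 c0 q1 mF mG F0 G0 Goo FG.
pose f k x := (c ^+ k * G (a ^+ k *: x))%:E.
have f0 k x : (0 <= f k x)%E by rewrite lee_fin mulr_ge0// exprn_ge0// ltW.
have mf k : measurable_fun setT (f k).
  apply/measurable_EFinP/measurable_funM => //.
  by apply: (measurableT_comp mG); exact: measurable_rVZ.
pose I := fine (\int[mu]_x (G x)%:E).
have IE : (\int[mu]_x (G x)%:E)%E = I%:E.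
  rewrite /I fineK// ge0_fin_numE//; apply: integral_ge0 => x _.
  by rewrite lee_fin.
have I0 : 0 <= I by rewrite -lee_fin -IE; apply: integral_ge0 => x _; rewrite lee_fin.
set q := c * `|a|^-1 ^+ n in q1.
have q0 : 0 < q by rewrite mulr_gt0// exprn_gt0// invr_gt0 normr_gt0.
have fE k : (\int[mu]_x f k x)%E = (I * q ^+ k)%:E.
  rewrite /f ge0_integralZ_fin//; last 2 first.
  - by rewrite exprn_ge0// ltW.
  - by apply: (measurableT_comp mG); exact: measurable_rVZ.
  have mG' : measurable_fun setT (EFin \o G) by exact/measurable_EFinP.
  have E := integral_rV_affine 0 (expf_neq0 k a0) mG'.
  rewrite -[X in (_ * X)%E]/(\int[mu]_u (EFin \o G) u)%E in E.
  rewrite (_ : (\int[mu]_x (G (a ^+ k *: x)%R)%:E =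
    \int[mu]_u (EFin \o G) (a ^+ k *: u + 0)%R)%E); last first.
    by apply: eq_integral => x _; rewrite addr0.
  rewrite E /=.
  rewrite IE -!EFinM mulrA mulrC; congr (_ * _)%:E.
  by rewrite /q exprMn normrX -exprVn -!exprM mulnC.
apply: (@le_lt_trans _ _ (\int[mu]_x \big[+%E/0%R]_(0 <= k <oo) f k x)%E).
  apply: ge0_le_integral => //.
  - by move=> x _; rewrite lee_fin.
  - exact/measurable_EFinP.
  - by apply: ge0_emeasurable_sum.
  move=> x _; have [k Fk] := FG x.
  apply: (@le_trans _ _ (\sum_(0 <= i < k.+1) f i x)%E).
    rewrite big_nat_recr//=; apply: (@le_trans _ _ (f k x)).
      by rewrite lee_fin.
    by rewrite leeDr// sume_ge0.
  exact: nneseries_lim_ge.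
rewrite integral_nneseries//.
apply: (@le_lt_trans _ _ (I / (1 - q))%:E); last by rewrite ltry.
apply: lime_le.
  by apply: is_cvg_nneseries => k _ _; exact: integral_ge0.
apply: nearW => m; under eq_bigr do rewrite fE.
rewrite sumEFin lee_fin.
have := @geometric_le_lim R m I q I0 q0; rewrite gtr0_norm// => /(_ q1).
by rewrite /series /geometric.
Qed.

Lemma dyadic_ge1 (t : R) : 1 <= t -> exists k : nat, 2 ^+ k <= t <= 2 ^+ k.+1.
Proof.
move=> t1; have [m tm] : exists m : nat, t < 2 ^+ m.
  by exists (Num.bound t); exact: upper_nthrootP.
elim: m tm => [|m IHm] tm; first by rewrite expr0 ltNge t1 in tm.
by have [tm'|tm'] := ltP t (2 ^+ m); [exact: IHm|exists m; rewrite tm' ltW].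
Qed.

Lemma measurable_powN s : measurable_fun setT (fun x => enorm x `^ (- s)).
Proof. by apply: measurable_funpow; exact: measurable_enormT. Qed.

Lemma measurable_powN_lt s r :
  measurable_fun setT (fun x => enorm x `^ (- s) * (enorm x < r)%R%:R).
Proof.
apply: measurable_funM; first exact: measurable_powN.
by apply: measurable_lt_nat => //; exact: measurable_enormT.
Qed.

Lemma measurable_powN_ge s r :
  measurable_fun setT (fun x => enorm x `^ (- s) * (r <= enorm x)%R%:R).
Proof.
apply: measurable_funM; first exact: measurable_powN.
by apply: measurable_le_nat => //; exact: measurable_enormT.
Qed.

Lemma powRN_le1 s t : 0 <= s -> 1 <= t -> t `^ (- s) <= 1.
Proof.
move=> s0 t1; rewrite -(powRr0 t); apply: ler_powR => //.
by rewrite oppr_le0.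
Qed.

Lemma powRN_lt1 s t : 0 < s -> 1 < t -> t `^ (- s) < 1.
Proof.
move=> s0 t1; rewrite powRN invf_lt1 ?powR_gt0 ?(lt_trans _ t1)//.
have h := @gt0_ltr_powR R s s0 1 t; rewrite powR1 in h.
by apply: h; rewrite ?nnegrE// ltW// (lt_trans _ t1).
Qed.

(** Dyadic decomposition: if [2^-(k+1) < |x| <= 2^-k], the dilation by [2^(k+1)]
    moves [x] to the shell between [1] and [2]. The exponent enters only
    through the convergence of the geometric series, [2^s 2^-n < 1]. *)
Lemma integral_powN_lt1 s : 0 <= s -> s < n%:R ->
  (\int[mu]_x (enorm x `^ (- s) * (enorm x < 1)%R%:R)%:E < +oo)%E.
Proof.
rewrite le_eqVlt => /predU1P[<- _|s0 sn].
  apply: le_lt_trans (lebesgue_ball_lty 1); apply: le_integral_fin => //.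
  - exact: measurable_powN_lt.
  - by apply: measurable_le_nat => //; exact: measurable_enormT.
  - by move=> x; rewrite mulr_ge0// powR_ge0.
  - by move=> x; rewrite oppr0 powRr0 mul1r; case: ltP => // /ltW ->.
apply: (@integral_dilations_lty (fun x => enorm x `^ (- s) * (enorm x < 1)%R%:R)
  (fun x => (enorm x <= 2)%R%:R) 2 (2 `^ s)) => //.
- rewrite ger0_norm// exprVn -powR_mulrn// -powRN -powRD; last by rewrite pnatr_eq0 implybT.
  by rewrite -opprB powRN_lt1 ?subr_gt0 ?ltr1n.
- exact: measurable_powN_lt.
- by apply: measurable_le_nat => //; exact: measurable_enormT.
- by move=> x; rewrite mulr_ge0// powR_ge0.
- exact: lebesgue_ball_lty.
move=> x; have [->|x0] := eqVneq x 0.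
  by exists 0%N; rewrite enorm0 powR0 ?mul0r ?mulr_ge0// oppr_eq0 gt_eqF.
have e0 : 0 < enorm x by rewrite enorm_gt0.
have [x1|x1] := ltP (enorm x) 1; last first.
  by exists 0%N; rewrite mulr0 mulr_ge0.
have [k /andP[k1 k2]] : exists k : nat, 2 ^+ k <= (enorm x)^-1 <= 2 ^+ k.+1.
  by apply: dyadic_ge1; rewrite invf_ge1// ltW.
exists k.+1; rewrite mulr1 enormZ ger0_norm ?exprn_ge0//.
have -> : 2 ^+ k.+1 * enorm x <= 2.
  rewrite exprS -mulrA -[leRHS]mulr1 ler_pM2l//.
  by rewrite -ler_pdivlMr // div1r.
rewrite mulr1 -powR_mulrn ?powR_ge0// -powRrM.
have h1 : 1 <= 2 ^+ k.+1 * enorm x.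
  by rewrite -ler_pdivrMr // div1r.
have h2 : (2 ^+ k.+1 * enorm x) `^ (- s) <= 1 by apply: powRN_le1 => //; exact: ltW.
rewrite powRM ?exprn_ge0 ?enorm_ge0// in h2.
rewrite mulrC powRrM powR_mulrn// -[leRHS]mulr1.
rewrite -(@ler_pM2l _ ((2 ^+ k.+1) `^ (- s))) ?powR_gt0 ?exprn_gt0//.
by rewrite (le_trans h2)// mulrA -powRD ?addNr ?powRr0 ?mul1r// expf_neq0 ?implybT.
Qed.

Lemma integral_powN_ge1 s : n%:R < s ->
  (\int[mu]_x (enorm x `^ (- s) * (1 <= enorm x)%R%:R)%:E < +oo)%E.
Proof.
move=> sn; have s0 : 0 <= s by rewrite (le_trans _ (ltW sn)).
apply: (@integral_dilations_lty (fun x => enorm x `^ (- s) * (1 <= enorm x)%R%:R)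
  (fun x => (enorm x <= 2)%R%:R) 2^-1 (2 `^ (- s))) => //.
- rewrite ger0_norm// invrK -powR_mulrn// -powRD; last by rewrite pnatr_eq0 implybT.
  by rewrite addrC -opprB powRN_lt1 ?subr_gt0 ?ltr1n.
- exact: measurable_powN_ge.
- by apply: measurable_le_nat => //; exact: measurable_enormT.
- by move=> x; rewrite mulr_ge0// powR_ge0.
- exact: lebesgue_ball_lty.
move=> x; have [x1|x1] := leP 1 (enorm x); last first.
  by exists 0%N; rewrite mulr0 mulr_ge0.
have [k /andP[k1 k2]] := dyadic_ge1 x1.
exists k; rewrite mulr1 enormZ ger0_norm ?exprn_ge0// exprVn.
have p0 : (0 : R) < 2 ^+ k by rewrite exprn_gt0.
have -> : (2 ^+ k)^-1 * enorm x <= 2 by rewrite ler_pdivrMl// -exprSr.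
rewrite mulr1 -powR_mulrn ?powR_ge0// -powRrM mulrC powRrM powR_mulrn//.
rewrite !powRN lef_pV2 ?posrE ?powR_gt0// ?(lt_le_trans p0)//.
by rewrite ge0_ler_powR// nnegrE ?ltW// (lt_le_trans p0).
Qed.

End powers.

Section powers_scaled.
Variables (R : realType) (n : nat).
Notation mu := (lebesgue_rV R n).
Implicit Types (x b : 'rV[R]_n) (s r : R).

(** The shape shared by the two lemmas below on balls of any centre and
    radius: a power function of the radius times the value for radius one. *)
Lemma integral_scaled (F : 'rV[R]_n -> R) s : measurable_fun setT F ->
  (forall x, 0 <= F x) -> (\int[mu]_x (F x)%:E < +oo)%E ->
  exists2 C : R, 0 <= C & forall b r, 0 < r ->
    (\int[mu]_x (r `^ (- s) * F (r^-1 *: (x - b)))%:E = (C * r `^ (n%:R - s))%:E)%E.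
Proof.
move=> mF F0 Foo; pose C := fine (\int[mu]_x (F x)%:E).
have CE : (\int[mu]_x (F x)%:E)%E = C%:E.
  rewrite /C fineK// ge0_fin_numE//; apply: integral_ge0 => x _.
  by rewrite lee_fin.
have C0 : 0 <= C by rewrite -lee_fin -CE; apply: integral_ge0 => x _; rewrite lee_fin.
exists C => // b r r0.
have mF' : measurable_fun setT (EFin \o F) by exact/measurable_EFinP.
have r1 : r^-1 != 0 by rewrite invr_eq0 gt_eqF.
rewrite ge0_integralZ_fin ?powR_ge0//; last first.
  by apply: (measurableT_comp mF); apply: measurable_rVZ => //; exact: measurable_rVB.
have E := integral_rV_affine (- (r^-1 *: b)) r1 mF'.
have -> : (\int[mu]_x (F (r^-1 *: (x - b)))%:E =
    \int[mu]_u (EFin \o F) (r^-1 *: u + - (r^-1 *: b))%R)%E.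
  by apply: eq_integral => x _; rewrite /= scalerBr.
rewrite E /= CE -!EFinM normfV invrK gtr0_norm// mulrA mulrC; congr (_ * _)%:E.
rewrite -powR_mulrn ?ltW// -powRD; last by apply/implyP; rewrite (gt_eqF r0).
by rewrite addrC.
Qed.

Lemma integral_powN_lt s : 0 <= s -> s < n%:R ->
  exists2 C : R, 0 <= C & forall b r, 0 < r ->
    (\int[mu]_x (enorm (x - b) `^ (- s) * (enorm (x - b) < r)%R%:R)%:E =
     (C * r `^ (n%:R - s))%:E)%E.
Proof.
move=> s0 sn; have [||C C0 CE] := @integral_scaled _ s (measurable_powN_lt s 1).
- by move=> x; rewrite mulr_ge0// powR_ge0.
- exact: integral_powN_lt1.
exists C => // b r r0; rewrite -(CE b r r0); apply: eq_integral => x _; congr EFin.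
rewrite enormZ gtr0_norm ?invr_gt0// powRM ?invr_ge0 ?enorm_ge0 ?(ltW r0)//.
rewrite mulrA mulrA -powRM ?invr_ge0 ?(ltW r0)// divff ?gt_eqF// powR1 mul1r.
by rewrite [r^-1 * _]mulrC ltr_pdivrMr// mul1r.
Qed.

Lemma integral_powN_ge s : n%:R < s ->
  exists2 C : R, 0 <= C & forall b r, 0 < r ->
    (\int[mu]_x (enorm (x - b) `^ (- s) * (r <= enorm (x - b))%R%:R)%:E =
     (C * r `^ (n%:R - s))%:E)%E.
Proof.
move=> sn; have [||C C0 CE] := @integral_scaled _ s (measurable_powN_ge s 1).
- by move=> x; rewrite mulr_ge0// powR_ge0.
- exact: integral_powN_ge1.
exists C => // b r r0; rewrite -(CE b r r0); apply: eq_integral => x _; congr EFin.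
rewrite enormZ gtr0_norm ?invr_gt0// powRM ?invr_ge0 ?enorm_ge0 ?(ltW r0)//.
rewrite mulrA mulrA -powRM ?invr_ge0 ?(ltW r0)// divff ?gt_eqF// powR1 mul1r.
by rewrite [r^-1 * _]mulrC ler_pdivlMr// mul1r.
Qed.

(** The sup norm balls with rational centres and radii form a countable
    basis of the topology, and they are boxes. *)
Lemma open_measurable_rV (U : set 'rV[R]_n) : open U -> measurable U.
Proof.
move=> oU.
pose V (p : 'rV[rat]_n * rat) : set 'rV[R]_n :=
  [set x | forall i, `](ratr (p.1 ord0 i) - ratr p.2), (ratr (p.1 ord0 i) + ratr p.2)[%classic
     (x ord0 i)].
have mV p : measurable (V p).
  apply: (@measurable_box_rV R n (fun i => `](ratr (p.1 ord0 i) - ratr p.2),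
    (ratr (p.1 ord0 i) + ratr p.2)[%classic)) => i; exact: measurable_itv.
pose W p := if `[< V p `<=` U >] then V p else set0.
suff -> : U = \bigcup_p W p.
  apply: countable_bigcupT_measurable => [|p]; first exact: countableP.
  by rewrite /W; case: ifP.
apply/seteqP; split => [x Ux|x [p _]]; last first.
  by rewrite /W; case: ifPn => // /asboolP; exact.
have /nbhs_ballP[e /= e0 xeU] : nbhs x U by exact: open_nbhs_nbhs.
have [r /andP[r1 r2]] : exists r : rat, e / 4 < ratr r < e / 2.
  have /rat_in_itvoo[r rI] : e / 4 < e / 2 by lra.
  by exists r; move: rI; rewrite inE.
have r0 : 0 < ratr r :> R by lra.
have qP i : exists q : rat, x ord0 i - ratr r < ratr q < x ord0 i + ratr r.
  have /rat_in_itvoo[q qI] : x ord0 i - ratr r < x ord0 i + ratr r by lra.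
  by exists q; move: qI; rewrite inE.
have [q0 q0E] := choice qP; pose q : 'rV[rat]_n := \row_i q0 i.
have qE i : x ord0 i - ratr r < ratr (q ord0 i) < x ord0 i + ratr r.
  by rewrite mxE.
exists (q, r) => //; rewrite /W.
have Vx : V (q, r) x.
  move=> i /=; rewrite in_itv/=; have /andP[] := qE i; lra.
case: ifPn => // /asboolP[] y Vy; apply: xeU; split => // i j.
rewrite (ord1 i) /ball /= ltr_distlC.
have /andP[] := qE j; have := Vy j; rewrite /= in_itv /= => /andP[]; lra.
Qed.

Lemma continuous_measurable_rV (f : 'rV[R]_n -> R) : continuous f ->
  measurable_fun setT f.
Proof.
move=> cf; apply: (measurability _ (RGenOInfty.measurableE R)) => //.
move=> _ [_ [a ->] <-]; rewrite setTI; apply: open_measurable_rV.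
by move/continuousP : cf; apply; exact: interval_open.
Qed.

End powers_scaled.

(** * Complex-valued integrals *)

Import Normc.

Section complex_aux.
Variable R : realType.
Implicit Types (z w : R[i]) (t : R).

Lemma ReD z w : complex.Re (z + w) = complex.Re z + complex.Re w.
Proof. by case: z; case: w. Qed.

Lemma ImD z w : complex.Im (z + w) = complex.Im z + complex.Im w.
Proof. by case: z; case: w. Qed.

Lemma ReN z : complex.Re (- z) = - complex.Re z. Proof. by case: z. Qed.

Lemma ImN z : complex.Im (- z) = - complex.Im z. Proof. by case: z. Qed.

Lemma ReM z w : complex.Re (z * w) =
  complex.Re z * complex.Re w - complex.Im z * complex.Im w.
Proof. by case: z; case: w. Qed.

Lemma ImM z w : complex.Im (z * w) =
  complex.Re z * complex.Im w + complex.Im z * complex.Re w.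
Proof. by case: z; case: w. Qed.

Lemma complexP z w : complex.Re z = complex.Re w ->
  complex.Im z = complex.Im w -> z = w.
Proof. by case: z; case: w => /= ? ? ? ? -> ->. Qed.

Lemma normcE z : normc z = Num.sqrt (complex.Re z ^+ 2 + complex.Im z ^+ 2).
Proof. by case: z. Qed.

Lemma normc_ge0 z : 0 <= normc z.
Proof. by rewrite normcE sqrtr_ge0. Qed.

Lemma normcD z w : normc (z + w) <= normc z + normc w.
Proof. exact: (le_normcD (z : Rcomplex R) (w : Rcomplex R)). Qed.

Lemma normcNE z : normc (- z) = normc z.
Proof. by case: z => a b /=; rewrite !sqrrN. Qed.

Lemma normcBC z w : normc (z - w) = normc (w - z).
Proof. by rewrite -normcNE opprB. Qed.

Lemma normc_real t : normc (t%:C)%C = `|t|.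
Proof. by rewrite /= expr0n/= addr0 sqrtr_sqr. Qed.

Lemma normc_eq0E z : (normc z == 0) = (z == 0).
Proof.
by apply/eqP/eqP => [/eq0_normc//|->]; rewrite normc0.
Qed.

Lemma normc_sum I (r : seq I) (P : pred I) (F : I -> R[i]) :
  normc (\sum_(i <- r | P i) F i) <= \sum_(i <- r | P i) normc (F i).
Proof.
elim/big_rec2: _ => [|i x z _ xz]; first by rewrite normc0.
by rewrite (le_trans (normcD _ _))// lerD2l.
Qed.

Lemma Re_le_normc z : `|complex.Re z| <= normc z.
Proof.
by rewrite normcE -sqrtr_sqr ler_wsqrtr// lerDl sqr_ge0.
Qed.

Lemma Im_le_normc z : `|complex.Im z| <= normc z.
Proof.
by rewrite normcE -sqrtr_sqr ler_wsqrtr// lerDr sqr_ge0.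
Qed.

Lemma normc_le_ReIm z : normc z <= `|complex.Re z| + `|complex.Im z|.
Proof.
rewrite -(@ler_pXn2r _ 2) ?nnegrE ?normc_ge0 ?addr_ge0// normcE.
rewrite sqr_sqrtr ?addr_ge0 ?sqr_ge0// sqrrD !real_normK ?num_real//.
by rewrite lerD2r lerDl mulrn_wge0// mulr_ge0.
Qed.

Lemma normc_cexpi t : normc (cexpi t) = 1.
Proof. by rewrite /= cos2Dsin2 sqrtr1. Qed.

Lemma cexpiD (s t : R) : cexpi (s + t) = cexpi s * cexpi t.
Proof.
by apply: complexP; rewrite ?ReM ?ImM /= ?cosD ?sinD//; ring.
Qed.

End complex_aux.

Section cmeasurable.
Context (R : realType) d (T : measurableType d).
Implicit Types (h k : T -> R[i]) (r : T -> R).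

(** As [cmeasurable], but on any measurable space, so as to speak of kernels
    on a product. *)
Definition cmeas h := measurable_fun setT (fun x => complex.Re (h x)) /\
  measurable_fun setT (fun x => complex.Im (h x)).

Lemma cmeas_cst z : cmeas (fun=> z).
Proof. by split; exact: measurable_cst. Qed.

Lemma cmeasD h k : cmeas h -> cmeas k -> cmeas (fun x => h x + k x).
Proof.
move=> [h1 h2] [k1 k2]; split.
  by under eq_fun do rewrite ReD; exact: measurable_funD.
by under eq_fun do rewrite ImD; exact: measurable_funD.
Qed.

Lemma cmeasN h : cmeas h -> cmeas (fun x => - h x).
Proof.
move=> [h1 h2]; split.
  by under eq_fun do rewrite ReN; apply: measurable_funN.
by under eq_fun do rewrite ImN; exact: measurable_funN.
Qed.

Lemma cmeasB h k : cmeas h -> cmeas k -> cmeas (fun x => h x - k x).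
Proof. by move=> mh mk; apply: cmeasD => //; exact: cmeasN. Qed.

Lemma cmeasM h k : cmeas h -> cmeas k -> cmeas (fun x => h x * k x).
Proof.
move=> [h1 h2] [k1 k2]; split.
  under eq_fun do rewrite ReM.
  by apply: measurable_funB; exact: measurable_funM.
under eq_fun do rewrite ImM.
by apply: measurable_funD; exact: measurable_funM.
Qed.

Lemma cmeas_real r : measurable_fun setT r -> cmeas (fun x => (r x)%:C%C).
Proof. by move=> mr; split => //=; exact: (measurable_cst (0:R)). Qed.

Lemma cmeas_cexpi r : measurable_fun setT r -> cmeas (fun x => cexpi (r x)).
Proof.
move=> mr; split => /=; apply: measurableT_comp => //.
  by apply: continuous_measurable_fun; exact: continuous_cos.
by apply: continuous_measurable_fun; exact: continuous_sin.
Qed.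

Lemma cmeas_normc h : cmeas h -> measurable_fun setT (fun x => normc (h x)).
Proof.
move=> [h1 h2]; under eq_fun do rewrite normcE.
apply: (measurableT_comp (f := @Num.sqrt R)).
  by apply: continuous_measurable_fun; exact: sqrt_continuous.
exact: (measurable_funD (measurable_funX 2 h1) (measurable_funX 2 h2)).
Qed.

End cmeasurable.

Lemma cmeas_comp (R : realType) d1 d2 (T1 : measurableType d1)
    (T2 : measurableType d2) (h : T2 -> R[i]) (f : T1 -> T2) :
  cmeas h -> measurable_fun setT f -> cmeas (fun x => h (f x)).
Proof.
move=> [h1 h2] mf; split; first exact: (measurableT_comp h1 mf).
exact: (measurableT_comp h2 mf).
Qed.

Section cintegrable.
Variables (R : realType) (n : nat).
Notation mu := (lebesgue_rV R n).
Implicit Types (h k : 'rV[R]_n -> R[i]) (z : R[i]).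

Definition cintegrable h := cmeas h /\ (\int[mu]_x (normc (h x))%:E < +oo)%E.

Lemma cintegrable_le h (b : 'rV[R]_n -> R) : cmeas h ->
  measurable_fun setT b -> (forall x, normc (h x) <= b x) ->
  (\int[mu]_x (b x)%:E < +oo)%E -> cintegrable h.
Proof.
move=> mh mb hb boo; split => //; apply: le_lt_trans boo.
by apply: le_integral_fin => //; [exact: cmeas_normc|move=> x; exact: normc_ge0].
Qed.

Lemma ge0_integrable_fin (b : 'rV[R]_n -> R) : measurable_fun setT b ->
  (forall x, 0 <= b x) -> (\int[mu]_x (b x)%:E < +oo)%E ->
  mu.-integrable setT (EFin \o b).
Proof.
move=> mb b0 boo; apply/integrableP; split; first exact/measurable_EFinP.
under eq_integral do rewrite /= ger0_norm//.
exact: boo.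
Qed.

Lemma cintegrable_normc h : cintegrable h ->
  mu.-integrable setT (fun x => (normc (h x))%:E).
Proof.
move=> [mh hoo]; apply: ge0_integrable_fin => //; first exact: cmeas_normc.
by move=> x; exact: normc_ge0.
Qed.

Lemma cintegrable_Re h : cintegrable h ->
  mu.-integrable setT (EFin \o (fun x => complex.Re (h x))).
Proof.
move=> ih; have [[h1 h2] _] := ih.
apply: le_integrable (cintegrable_normc ih) => //; first exact/measurable_EFinP.
by move=> x _ /=; rewrite lee_fin (ger0_norm (normc_ge0 _)) Re_le_normc.
Qed.

Lemma cintegrable_Im h : cintegrable h ->
  mu.-integrable setT (EFin \o (fun x => complex.Im (h x))).
Proof.
move=> ih; have [[h1 h2] _] := ih.
apply: le_integrable (cintegrable_normc ih) => //; first exact/measurable_EFinP.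
by move=> x _ /=; rewrite lee_fin (ger0_norm (normc_ge0 _)) Im_le_normc.
Qed.

Lemma cintegrableP h : mu.-integrable setT (fun x => (complex.Re (h x))%:E) ->
  mu.-integrable setT (fun x => (complex.Im (h x))%:E) -> cintegrable h.
Proof.
move=> hr hi.
have mr := measurable_int _ hr; have mi := measurable_int _ hi.
move/measurable_EFinP in mr; move/measurable_EFinP in mi.
have := integrableD measurableT (integrable_abse hr) (integrable_abse hi).
move=> /integrableP[_ rioo].
apply: (@cintegrable_le _ (fun x => `|complex.Re (h x)| + `|complex.Im (h x)|)) => //.
- by apply: measurable_funD; exact: measurableT_comp.
- by move=> x; exact: normc_le_ReIm.
move: rioo; under eq_integral do rewrite /= ger0_norm ?addr_ge0//.
by [].
Qed.

Lemma cintegrableD h k : cintegrable h -> cintegrable k ->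
  cintegrable (fun x => h x + k x).
Proof.
move=> [mh hoo] [mk koo].
apply: (@cintegrable_le _ (fun x => normc (h x) + normc (k x))).
- exact: cmeasD.
- by apply: measurable_funD; exact: cmeas_normc.
- by move=> x; exact: normcD.
rewrite ge0_integralD_fin; [exact: lte_add_pinfty|..].
- exact: cmeas_normc.
- exact: cmeas_normc.
- by move=> x; exact: normc_ge0.
- by move=> x; exact: normc_ge0.
Qed.

Lemma cintegrableM h k (B : R) : cmeas h -> (forall x, normc (h x) <= B) ->
  cintegrable k -> cintegrable (fun x => h x * k x).
Proof.
move=> mh hB [mk koo].
have B0 : 0 <= B by apply: le_trans (hB 0); exact: normc_ge0.
have mk' := cmeas_normc mk.
apply: (@cintegrable_le _ (fun x => B * normc (k x))).
- exact: cmeasM.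
- exact: measurable_funM.
- by move=> x; rewrite normcM ler_wpM2r// normc_ge0.
rewrite ge0_integralZ_fin//; last by move=> x; exact: normc_ge0.
by rewrite lte_mul_pinfty// lee_fin.
Qed.

Lemma cintegrableZ z h : cintegrable h -> cintegrable (fun x => z * h x).
Proof.
move=> ih; apply: (@cintegrableM (fun=> z) h (normc z)) => //; exact: cmeas_cst.
Qed.

Lemma eq_cintegral h k : h =1 k -> cintegral h = cintegral k.
Proof. by move=> hk; congr cintegral; apply/funext. Qed.

Lemma cintegral0 : cintegral (fun _ : 'rV[R]_n => 0 : R[i]) = 0.
Proof.
by rewrite /cintegral /Rintegral !integral0.
Qed.

Lemma cintegralD h k : cintegrable h -> cintegrable k ->
  cintegral (fun x => h x + k x) = cintegral h + cintegral k.
Proof.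
move=> ih ik; apply: complexP; rewrite ?ReD ?ImD /=.
  under eq_Rintegral do rewrite ReD.
  by rewrite RintegralD//; exact: cintegrable_Re.
under eq_Rintegral do rewrite ImD.
by rewrite RintegralD//; exact: cintegrable_Im.
Qed.

Lemma integrableZ_fin (r : R) (f : 'rV[R]_n -> R) :
  mu.-integrable setT (EFin \o f) ->
  mu.-integrable setT (EFin \o (fun x => r * f x)).
Proof.
move=> fi; have := integrableZl measurableT r fi.
by apply: eq_integrable => // x _ /=; rewrite EFinM.
Qed.

Lemma cintegralZ z h : cintegrable h ->
  cintegral (fun x => z * h x) = z * cintegral h.
Proof.
move=> ih; have ir := cintegrable_Re ih; have ii := cintegrable_Im ih.
apply: complexP; rewrite ?ReM ?ImM /=.
  under eq_Rintegral do rewrite ReM.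
  by rewrite RintegralB ?RintegralZl//; exact: integrableZ_fin.
under eq_Rintegral do rewrite ImM.
by rewrite RintegralD ?RintegralZl//; exact: integrableZ_fin.
Qed.

Lemma cintegrable_sum I (s : seq I) (F : I -> 'rV[R]_n -> R[i]) :
  (forall i, cintegrable (F i)) -> cintegrable (fun x => \sum_(i <- s) F i x).
Proof.
move=> iF; elim: s => [|i s IHs].
  under eq_fun do rewrite big_nil; split; first exact: cmeas_cst.
  by under eq_integral do rewrite normc0; rewrite integral0.
by under eq_fun do rewrite big_cons; exact: cintegrableD.
Qed.

Lemma cintegral_sum I (s : seq I) (F : I -> 'rV[R]_n -> R[i]) :
  (forall i, cintegrable (F i)) ->
  cintegral (fun x => \sum_(i <- s) F i x) = \sum_(i <- s) cintegral (F i).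
Proof.
move=> iF; elim: s => [|i s IHs].
  by under eq_fun do rewrite big_nil; rewrite big_nil cintegral0.
under eq_fun do rewrite big_cons; rewrite big_cons cintegralD ?IHs//.
exact: cintegrable_sum.
Qed.

(** The constant [2] comes from estimating real and imaginary parts
    separately. *)
Lemma le_normc_cintegral h : cmeas h ->
  ((normc (cintegral h))%:E <= 2%:E * \int[mu]_x (normc (h x))%:E)%E.
Proof.
move=> mh; have [hoo|] := ltP (\int[mu]_x (normc (h x))%:E)%E +oo%E; last first.
  by rewrite leye_eq => /eqP ->; rewrite gt0_muley ?leey ?lte_fin.
have ih : cintegrable h by [].
have [h1 h2] := mh.
apply: (@le_trans _ _ (\int[mu]_x (`|complex.Re (h x)|)%:E +
    \int[mu]_x (`|complex.Im (h x)|)%:E)%E).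
  apply: (@le_trans _ _ (`|\int[mu]_x complex.Re (h x)|%:E +
      `|\int[mu]_x complex.Im (h x)|%:E)%E).
    by rewrite -EFinD lee_fin; exact: (normc_le_ReIm (cintegral h)).
  rewrite (EFin_normr_Rintegral measurableT (cintegrable_Re ih)).
  rewrite (EFin_normr_Rintegral measurableT (cintegrable_Im ih)).
  apply: leeD; apply: le_abse_integral => //; exact/measurable_EFinP.
have -> : (2%:E * \int[mu]_x (normc (h x))%:E =
   \int[mu]_x (normc (h x))%:E + \int[mu]_x (normc (h x))%:E)%E.
  by rewrite -mule2n mule_natl.
have mn := cmeas_normc mh.
apply: leeD; apply: le_integral_fin => //.
- exact: measurableT_comp.
- by move=> x; exact: Re_le_normc.
- exact: measurableT_comp.
- by move=> x; exact: Im_le_normc.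
Qed.

End cintegrable.

Section real_fubini.
Context (R : realType) d1 d2 (T1 : measurableType d1) (T2 : measurableType d2).
Variables (m1 : {sigma_finite_measure set T1 -> \bar R})
  (m2 : {sigma_finite_measure set T2 -> \bar R}).

Lemma measurable_Rintegral (f : T1 * T2 -> R) : measurable_fun setT f ->
  measurable_fun setT (fun x => \int[m2]_y f (x, y)).
Proof.
move=> mf; have mf' : measurable_fun setT (EFin \o f) by exact/measurable_EFinP.
have -> : (fun x => \int[m2]_y f (x, y)) = fun x => fine
    (\int[m2]_y ((EFin \o f)^\+ (x, y)) - \int[m2]_y ((EFin \o f)^\- (x, y)))%E.
  apply/funext => x; rewrite /Rintegral integralE; congr fine.
  by congr (_ - _)%E; apply: eq_integral => y _; rewrite ?funeposE ?funenegE.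
apply: (measurableT_comp (f := @fine R)); first exact: fine_measurable.
apply: emeasurable_funB.
  apply: (measurable_fun_fubini_tonelli_F (EFin \o f)^\+%E).
    exact: measurable_funepos.
  by move=> z; exact: funepos_ge0.
apply: (measurable_fun_fubini_tonelli_F (EFin \o f)^\-%E).
  exact: measurable_funeneg.
by move=> z; exact: funeneg_ge0.
Qed.

(** The inner real integral is [0] by convention where the extended one is
    infinite, which happens on a null set only. *)
Lemma Rintegral_prod_lr (f : T1 * T2 -> R) :
  (m1 \x m2)%E.-integrable setT (EFin \o f) ->
  (\int[m1]_x (\int[m2]_y f (x, y))%:E = \int[m1]_x \int[m2]_y (f (x, y))%:E)%E.
Proof.
move=> fi; have Fi := integrable_fubini_F fi.
have mf : measurable_fun setT f.
  by have /measurable_EFinP := measurable_int _ fi.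
apply: ae_eq_integral => //.
- by apply/measurable_EFinP; exact: measurable_Rintegral.
- exact: (measurable_int _ Fi).
have := integrable_ae measurableT Fi; apply: filterS => x /= Fx _.
by rewrite /Rintegral fineK//; exact: Fx.
Qed.

Lemma Rintegral_prod_rl (f : T1 * T2 -> R) :
  (m1 \x m2)%E.-integrable setT (EFin \o f) ->
  (\int[m2]_y (\int[m1]_x f (x, y))%:E = \int[m2]_y \int[m1]_x (f (x, y))%:E)%E.
Proof.
move=> fi; have Gi : m2.-integrable setT (fun y => \int[m1]_x (f (x, y))%:E)%E.
  pose sw (p : T2 * T1) := (p.2, p.1).
  have ms : measurable_fun setT sw.
    by apply: measurable_fun_pair; [exact: measurable_snd|exact: measurable_fst].
  have mf := measurable_int _ fi.
  have si : (m2 \x m1)%E.-integrable setT (EFin \o f \o sw).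
    apply/integrable12ltyP; first exact: (measurableT_comp mf ms).
    by have /integrable21ltyP := fi; apply.
  exact: (integrable_fubini_F si).
have mf : measurable_fun setT f.
  by have /measurable_EFinP := measurable_int _ fi.
have mG := measurable_int _ Gi.
apply: ae_eq_integral => //.
  apply/measurable_EFinP; rewrite /Rintegral.
  by apply: (measurableT_comp (f := @fine R)) => //; exact: fine_measurable.
have := integrable_ae measurableT Gi; apply: filterS => x /= Gx _.
by rewrite /Rintegral fineK//; exact: Gx.
Qed.

Lemma Rfubini (f : T1 * T2 -> R) :
  (m1 \x m2)%E.-integrable setT (EFin \o f) ->
  \int[m1]_x (\int[m2]_y f (x, y)) = \int[m2]_y (\int[m1]_x f (x, y)).
Proof.
move=> fi; rewrite [LHS]/Rintegral [RHS]/Rintegral; congr fine.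
rewrite Rintegral_prod_lr// Rintegral_prod_rl//.
exact: (Fubini fi).
Qed.

End real_fubini.

Section complex_fubini.
Variables (R : realType) (n m : nat).
Notation mu := (lebesgue_rV R n).
Notation nu := (lebesgue_rV R m).
Variable K : 'rV[R]_n -> 'rV[R]_m -> R[i].
Hypothesis mK : cmeas (fun p : 'rV[R]_n * 'rV[R]_m => K p.1 p.2).

Lemma cmeas_cintegral : cmeas (fun x => cintegral (K x)).
Proof.
have [m1 m2] := mK; split.
  exact: (measurable_Rintegral nu m1).
exact: (measurable_Rintegral nu m2).
Qed.

Lemma cmeas_slice x : cmeas (K x).
Proof.
apply: (cmeas_comp (f := pair x) mK).
exact: pair1_measurable.
Qed.

Lemma measurable_normc_int :
  measurable_fun setT (fun x => \int[nu]_y (normc (K x y))%:E)%E.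
Proof.
apply: (measurable_fun_fubini_tonelli_F (fun p => (normc (K p.1 p.2))%:E)).
  by apply/measurable_EFinP; exact: cmeas_normc.
by move=> p; rewrite lee_fin normc_ge0.
Qed.

Lemma le_normc_cintegral_int :
  (\int[mu]_x (normc (cintegral (K x)))%:E <=
   2%:E * \int[mu]_x \int[nu]_y (normc (K x y))%:E)%E.
Proof.
have i0 x : (0 <= \int[nu]_y (normc (K x y))%:E)%E.
  by apply: integral_ge0 => y _; rewrite lee_fin normc_ge0.
rewrite -ge0_integralZl//; last exact: measurable_normc_int.
apply: ge0_le_integral => //.
- by move=> x _; rewrite lee_fin normc_ge0.
- apply/measurable_EFinP; apply: cmeas_normc; exact: cmeas_cintegral.
- by apply: measurable_funeM; exact: measurable_normc_int.
- by move=> x _; apply: le_normc_cintegral; exact: cmeas_slice.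
Qed.

Hypothesis Koo : (\int[mu]_x \int[nu]_y (normc (K x y))%:E < +oo)%E.

Lemma integrable_prod_le (r : 'rV[R]_n * 'rV[R]_m -> R) :
  measurable_fun setT r -> (forall p, `|r p| <= normc (K p.1 p.2)) ->
  (mu \x nu)%E.-integrable setT (EFin \o r).
Proof.
move=> mr rK; apply/integrable12ltyP; first exact/measurable_EFinP.
apply: le_lt_trans Koo; apply: ge0_le_integral => //.
- by move=> x _; exact: integral_ge0.
- apply: (measurable_fun_fubini_tonelli_F (fun p => `|(r p)%:E|%E)) => //.
  by apply: measurableT_comp => //; exact/measurable_EFinP.
- exact: measurable_normc_int.
move=> x _; apply: ge0_le_integral => //.
- apply: measurableT_comp => //; apply/measurable_EFinP.
  by apply: (measurableT_comp mr); exact: pair1_measurable.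
- by apply/measurable_EFinP; apply: cmeas_normc; exact: cmeas_slice.
- by move=> y _; rewrite lee_fin; exact: (rK (x, y)).
Qed.

Lemma cfubini : cintegral (fun x => cintegral (K x)) =
  cintegral (fun y => cintegral (K^~ y)).
Proof.
have [m1 m2] := mK; apply: complexP => /=.
  apply: (Rfubini (f := fun p => complex.Re (K p.1 p.2))).
  by apply: integrable_prod_le => // p; exact: Re_le_normc.
apply: (Rfubini (f := fun p => complex.Im (K p.1 p.2))).
by apply: integrable_prod_le => // p; exact: Im_le_normc.
Qed.

End complex_fubini.

Section complex_affine.
Variables (R : realType) (n : nat).
Notation mu := (lebesgue_rV R n).
Implicit Types (h : 'rV[R]_n -> R[i]) (b : 'rV[R]_n).

Lemma Rintegral_affine (a : R) b (f : 'rV[R]_n -> R) : a != 0 ->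
  measurable_fun setT f ->
  \int[mu]_x f (a *: x + b) = `|a|^-1 ^+ n * \int[mu]_x f x.
Proof.
move=> a0 mf; rewrite /Rintegral.
have mf' : measurable_fun setT (EFin \o f) by exact/measurable_EFinP.
rewrite (integral_rV_affine b a0 mf').
have c0 : 0 < `|a|^-1 ^+ n by rewrite exprn_gt0// invr_gt0 normr_gt0.
case: (integral _ _ _) => [r| |]//=.
  by rewrite gt0_muley ?lte_fin//= mulr0.
by rewrite gt0_muleNy ?lte_fin//= mulr0.
Qed.

Lemma cintegral_affine (a : R) b h : a != 0 -> cmeas h ->
  cintegral (fun x => h (a *: x + b)) = ((`|a|^-1 ^+ n)%:C)%C * cintegral h.
Proof.
move=> a0 [m1 m2]; apply: complexP; rewrite ?ReM ?ImM /= mul0r ?subr0 ?addr0.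
  by rewrite -(Rintegral_affine b a0 m1).
by rewrite -(Rintegral_affine b a0 m2).
Qed.

Lemma cintegral_translate b h : cmeas h ->
  cintegral (fun x => h (x + b)) = cintegral h.
Proof.
move=> mh; have := @cintegral_affine 1 b h (oner_neq0 _) mh.
rewrite normr1 invr1 expr1n mul1r => <-.
by apply: eq_cintegral => x; rewrite scale1r.
Qed.

Lemma Rintegral_translate b (f : 'rV[R]_n -> R) : measurable_fun setT f ->
  \int[mu]_x f (x + b) = \int[mu]_x f x.
Proof.
move=> mf; have := @Rintegral_affine 1 b f (oner_neq0 _) mf.
rewrite normr1 invr1 expr1n mul1r => <-.
by apply: eq_Rintegral => x _; rewrite scale1r.
Qed.

Lemma ge0_integral_translate b (f : 'rV[R]_n -> R) : measurable_fun setT f ->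
  (\int[mu]_x (f (x + b))%:E = \int[mu]_x (f x)%:E)%E.
Proof.
move=> mf; have mf' : measurable_fun setT (EFin \o f) by exact/measurable_EFinP.
have := integral_rV_affine b (oner_neq0 R) mf'.
rewrite normr1 invr1 expr1n mul1e => <-.
by apply: eq_integral => x _; rewrite scale1r.
Qed.

Lemma Rintegral_odd (f : 'rV[R]_n -> R) : measurable_fun setT f ->
  (forall x, f (- x) = - f x) -> mu.-integrable setT (EFin \o f) ->
  \int[mu]_x f x = 0.
Proof.
move=> mf fN fi; have N1 : (-1 : R) != 0 by rewrite oppr_eq0 oner_neq0.
have := @Rintegral_affine (-1) 0 f N1 mf.
rewrite normrN1 invr1 expr1n mul1r.
under eq_Rintegral do rewrite addr0 scaleN1r fN -mulN1r.
rewrite RintegralZl// mulN1r => E; lra.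
Qed.

End complex_affine.

(** * Differentiation and integration over R^d *)

Section derive_aux.
Variable R : realType.
Implicit Types (f g : R -> R) (x a b : R).

Lemma is_derive_add f g x a b : is_derive x 1 f a -> is_derive x 1 g b ->
  is_derive x 1 (fun u => f u + g u) (a + b).
Proof. by move=> fa gb; exact: (is_deriveD fa gb). Qed.

Lemma is_derive_opp f x a : is_derive x 1 f a ->
  is_derive x 1 (fun u => - f u) (- a).
Proof. by move=> fa; exact: (is_deriveN fa). Qed.

Lemma is_derive_mul f g x a b : is_derive x 1 f a -> is_derive x 1 g b ->
  is_derive x 1 (fun u => f u * g u) (a * g x + f x * b).
Proof.
move=> fa gb; apply: (is_derive_eq (is_deriveM fa gb)).
by rewrite /GRing.scale /= addrC mulrC.
Qed.

Lemma is_derive_comp f g x a b : is_derive (g x) 1 f a -> is_derive x 1 g b ->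
  is_derive x 1 (fun u => f (g u)) (a * b).
Proof. by move=> fa gb; exact: (is_derive1_comp fa gb). Qed.

Lemma is_derive_cst1 (c x : R) : is_derive x 1 (fun=> c) 0.
Proof. exact: is_derive_cst. Qed.

Lemma is_derive_id1 (x : R) : is_derive x 1 (fun u : R => u) 1.
Proof. exact: is_derive_id. Qed.

Lemma is_derive_scale (c x : R) : is_derive x 1 (fun u => u * c) c.
Proof.
apply: (is_derive_eq (is_derive_mul (is_derive_id1 x) (is_derive_cst1 c x))).
by rewrite mul1r mulr0 addr0.
Qed.

Lemma is_derive_translate f x a s : is_derive (x + s) 1 f a ->
  is_derive x 1 (fun u => f (u + s)) a.
Proof.
move=> fa; apply: (is_derive_eq (is_derive_comp (g := fun u => u + s) fa
  (is_derive_add (is_derive_id1 x) (is_derive_cst1 s x)))).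
by rewrite addr0 mulr1.
Qed.

End derive_aux.

Section derive_line.
Variables (R : realType) (n : nat).
Implicit Types (x v : 'rV[R]_n).

Lemma is_derive_line (h h' : 'rV[R]_n -> R) v :
  (forall x, is_derive (0 : R) 1 (fun u => h (x + u *: v)) (h' x)) ->
  forall x (s : R), is_derive s 1 (fun u => h (x + u *: v)) (h' (x + s *: v)).
Proof.
move=> hh x s; have E : (fun u => h (x + u *: v)) =
    fun u => (fun u => h ((x + s *: v) + u *: v)) (u + - s).
  by apply/funext => u /=; rewrite -addrA -scalerDl addrCA subrr addr0.
have D : is_derive (s - s) 1 (fun u => h ((x + s *: v) + u *: v)) (h' (x + s *: v)).
  by rewrite subrr; exact: hh.
by rewrite E; exact: (is_derive_translate D).
Qed.

Lemma derivable_line (h : 'rV[R]_n -> R) v x (s : R) :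
  derivable h (x + s *: v) v ->
  is_derive s 1 (fun u => h (x + u *: v)) ('D_v h (x + s *: v)).
Proof.
have E : (fun k : R => k^-1 *: ((h \o shift (x + s *: v)) (k *: v) - h (x + s *: v))) =
   (fun k => k^-1 *: (((fun u => h (x + u *: v)) \o shift s) (k *: (1 : R)) -
     (fun u => h (x + u *: v)) s)).
  apply/funext => k /=; congr (_ *: (h _ - _)).
  by rewrite scalerDl [k *: 1]mulr1 addrCA.
by rewrite /derivable E => dh; split; rewrite // /derive E.
Qed.

End derive_line.

Section weight.
Variables (R : realType) (n : nat).
Notation mu := (lebesgue_rV R n).
Implicit Types (x y v : 'rV[R]_n).

(** One power more than the dimension makes this integrable; dominations
    below are by multiples of it. *)
Definition wt x : R := (1 + enorm x) ^- n.+1.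

Lemma enorm1_ge1 x : 1 <= 1 + enorm x.
Proof. by rewrite lerDl enorm_ge0. Qed.

Lemma enorm1_gt0 x : 0 < 1 + enorm x.
Proof. exact: lt_le_trans (enorm1_ge1 x). Qed.

Lemma wt_gt0 x : 0 < wt x.
Proof. by rewrite invr_gt0 exprn_gt0// enorm1_gt0. Qed.

Lemma wt_ge0 x : 0 <= wt x. Proof. exact/ltW/wt_gt0. Qed.

Lemma wt_le1 x : wt x <= 1.
Proof. by rewrite invf_le1 ?exprn_gt0 ?enorm1_gt0// exprn_ege1// enorm1_ge1. Qed.

Lemma measurable_invX (N : nat) : measurable_fun setT (fun x => (1 + enorm x) ^- N).
Proof.
have -> : (fun x => (1 + enorm x) ^- N) = fun x => (1 + enorm x) `^ (- N%:R).
  by apply/funext => x; rewrite powRN powR_mulrn// ltW// enorm1_gt0.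
apply: measurable_funpow; apply: measurable_funD => //; exact: measurable_enormT.
Qed.

Lemma invX_ge0 (N : nat) x : 0 <= (1 + enorm x) ^- N.
Proof. by rewrite invr_ge0 exprn_ge0// ltW// enorm1_gt0. Qed.

Lemma measurable_wt : measurable_fun setT wt.
Proof. exact: measurable_invX. Qed.

Lemma integral_wt_lty : (\int[mu]_x (wt x)%:E < +oo)%E.
Proof.
have m1 : measurable_fun setT (fun x : 'rV[R]_n => (enorm x <= 1)%R%:R : R).
  by apply: measurable_le_nat => //; exact: measurable_enormT.
have m2 := measurable_powN_ge (n.+1%:R : R) (1 : R) (n := n).
apply: (@le_lt_trans _ _ (\int[mu]_x ((enorm x <= 1)%R%:R +
    enorm x `^ (- n.+1%:R) * (1 <= enorm x)%R%:R)%:E)%E).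
  apply: le_integral_fin => //.
  - exact: measurable_wt.
  - exact: measurable_funD.
  - exact: wt_ge0.
  move=> x; have [x1|x1] := leP (enorm x) 1.
    by rewrite (le_trans (wt_le1 x))// lerDl mulr_ge0// powR_ge0.
  have x0 : 0 < enorm x by rewrite (lt_trans _ x1).
  rewrite (ltW x1) add0r mulr1 powRN powR_mulrn ?enorm_ge0//.
  rewrite lef_pV2 ?posrE ?exprn_gt0 ?enorm1_gt0//.
  by rewrite lerXn2r ?nnegrE ?(ltW x0) ?(ltW (enorm1_gt0 x))// lerDr.
rewrite ge0_integralD_fin//; last by move=> x; rewrite mulr_ge0// powR_ge0.
apply: lte_add_pinfty; first exact: lebesgue_ball_lty.
by apply: integral_powN_ge1; rewrite ltr_nat.
Qed.

Lemma integrable_wt_le (f : 'rV[R]_n -> R) C : measurable_fun setT f ->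
  (forall x, `|f x| <= C * wt x) -> mu.-integrable setT (EFin \o f).
Proof.
move=> mf fC; have C0 : 0 <= C.
  by have := le_trans (normr_ge0 _) (fC 0); rewrite pmulr_lge0// wt_gt0.
have mw := measurable_wt.
have iw : mu.-integrable setT (EFin \o (fun x => C * wt x)).
  apply: ge0_integrable_fin; first exact: measurable_funM.
    by move=> x; rewrite mulr_ge0// wt_ge0.
  rewrite ge0_integralZ_fin//; last exact: wt_ge0.
  by rewrite lte_mul_pinfty ?lee_fin// integral_wt_lty.
apply: le_integrable iw => //; first exact/measurable_EFinP.
move=> x _ /=; rewrite lee_fin (le_trans (fC x))// ler_norm//.
Qed.

Lemma enorm1_shift x v s : `|s| <= 1 ->
  1 + enorm x <= (1 + enorm v) * (1 + enorm (x + s *: v)).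
Proof.
move=> s1; have := ler_enormB x (x + s *: v).
rewrite opprD addrA subrr add0r enormN enormZ => h.
have h2 : `|s| * enorm v <= enorm v by rewrite ler_piMl// enorm_ge0.
have h3 : 0 <= enorm v * enorm (x + s *: v) by rewrite mulr_ge0 ?enorm_ge0.
rewrite mulrDl mul1r mulrDr mulr1; lra.
Qed.

(** Bounded translations change the weight by a bounded factor, so that it
    also dominates difference quotients. *)
Lemma wt_shift x v s : `|s| <= 1 ->
  wt (x + s *: v) <= (1 + enorm v) ^+ n.+1 * wt x.
Proof.
move=> s1; rewrite /wt -[X in _ <= X]invrK -[X in X <= _]invrK.
rewrite lef_pV2 ?posrE ?invr_gt0 ?mulr_gt0 ?invr_gt0 ?exprn_gt0 ?enorm1_gt0//.
rewrite invfM !invrK ler_pdivrMl ?exprn_gt0 ?enorm1_gt0// -exprMn.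
by rewrite lerXn2r ?nnegrE ?mulr_ge0 ?(ltW (enorm1_gt0 _))// enorm1_shift.
Qed.

End weight.

Section derive_integral.
Variables (R : realType) (n : nat).
Notation mu := (lebesgue_rV R n).

Lemma is_derive_Rintegral (f df : R -> 'rV[R]_n -> R) (a e C : R) : 0 < e ->
  (forall x, measurable_fun setT (f x)) ->
  (forall x y, `|x - a| < e -> `|f x y| <= C * wt y) ->
  (forall (x : R) y, is_derive x 1 (f^~ y) (df x y)) ->
  (forall x y, `|x - a| < e -> `|df x y| <= C * wt y) ->
  is_derive a 1 (fun x => \int[mu]_y f x y) (\int[mu]_y df a y).
Proof.
move=> e0 mf fC fd dC.
have Ia : (`](a - e), (a + e)[%classic : set R) a.
  by rewrite /= in_itv /= ltrBlDr !ltrDl e0.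
have IP x : (`](a - e), (a + e)[%classic : set R) x -> `|x - a| < e.
  by rewrite /= in_itv /= ltr_distl.
have dE x y : partial1of2 f x y = df x y.
  by rewrite partial1of2E; exact: (@derive_val _ _ _ _ _ _ _ (fd x y)).
have C0 : 0 <= C.
  have := le_trans (normr_ge0 _) (fC a 0 _); rewrite subrr normr0 => /(_ e0).
  by rewrite pmulr_lge0// wt_gt0.
have h1 x : (`](a - e), (a + e)[%classic : set R) x ->
    mu.-integrable setT (EFin \o f x).
  by move=> /IP xe; apply: (@integrable_wt_le _ _ _ C) => // y; exact: fC.
have h2 x y : (`](a - e), (a + e)[%classic : set R) x -> setT y ->
    derivable (f^~ y) x 1.
  by move=> _ _; exact: (@ex_derive _ _ _ _ _ _ _ (fd x y)).
have h3 (y : 'rV[R]_n) : 0 <= C * wt y by rewrite mulr_ge0// wt_ge0.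
have h4 : mu.-integrable setT (EFin \o (fun y => C * wt y)).
  apply: (@integrable_wt_le _ _ _ C) => [|y]; last by rewrite ger0_norm.
  by apply: measurable_funM => //; exact: measurable_wt.
have h5 x y : (`](a - e), (a + e)[%classic : set R) x -> setT y ->
    `|partial1of2 f x y| <= C * wt y.
  by move=> /IP xe _; rewrite dE dC.
apply: DeriveDef.
  exact: (derivable_under_integral measurableT Ia h1 h2 h3 h4 h5).
rewrite -derive1E (differentiation_under_integral measurableT Ia h1 h2 h3 h4 h5).
by apply: eq_Rintegral => y _; exact: dE.
Qed.

(** The integral of [h (x + s v)] does not depend on [s], and [h'] is the
    integrand of its derivative. *)
Lemma Rintegral_derive0 (h h' : 'rV[R]_n -> R) v C : measurable_fun setT h ->
  (forall x, `|h x| <= C * wt x) -> (forall x, `|h' x| <= C * wt x) ->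
  (forall x, is_derive (0 : R) 1 (fun u => h (x + u *: v)) (h' x)) ->
  \int[mu]_x h' x = 0.
Proof.
move=> mh hC h'C hh.
pose C' := C * (1 + enorm v) ^+ n.+1.
have C0 : 0 <= C.
  by have := le_trans (normr_ge0 _) (hC 0); rewrite pmulr_lge0// wt_gt0.
have bnd (g : 'rV[R]_n -> R) (s : R) y : (forall x, `|g x| <= C * wt x) ->
    `|s - 0| < 1 -> `|g (y + s *: v)| <= C' * wt y.
  rewrite subr0 => gC s1; rewrite (le_trans (gC _))// -mulrA ler_wpM2l//.
  by apply: wt_shift; exact: ltW.
have D : is_derive (0 : R) 1 (fun s => \int[mu]_y h (y + s *: v))
    (\int[mu]_y h' (y + 0 *: v)).
  apply: (is_derive_Rintegral (f := fun s y => h (y + s *: v))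
    (df := fun s y => h' (y + s *: v)) (C := C') ltr01).
  - move=> s; apply: (measurableT_comp mh); exact: measurable_rVD.
  - by move=> s y; exact: bnd.
  - by move=> s y; exact: is_derive_line.
  - by move=> s y; exact: bnd.
have E : (fun s : R => \int[mu]_y h (y + s *: v)) = fun=> \int[mu]_y h y.
  by apply/funext => s; exact: Rintegral_translate.
rewrite E in D; have := @derive_val _ _ _ _ _ _ _ D.
rewrite derive_cst => ->.
by apply: eq_Rintegral => x _; rewrite scale0r addr0.
Qed.

End derive_integral.

(** * The Fourier transform of Gaussians *)

Section gaussian.
Variables (R : realType) (n : nat).
Notation mu := (lebesgue_rV R n).
Implicit Types (x y : 'rV[R]_n) (c t : R).

(** [1 + r <= 1 + 1 / (4 c) + c r ^ 2], and the exponential dominates any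
    power. *)
Lemma pow_expN_bounded c (N : nat) : 0 < c ->
  exists2 B : R, 0 <= B & forall r : R, 0 <= r -> (1 + r) ^+ N * expR (- (c * r ^+ 2)) <= B.
Proof.
move=> c0; exists (N.+1`!%:R * expR (1 + (4 * c)^-1)).
  by rewrite mulr_ge0// expR_ge0.
move=> r r0; rewrite expRN ler_pdivrMr ?expR_gt0// -mulrA -expRD.
have r1 : 0 <= 1 + r by rewrite addr_ge0.
have h1 : (1 + r) ^+ N <= (1 + r) ^+ N.+1 by rewrite ler_weXn2l// lerDl.
apply: (le_trans h1).
have := expR_ge1Dxn N r1 => h2.
have f0 : (0 : R) < N.+1`!%:R by rewrite ltr0n fact_gt0.
have h3 : (1 + r) ^+ N.+1 <= N.+1`!%:R * expR (1 + r).
  rewrite -ler_pdivrMl// mulrC; apply: le_trans h2; by rewrite lerDr.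
apply: (le_trans h3); rewrite ler_pM2l// ler_expR.
rewrite -addrA lerD2l.
have -> : (4 * c)^-1 + c * r ^+ 2 = r + c * (r - (2 * c)^-1) ^+ 2.
  by field; rewrite gt_eqF.
by rewrite lerDl mulr_ge0 ?(ltW c0)// sqr_ge0.
Qed.

Definition gauss x : R := expR (- (pi * dotrV x x)).

Lemma gauss_ge0 x : 0 <= gauss x. Proof. exact: expR_ge0. Qed.

Lemma measurable_gauss : measurable_fun setT gauss.
Proof.
apply: (measurableT_comp (f := expR)); first exact: measurable_expR.
by apply: measurable_funN; apply: measurable_funM => //; exact: measurable_dotrV.
Qed.

Lemma gauss_decay : exists2 B : R, 0 <= B & forall x,
  gauss x * (1 + enorm x) <= B * wt x.
Proof.
have [B B0 BP] := pow_expN_bounded n.+2 (pi_gt0 R).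
exists B => // x; rewrite /wt ler_pdivlMr ?exprn_gt0 ?enorm1_gt0//.
by rewrite -mulrA -exprS mulrC /gauss -enorm_sqr BP// enorm_ge0.
Qed.

Lemma gauss_le_decay B x : gauss x * (1 + enorm x) <= B * wt x -> gauss x <= B * wt x.
Proof.
by apply: le_trans; rewrite ler_peMr ?gauss_ge0// enorm1_ge1.
Qed.

Section fourier_gauss.
Variable x : 'rV[R]_n.

Let th t y := 2 * pi * t * dotrV y x.
Let Ct t := \int[mu]_y (gauss y * cos (th t y)).

Let measurable_th t : measurable_fun setT (th t).
Proof. by apply: measurable_funM => //; exact: measurable_dotrV. Qed.

Let measurable_gc t : measurable_fun setT (fun y => gauss y * cos (th t y)).
Proof.
apply: measurable_funM; first exact: measurable_gauss.
apply: measurableT_comp => //; apply: continuous_measurable_fun.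
exact: continuous_cos.
Qed.

Let measurable_gs t : measurable_fun setT (fun y => gauss y * sin (th t y)).
Proof.
apply: measurable_funM; first exact: measurable_gauss.
apply: measurableT_comp => //; apply: continuous_measurable_fun.
exact: continuous_sin.
Qed.

Let dot_le y : `|2 * pi * dotrV y x| <= 2 * pi * enorm x * (1 + enorm y).
Proof.
rewrite normrM ger0_norm ?mulr_ge0 ?pi_ge0// -mulrA ler_wpM2l ?mulr_ge0 ?pi_ge0//.
rewrite (le_trans (ler_norm_dotrV _ _))// mulrC ler_wpM2l ?enorm_ge0//.
by rewrite lerDr.
Qed.

Let derive_Ct t : is_derive t 1 Ct
  (\int[mu]_y (gauss y * - (2 * pi * dotrV y x * sin (th t y)))).
Proof.
have [B B0 BP] := gauss_decay.
pose C := B * (1 + 2 * pi * enorm x).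
have k0 : 0 <= 2 * pi * enorm x by rewrite !mulr_ge0 ?pi_ge0 ?enorm_ge0.
apply: (@is_derive_Rintegral _ _ (fun t y => gauss y * cos (th t y))
  (fun t y => gauss y * - (2 * pi * dotrV y x * sin (th t y))) t 1 C ltr01) => //.
- move=> s y _; rewrite normrM ger0_norm ?gauss_ge0//.
  have h := gauss_le_decay (BP y).
  apply: (@le_trans _ _ (gauss y)).
    by rewrite ler_piMr ?gauss_ge0// ler_norml cos_le1 cos_geN1.
  apply: (le_trans h); rewrite ler_wpM2r ?wt_ge0// /C mulrDr mulr1 lerDl mulr_ge0//.
- move=> s y; have E : (fun t => gauss y * cos (th t y)) =
     fun t => cos (t * (2 * pi * dotrV y x)) * gauss y.
    by apply/funext => u; rewrite mulrC /th; congr (cos _ * _); ring.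
  rewrite E; have D1 := is_derive_comp (f := cos) (is_derive_cos _)
    (is_derive_scale (2 * pi * dotrV y x) s).
  apply: (is_derive_eq (is_derive_mul D1 (is_derive_cst1 (gauss y) s))).
  by rewrite /th (_ : s * (2 * pi * dotrV y x) = 2 * pi * s * dotrV y x); ring.
- move=> s y _; rewrite normrM (ger0_norm (gauss_ge0 y)) normrN normrM.
  apply: (@le_trans _ _ (gauss y * (2 * pi * enorm x * (1 + enorm y)))).
    rewrite ler_wpM2l ?gauss_ge0// -[leRHS]mulr1 ler_pM//.
    by rewrite ler_norml sin_le1 sin_geN1.
  rewrite mulrCA (le_trans (ler_wpM2l k0 (BP y)))// mulrA ler_wpM2r ?wt_ge0//.
  by rewrite /C mulrC ler_wpM2l// lerDr.
Qed.

(** Integrating the derivative of [gauss * sin] in the direction [x]. *)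
Let by_parts t :
  \int[mu]_y (gauss y * - (2 * pi * dotrV y x * sin (th t y))) =
  - (2 * pi * t * dotrV x x) * Ct t.
Proof.
have [B B0 BP] := gauss_decay.
pose k := 2 * pi * enorm x.
have k0 : 0 <= k by rewrite !mulr_ge0 ?pi_ge0 ?enorm_ge0.
pose q := `|2 * pi * t * dotrV x x|.
pose C := B * (1 + k + q).
pose h' y := gauss y * - (2 * pi * dotrV y x * sin (th t y)) +
  (2 * pi * t * dotrV x x) * (gauss y * cos (th t y)).
have gB y := gauss_le_decay (BP y).
have b1 y : `|gauss y * - (2 * pi * dotrV y x * sin (th t y))| <= B * k * wt y.
  rewrite normrM (ger0_norm (gauss_ge0 y)) normrN normrM.
  apply: (@le_trans _ _ (gauss y * (k * (1 + enorm y)))).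
    rewrite ler_wpM2l ?gauss_ge0// -[leRHS]mulr1 ler_pM//.
    by rewrite ler_norml sin_le1 sin_geN1.
  by rewrite mulrCA (le_trans (ler_wpM2l k0 (BP y)))// mulrA (mulrC k).
have b2 y : `|gauss y * cos (th t y)| <= B * wt y.
  rewrite normrM ger0_norm ?gauss_ge0// (le_trans _ (gB y))//.
  by rewrite ler_piMr ?gauss_ge0// ler_norml cos_le1 cos_geN1.
have b3 y : `|gauss y * sin (th t y)| <= B * wt y.
  rewrite normrM ger0_norm ?gauss_ge0// (le_trans _ (gB y))//.
  by rewrite ler_piMr ?gauss_ge0// ler_norml sin_le1 sin_geN1.
have m1 : measurable_fun setT (fun y => gauss y * - (2 * pi * dotrV y x * sin (th t y))).
  apply: measurable_funM; first exact: measurable_gauss.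
  apply: measurable_funN; apply: measurable_funM.
    by apply: measurable_funM => //; exact: measurable_dotrV.
  apply: measurableT_comp => //; apply: continuous_measurable_fun.
  exact: continuous_sin.
have I1 := integrable_wt_le m1 b1.
have I2 := integrable_wt_le (measurable_gc t) b2.
have := @Rintegral_derive0 R n (fun y => gauss y * sin (th t y)) h' x C
  (measurable_gs t).
rewrite /h' RintegralD//; last exact: integrableZ_fin.
rewrite RintegralZl// => H; apply/eqP; rewrite mulNr -addr_eq0; apply/eqP; apply: H.
- move=> y; rewrite (le_trans (b3 y))// ler_wpM2r ?wt_ge0// /C -[leLHS]mulr1.
  by rewrite ler_wpM2l// -addrA lerDl addr_ge0// normr_ge0.
- move=> y; rewrite (le_trans (ler_normD _ _))// /C.
  have -> : B * (1 + k + q) * wt y = B * (1 + k) * wt y + B * q * wt y by ring.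
  apply: lerD.
    by rewrite (le_trans (b1 y))// ler_wpM2r ?wt_ge0// ler_wpM2l// lerDr.
  by rewrite normrM -/q (mulrC B) -mulrA ler_wpM2l ?normr_ge0.
move=> y.
pose dq (u : R) := dotrV y y + u * (2 * dotrV y x) + u * u * dotrV x x.
have E : (fun u : R => gauss (y + u *: x) * sin (th t (y + u *: x))) =
    fun u => expR (- (pi * dq u)) * sin (th t y + u * (2 * pi * t * dotrV x x)).
  apply/funext => u; rewrite /gauss /th !(dotrVDl, dotrVDr, dotrVZl, dotrVZr) (dotrVC x y).
  by congr (expR _ * sin _); rewrite /dq; ring.
have D1 := is_derive_add (is_derive_cst1 (dotrV y y) 0)
  (is_derive_scale (2 * dotrV y x) 0).
have D2 := is_derive_mul (is_derive_mul (is_derive_id1 0) (is_derive_id1 0))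
  (is_derive_cst1 (dotrV x x) 0).
have D3 := is_derive_opp (is_derive_mul (is_derive_cst1 pi 0) (is_derive_add D1 D2)).
have D4 := is_derive_comp (f := expR) (is_derive_expR _) D3.
have D5 := is_derive_comp (f := sin) (is_derive_sin _) (is_derive_add
  (is_derive_cst1 (th t y) 0) (is_derive_scale (2 * pi * t * dotrV x x) 0)).
rewrite E; apply: (is_derive_eq (is_derive_mul D4 D5)).
rewrite /h' /dq !mul0r !addr0 /gauss; ring.
Qed.

(** [Ct] satisfies [Ct' = - 2 pi t |x|^2 Ct], hence it is a Gaussian in [t]. *)
Let Ct_ode t : Ct t * expR (pi * t ^+ 2 * dotrV x x) = Ct 0.
Proof.
pose phi t := Ct t * expR (t * t * (pi * dotrV x x)).
have d0 (s : R) : is_derive s 1 phi 0.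
  have D1 := is_derive_mul (is_derive_mul (is_derive_id1 s) (is_derive_id1 s))
    (is_derive_cst1 (pi * dotrV x x) s).
  have D2 := is_derive_comp (f := expR) (is_derive_expR _) D1.
  apply: (is_derive_eq (is_derive_mul (derive_Ct s) D2)).
  by rewrite by_parts; ring.
have := is_derive_0_is_cst t 0 d0; rewrite /phi mul0r mul0r expR0 mulr1 => <-.
by congr (_ * expR _); ring.
Qed.

(** The imaginary part vanishes by oddness. *)
Lemma fourier_gauss :
  cintegral (fun y => (gauss y)%:C%C * cexpi (2 * pi * dotrV y x)) =
  ((\int[mu]_y gauss y) * gauss x)%:C%C.
Proof.
have [B B0 BP] := gauss_decay.
have E1 : \int[mu]_y (gauss y * cos (th 1 y)) = (\int[mu]_y gauss y) * gauss x.
  have := Ct_ode 1; rewrite /Ct expr1n mulr1.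
  have -> : \int[mu]_y (gauss y * cos (th 0 y)) = \int[mu]_y gauss y.
    by apply: eq_Rintegral => y _; rewrite /th mulr0 mul0r cos0 mulr1.
  by move=> <-; rewrite -mulrA /gauss -expRD subrr expR0 mulr1.
have E2 : \int[mu]_y (gauss y * sin (th 1 y)) = 0.
  apply: Rintegral_odd; first exact: measurable_gs.
    move=> y; rewrite /gauss /th !dotrVNl dotrVNr opprK mulrN sinN mulrN.
    by [].
  apply: (integrable_wt_le (measurable_gs 1) (C := B)) => y.
  rewrite normrM ger0_norm ?gauss_ge0// (le_trans _ (gauss_le_decay (BP y)))//.
  by rewrite ler_piMr ?gauss_ge0// ler_norml sin_le1 sin_geN1.
apply: complexP => /=.
  rewrite -E1; apply: eq_Rintegral => y _.
  by rewrite mul0r subr0 /th mulr1.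
rewrite -[RHS]E2; apply: eq_Rintegral => y _.
by rewrite mul0r addr0 /th mulr1.
Qed.

End fourier_gauss.
End gaussian.

(** * Schwartz functions *)

Section real_schwartz.
Variables (R : realType) (n : nat).
Notation mu := (lebesgue_rV R n).
Implicit Types (psi : 'rV[R]_n -> R) (x xi : 'rV[R]_n).

Definition rschwartz psi := smooth_on setT psi /\
  forall (s : seq 'I_n) (N : nat), exists B : R, forall x,
    (1 + enorm x) ^+ N * `|iter_partial s psi x| <= B.

Lemma schwartzE (phi : 'rV[R]_n -> R[i]) : schwartz phi <->
  rschwartz (fun x => complex.Re (phi x)) /\ rschwartz (fun x => complex.Im (phi x)).
Proof.
split=> [[[sr si] b]|[[sr br] [si bi]]].
  by split; split => // s N; have [B BP] := b s N; exists B => x; have [] := BP x.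
split => // s N; have [Br BrP] := br s N; have [Bi BiP] := bi s N.
exists (Num.max Br Bi) => x; rewrite !le_max BrP BiP orbT; split => //.
Qed.

Definition partial (i : 'I_n) psi : 'rV[R]_n -> R :=
  fun x => 'D_(delta_mx ord0 i) psi x.

Lemma iter_partial_partial s i psi :
  iter_partial s (partial i psi) = iter_partial (rcons s i) psi.
Proof. by rewrite /iter_partial -cats1 foldr_cat. Qed.

Lemma rschwartz_partial i psi : rschwartz psi -> rschwartz (partial i psi).
Proof.
move=> [sp bp]; split.
  by move=> s x _; rewrite iter_partial_partial; exact: sp.
by move=> s N; rewrite iter_partial_partial; exact: bp.
Qed.

Lemma rschwartz_continuous psi : rschwartz psi -> continuous psi.
Proof. by move=> [sp _] x; have [] := sp [::] x I. Qed.

Lemma rschwartz_measurable psi : rschwartz psi -> measurable_fun setT psi.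
Proof. by move=> /rschwartz_continuous; exact: continuous_measurable_rV. Qed.

Lemma rschwartz_wt psi : rschwartz psi ->
  exists2 B : R, 0 <= B & forall x, `|psi x| <= B * wt x.
Proof.
move=> [_ bp]; have [B BP] := bp [::] n.+1.
have B0 : 0 <= B.
  by apply: le_trans (BP 0); rewrite mulr_ge0// exprn_ge0// ltW// enorm1_gt0.
exists B => // x; rewrite /wt ler_pdivlMr ?exprn_gt0 ?enorm1_gt0// mulrC.
exact: BP.
Qed.

Lemma rschwartz_is_derive i psi : rschwartz psi -> forall x,
  is_derive (0 : R) 1 (fun u => psi (x + u *: delta_mx ord0 i)) (partial i psi x).
Proof.
move=> [sp _] x; have [_ /(_ i) dp] := sp [::] x I.
have := @derivable_line R n psi (delta_mx ord0 i) x 0.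
by rewrite scale0r addr0; apply.
Qed.

Lemma dotrV_delta xi i : dotrV xi (delta_mx ord0 i) = xi ord0 i.
Proof.
rewrite /dotrV (bigD1 i)//= big1 => [|j ji]; rewrite mxE eqxx ?eqxx ?mulr1 ?addr0//.
by rewrite /= (negPf ji) mulr0.
Qed.

(** The phase [th] makes the cosine and the sine transforms instances of one
    another. *)
Definition phase_transform psi th xi :=
  \int[mu]_x (psi x * cos (2 * pi * dotrV xi x + th)).

Lemma measurable_cos_dot xi th :
  measurable_fun setT (fun x => cos (2 * pi * dotrV xi x + th)).
Proof.
apply: (measurableT_comp (f := @cos R)).
  by apply: continuous_measurable_fun; exact: continuous_cos.
apply: measurable_funD => //; apply: measurable_funM => //; exact: measurable_dotrV.
Qed.

Section by_parts.
Variables (psi : 'rV[R]_n -> R) (i : 'I_n).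
Hypothesis Spsi : rschwartz psi.
Let Sd := rschwartz_partial i Spsi.

Let mulcos_le (r t b : R) : `|r| <= b -> `|r * cos t| <= b.
Proof.
move=> rb; rewrite normrM (le_trans _ rb)// ler_piMr//.
by rewrite ler_norml cos_le1 cos_geN1.
Qed.

Lemma integrable_cos (f : 'rV[R]_n -> R) th xi : rschwartz f ->
  mu.-integrable setT (EFin \o (fun x => f x * cos (2 * pi * dotrV xi x + th))).
Proof.
move=> Sf; have [B B0 BP] := rschwartz_wt Sf.
apply: (@integrable_wt_le _ _ _ B) => [|x]; last exact: mulcos_le.
by apply: measurable_funM; [exact: rschwartz_measurable|exact: measurable_cos_dot].
Qed.

Let arg_derive xi th x : is_derive (0 : R) 1
  (fun u => 2 * pi * dotrV xi (x + u *: delta_mx ord0 i) + th) (2 * pi * xi ord0 i).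
Proof.
have -> : (fun u : R => 2 * pi * dotrV xi (x + u *: delta_mx ord0 i) + th) =
    fun u => 2 * pi * dotrV xi x + th + u * (2 * pi * xi ord0 i).
  by apply/funext => u; rewrite dotrVDr dotrVZr dotrV_delta; ring.
apply: (is_derive_eq (is_derive_add (is_derive_cst1 _ _) (is_derive_scale _ _))).
by rewrite add0r.
Qed.

(** Integration by parts; differentiating the cosine shifts its phase. *)
Lemma phase_transform_partial th xi : phase_transform (partial i psi) th xi =
  - (2 * pi * xi ord0 i) * phase_transform psi (th + pi / 2) xi.
Proof.
have [B B0 BP] := rschwartz_wt Spsi; have [D D0 DP] := rschwartz_wt Sd.
pose k := 2 * pi * xi ord0 i.
have Bk : 0 <= B * `|k| by rewrite mulr_ge0.
have I1 := integrable_cos th xi Sd.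
have I2 := integrable_cos (th + pi / 2) xi Spsi.
have := @Rintegral_derive0 R n (fun x => psi x * cos (2 * pi * dotrV xi x + th))
  (fun x => partial i psi x * cos (2 * pi * dotrV xi x + th) +
    k * (psi x * cos (2 * pi * dotrV xi x + (th + pi / 2)))) (delta_mx ord0 i)
  (B + D + B * `|k|).
rewrite RintegralD//; last exact: integrableZ_fin.
rewrite RintegralZl// => H; apply/eqP; rewrite mulNr -addr_eq0; apply/eqP; apply: H.
- by apply: measurable_funM; [exact: rschwartz_measurable|exact: measurable_cos_dot].
- move=> x; rewrite (le_trans (mulcos_le _ (BP x)))// ler_wpM2r ?wt_ge0//.
  by rewrite -addrA lerDl addr_ge0.
- move=> x; rewrite (le_trans (ler_normD _ _))//.
  have -> : (B + D + B * `|k|) * wt x = D * wt x + `|k| * (B * wt x) + B * wt x by ring.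
  rewrite -[X in X <= _]addr0; apply: lerD; last by rewrite mulr_ge0// wt_ge0.
  apply: lerD; first exact: mulcos_le.
  by rewrite normrM ler_wpM2l// mulcos_le.
move=> x.
have D1 := is_derive_comp (f := cos) (is_derive_cos _) (arg_derive xi th x).
apply: (is_derive_eq (is_derive_mul (rschwartz_is_derive i Spsi x) D1)).
by rewrite scale0r addr0 addrA cosDpihalf /k; ring.
Qed.

Lemma phase_transform_bounded : exists B : R, forall th xi,
  `|phase_transform psi th xi| <= B.
Proof.
have [B B0 BP] := rschwartz_wt Spsi.
have iw : mu.-integrable setT (EFin \o (fun x : 'rV[R]_n => B * wt x)).
  apply: (@integrable_wt_le _ _ _ B) => [|y]; last by rewrite ger0_norm// mulr_ge0 ?wt_ge0.
  by apply: measurable_funM => //; exact: measurable_wt.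
exists (\int[mu]_x (B * wt x)) => th xi; have I1 := integrable_cos th xi Spsi.
apply: le_trans (le_normr_Rintegral measurableT I1) _.
apply: le_Rintegral => //; first exact: integrable_norm.
by move=> x _; exact: mulcos_le.
Qed.

End by_parts.

(** Each derivative of [psi] trades for a factor [xi_i]. *)
Lemma phase_transform_decay i N psi : rschwartz psi -> exists B : R, forall th xi,
  `|xi ord0 i| ^+ N * `|phase_transform psi th xi| <= B.
Proof.
elim: N psi => [|N IHN] psi Spsi.
  have [B BP] := phase_transform_bounded Spsi; exists B => th xi.
  by rewrite expr0 mul1r.
have [B BP] := IHN _ (rschwartz_partial i Spsi).
have p1 : (1 : R) <= 2 * pi by have := pi_ge2 R; lra.
exists B => th xi; apply: le_trans (BP (th - pi / 2) xi).
rewrite phase_transform_partial// subrK normrM normrN exprSr -!mulrA.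
rewrite ler_wpM2l ?exprn_ge0// !normrM (ger0_norm (pi_ge0 R)) normr_nat.
by rewrite !mulrA ler_wpM2r// ler_peMl.
Qed.

End real_schwartz.

Section inv_fourier_decay.
Variables (R : realType) (n : nat).
Notation mu := (lebesgue_rV R n).
Implicit Types (x xi : 'rV[R]_n).

(** Far away, some coordinate of [xi] is at least [|xi| / n]. *)
Lemma decay_of_coord (N : nat) (T : 'rV[R]_n -> R) : (forall xi, 0 <= T xi) ->
  (exists B : R, forall xi, T xi <= B) ->
  (forall i, exists B : R, forall xi, `|xi ord0 i| ^+ N * T xi <= B) ->
  exists B : R, forall xi, (1 + enorm xi) ^+ N * T xi <= B.
Proof.
move=> T0 [A AP] /choice[B BP].
have B0 i : 0 <= B i by apply: le_trans (BP i 0); rewrite mulr_ge0// exprn_ge0.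
have A0 : 0 <= A by apply: le_trans (AP 0).
have S0 : 0 <= \sum_i B i by apply: sumr_ge0.
exists ((1 + n%:R) ^+ N * (A + \sum_i B i)) => xi.
have n0 : 0 <= (1 + n%:R : R) by rewrite addr_ge0.
have [x1|x1] := leP (enorm xi) n%:R.
  rewrite ler_pM ?exprn_ge0 ?(ltW (enorm1_gt0 _))//.
    by rewrite lerXn2r ?nnegrE ?(ltW (enorm1_gt0 _))// lerD2l.
  by rewrite (le_trans (AP xi))// lerDl.
have [i xi_i] : exists i, enorm xi <= n%:R * `|xi ord0 i|.
  apply: contrapT => /forallNP h; have := enorm_le_sum xi.
  apply/negP; rewrite -ltNge.
  have [n_gt0|] := ltnP 0 n; last first.
    rewrite leqn0 => /eqP n_0; apply: le_lt_trans x1.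
    rewrite big1 ?ler0n// => i _; exfalso; move: i (ltn_ord i) => i; rewrite [X in (_ < X)%N]n_0//.
  rewrite -(@ltr_pM2l _ n%:R) ?ltr0n// mulr_sumr.
  have -> : n%:R * enorm xi = \sum_(i < n) enorm xi.
    by rewrite sumr_const card_ord mulr_natl.
  apply: ltr_sum => //; first by apply/hasP; exists (Ordinal n_gt0); rewrite ?mem_index_enum.
  by move=> i _; rewrite ltNge; apply/negP; exact: h.
have h1 : (1 + enorm xi) <= (1 + n%:R) * `|xi ord0 i|.
  have h : 1 <= `|xi ord0 i|.
    have : n%:R < n%:R * `|xi ord0 i| by exact: lt_le_trans xi_i.
    have [->|n_neq0] := eqVneq (n%:R : R) 0; first by rewrite mul0r ltxx.
    rewrite -[ltLHS]mulr1 ltr_pM2l; first exact: ltW.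
    by rewrite lt_neqAle eq_sym n_neq0 ler0n.
  by rewrite mulrDl mul1r lerD.
apply: (@le_trans _ _ ((1 + n%:R) ^+ N * (`|xi ord0 i| ^+ N * T xi))).
  rewrite mulrA -exprMn; apply: ler_wpM2r => //.
  by apply: lerXn2r => //; rewrite nnegrE ?mulr_ge0// ltW// enorm1_gt0.
rewrite ler_wpM2l ?exprn_ge0// (le_trans (BP i xi))// (bigD1 i)//= addrCA lerDl.
by rewrite addr_ge0// sumr_ge0.
Qed.

Variable phi : 'rV[R]_n -> R[i].
Hypothesis Sphi : schwartz phi.

Lemma schwartz_cmeas : cmeas phi.
Proof. by have /schwartzE[Sr Si] := Sphi; split; exact: rschwartz_measurable. Qed.

Lemma schwartz_wt : exists2 B : R, 0 <= B & forall x, normc (phi x) <= B * wt x.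
Proof.
have /schwartzE[Sr Si] := Sphi.
have [B B0 BP] := rschwartz_wt Sr; have [D D0 DP] := rschwartz_wt Si.
exists (B + D); first exact: addr_ge0.
by move=> x; rewrite (le_trans (normc_le_ReIm _))// mulrDl lerD.
Qed.

Lemma inv_fourierE xi : inv_fourier phi xi = Complex
  (phase_transform (fun x => complex.Re (phi x)) 0 xi +
   phase_transform (fun x => complex.Im (phi x)) (pi / 2) xi)
  (phase_transform (fun x => complex.Im (phi x)) 0 xi -
   phase_transform (fun x => complex.Re (phi x)) (pi / 2) xi).
Proof.
have /schwartzE[Sr Si] := Sphi; apply: complexP => /=.
  rewrite /phase_transform -RintegralD//; try exact: integrable_cos.
  by apply: eq_Rintegral => x _; rewrite addr0 cosDpihalf mulrN; case: (phi x).
rewrite /phase_transform -RintegralB//; try exact: integrable_cos.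
apply: eq_Rintegral => x _; rewrite addr0 cosDpihalf mulrN opprK.
by case: (phi x) => u v /=; rewrite addrC.
Qed.

Lemma inv_fourier_decay N : exists2 B : R, 0 <= B & forall xi,
  (1 + enorm xi) ^+ N * normc (inv_fourier phi xi) <= B.
Proof.
have /schwartzE[Sr Si] := Sphi.
have C psi th : rschwartz psi -> exists B : R, forall xi,
    (1 + enorm xi) ^+ N * `|phase_transform psi th xi| <= B.
  move=> Sp; apply: decay_of_coord => //.
    by have [B BP] := phase_transform_bounded Sp; exists B.
  by move=> i; have [B BP] := phase_transform_decay i N Sp; exists B.
have [B1 P1] := C _ 0 Sr; have [B2 P2] := C _ (pi / 2) Sr.
have [B3 P3] := C _ 0 Si; have [B4 P4] := C _ (pi / 2) Si.
have h xi : (1 + enorm xi) ^+ N * normc (inv_fourier phi xi) <= (B1 + B4) + (B3 + B2).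
  rewrite inv_fourierE (le_trans (ler_wpM2l _ (normc_le_ReIm _)))//.
    by rewrite exprn_ge0// ltW// enorm1_gt0.
  rewrite /= (le_trans (ler_wpM2l _ (lerD (ler_normD _ _) (ler_normB _ _))))//.
    by rewrite exprn_ge0// ltW// enorm1_gt0.
  by rewrite !mulrDr !lerD.
exists ((B1 + B4) + (B3 + B2)) => //.
by apply: le_trans (h 0); rewrite mulr_ge0 ?normc_ge0// exprn_ge0// ltW// enorm1_gt0.
Qed.

End inv_fourier_decay.

(** The weight [|xi|^-a (1 + |xi|)^-n] is integrable near the origin because
    [a < n], and at infinity because [0 < a]. *)
Section riesz_weight.
Variables (R : realType) (n : nat) (a : R).
Hypotheses (a_gt0 : 0 < a) (a_lt : a < n%:R).
Notation mu := (lebesgue_rV R n).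
Implicit Types (x xi : 'rV[R]_n).

Definition rw xi : R := enorm xi `^ (- a) / (1 + enorm xi) ^+ n.

Lemma rw_ge0 xi : 0 <= rw xi.
Proof. by rewrite divr_ge0 ?powR_ge0// exprn_ge0// ltW// enorm1_gt0. Qed.

Lemma measurable_rw : measurable_fun setT rw.
Proof. by apply: measurable_funM; [exact: measurable_powN|exact: measurable_invX]. Qed.

Lemma integral_rw_lty : (\int[mu]_x (rw x)%:E < +oo)%E.
Proof.
have m1 := measurable_powN_lt a (1 : R) (n := n).
have m2 := measurable_powN_ge (n%:R + a) (1 : R) (n := n).
apply: (@le_lt_trans _ _ (\int[mu]_x (enorm x `^ (- a) * (enorm x < 1)%R%:R +
    enorm x `^ (- (n%:R + a)) * (1 <= enorm x)%R%:R)%:E)%E).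
  apply: le_integral_fin => //.
  - exact: measurable_rw.
  - exact: measurable_funD.
  - exact: rw_ge0.
  move=> x; have p0 := powR_ge0 (enorm x) (- a).
  have e1 : 1 <= (1 + enorm x) ^+ n by rewrite exprn_ege1// enorm1_ge1.
  have [x1|x1] := ltP (enorm x) 1.
    rewrite mulr1 mulr0 addr0 /rw ler_pdivrMr ?(lt_le_trans _ e1)//.
    by rewrite ler_peMr.
  have x0 : 0 < enorm x by rewrite (lt_le_trans _ x1).
  rewrite mulr0 add0r mulr1 opprD powRD; last by apply/implyP; rewrite (gt_eqF x0).
  rewrite [leRHS]mulrC /rw ler_wpM2l//.
  rewrite powRN powR_mulrn ?enorm_ge0//.
  rewrite lef_pV2 ?posrE ?exprn_gt0 ?enorm1_gt0//.
  by rewrite lerXn2r ?nnegrE ?(ltW x0) ?(ltW (enorm1_gt0 x))// lerDr.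
rewrite ge0_integralD_fin//; [|by move=> x; rewrite mulr_ge0// powR_ge0..].
apply: lte_add_pinfty; first by apply: integral_powN_lt1 => //; exact: ltW.
by apply: integral_powN_ge1; rewrite ltrDl.
Qed.

Lemma integral_rw_le_lty (f : 'rV[R]_n -> R) B : measurable_fun setT f ->
  (forall xi, 0 <= f xi) -> 0 <= B ->
  (forall xi, (1 + enorm xi) ^+ n * f xi <= B) ->
  (\int[mu]_xi (enorm xi `^ (- a) * f xi)%:E < +oo)%E.
Proof.
move=> mf f0 B0 fB.
apply: (@le_lt_trans _ _ (\int[mu]_x (B * rw x)%:E)%E).
  apply: le_integral_fin => //.
  - by apply: measurable_funM => //; exact: measurable_powN.
  - by apply: measurable_funM => //; exact: measurable_rw.
  - by move=> x; rewrite mulr_ge0// powR_ge0.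
  move=> x; rewrite /rw mulrCA ler_wpM2l ?powR_ge0// ler_pdivlMr ?exprn_gt0 ?enorm1_gt0//.
  by rewrite mulrC.
rewrite ge0_integralZ_fin//; [|exact: measurable_rw|exact: rw_ge0].
by rewrite lte_mul_pinfty ?lee_fin// integral_rw_lty.
Qed.

End riesz_weight.

(** * The Riesz kernel *)

Section cintegral_more.
Variables (R : realType) (n : nat).
Hypothesis n_gt0 : (0 < n)%N.
Notation mu := (lebesgue_rV R n).
Implicit Types (h k : 'rV[R]_n -> R[i]) (z : R[i]).

Lemma lebesgue_rV_set1 (b : 'rV[R]_n) : mu [set b] = 0%E.
Proof.
pose A := fun i : 'I_n => [set b ord0 i] : set R.
have mA i : measurable (A i) by exact: measurable_set1.
have -> : [set b] = [set x : 'rV[R]_n | forall i, A i (x ord0 i)].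
  apply/seteqP; split => x /=; first by move=> -> i.
  by move=> xb; apply/rowP => i; exact: xb.
rewrite (lebesgue_rV_box mA) (bigD1 (Ordinal n_gt0))//=.
by rewrite lebesgue_measure_set1 mul0e.
Qed.

Lemma ae_neq (b : 'rV[R]_n) (P : 'rV[R]_n -> Prop) :
  (forall x, x != b -> P x) -> {ae mu, forall x, P x}.
Proof.
move=> Pb; exists [set b]; split.
- have -> : [set b] = [set x : 'rV[R]_n | forall i, [set b ord0 i] (x ord0 i)].
    apply/seteqP; split => x /=; first by move=> -> i.
    by move=> xb; apply/rowP => i; exact: xb.
  by apply: (@measurable_box_rV R n (fun i => [set b ord0 i])) => i; exact: measurable_set1.
- exact: lebesgue_rV_set1.
move=> x /= nPx; apply: contrapT => xb; apply: nPx; apply: Pb.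
by apply/eqP.
Qed.

Lemma eq_integral_neq (b : 'rV[R]_n) (f g : 'rV[R]_n -> \bar R) :
  measurable_fun setT f -> measurable_fun setT g ->
  (forall x, x != b -> f x = g x) -> (\int[mu]_x f x = \int[mu]_x g x)%E.
Proof.
move=> mf mg fg; apply: ae_eq_integral => //.
by apply: (ae_neq (b := b)) => x xb _; rewrite fg.
Qed.

Lemma eq_cintegral_neq (b : 'rV[R]_n) h k : cmeas h -> cmeas k ->
  (forall x, x != b -> h x = k x) -> cintegral h = cintegral k.
Proof.
move=> [h1 h2] [k1 k2] hk; apply: complexP => /=; congr fine;
  apply: ae_eq_integral => //; try exact/measurable_EFinP;
  by apply: (ae_neq (b := b)) => x xb _; rewrite hk.
Qed.

Lemma cintegral_real (r : 'rV[R]_n -> R) :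
  cintegral (fun x => (r x)%:C%C) = (\int[mu]_x r x)%:C%C.
Proof. by apply: complexP => //=; rewrite /Rintegral integral0. Qed.

Lemma cintegrable_real (r : 'rV[R]_n -> R) : measurable_fun setT r ->
  (forall x, 0 <= r x) -> (\int[mu]_x (r x)%:E < +oo)%E ->
  cintegrable (fun x => (r x)%:C%C).
Proof.
move=> mr r0 roo; apply: (cintegrable_le (b := r)) => //.
by move=> x; rewrite normc_real ger0_norm.
Qed.

Lemma cintegral_realM (r : 'rV[R]_n -> R) (I : R) z : measurable_fun setT r ->
  (forall x, 0 <= r x) -> (\int[mu]_x (r x)%:E = I%:E)%E ->
  cintegral (fun x => (r x)%:C%C * z) = (I%:C)%C * z.
Proof.
move=> mr r0 rI; transitivity (cintegral (fun x => z * (r x)%:C%C)).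
  by apply: eq_cintegral => x; rewrite mulrC.
rewrite cintegralZ; last by apply: cintegrable_real => //; rewrite rI ltry.
by rewrite cintegral_real mulrC /Rintegral rI.
Qed.

Lemma measurable_gauss_comp d (T : measurableType d) (f : T -> 'rV[R]_n) :
  measurable_fun setT f -> measurable_fun setT (fun t => gauss (f t)).
Proof. by move=> mf; apply: (measurableT_comp (@measurable_gauss R n)). Qed.

Lemma gauss_scaleE (r s : R) (x y : 'rV[R]_n) :
  r ^+ 2 * enorm x ^+ 2 = s ^+ 2 * enorm y ^+ 2 -> gauss (r *: x) = gauss (s *: y).
Proof.
rewrite !enorm_sqr !expr2 -!mulrA => E.
by rewrite /gauss !dotrVZl !dotrVZr E.
Qed.

Definition gauss_mass := \int[mu]_y gauss y.

Lemma fourier_gauss_scaled (r : R) (z : 'rV[R]_n) : 0 < r ->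
  cintegral (fun xi => (gauss (r *: xi))%:C%C * cexpi (2 * pi * dotrV xi z)) =
  ((r^-1 ^+ n * (gauss_mass * gauss (r^-1 *: z)))%:C)%C.
Proof.
move=> r0; have r1 : r != 0 by rewrite gt_eqF.
pose h y := (gauss y)%:C%C * cexpi (2 * pi * dotrV y (r^-1 *: z)) : R[i].
have mh : cmeas h.
  apply: cmeasM; first by apply: cmeas_real; exact: measurable_gauss.
  apply: cmeas_cexpi; apply: measurable_funM => //; exact: measurable_dotrV.
have := cintegral_affine 0 r1 mh; rewrite gtr0_norm// /h fourier_gauss -rmorphM => <-.
apply: eq_cintegral => x; rewrite addr0 dotrVZl dotrVZr; congr (_ * cexpi _).
by rewrite (mulrA r) divff// mul1r.
Qed.

End cintegral_more.

Section riesz_constants.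
Variables (R : realType) (n : nat) (a : R).
Hypotheses (a_gt0 : 0 < a) (a_lt : a < n%:R).
Notation mu := (lebesgue_rV R n).
Implicit Types (x l : 'rV[R]_n).

Lemma riesz_dim_gt0 : (0 < n)%N.
Proof. by rewrite -(ltr0n R) (lt_trans a_gt0). Qed.

Let F1 l := enorm l `^ (- (n%:R - a)) * gauss l.

Let mF1 : measurable_fun setT F1.
Proof. by apply: measurable_funM; [exact: measurable_powN|exact: measurable_gauss]. Qed.

Let F1_ge0 l : 0 <= F1 l. Proof. by rewrite mulr_ge0 ?powR_ge0 ?gauss_ge0. Qed.

Let F1_lty : (\int[mu]_l (F1 l)%:E < +oo)%E.
Proof.
have [B B0 BP] := gauss_decay R n.
have m1 := measurable_powN_lt (n%:R - a) (1 : R) (n := n).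
have m2 : measurable_fun setT (fun x : 'rV[R]_n => B * wt x).
  by apply: measurable_funM => //; exact: measurable_wt.
have na : 0 <= n%:R - a by rewrite subr_ge0 ltW.
apply: (@le_lt_trans _ _ (\int[mu]_x (enorm x `^ (- (n%:R - a)) * (enorm x < 1)%R%:R +
    B * wt x)%:E)%E).
  apply: le_integral_fin => //; first exact: measurable_funD.
  move=> l; have gB := gauss_le_decay (BP l).
  have p0 := powR_ge0 (enorm l) (- (n%:R - a)).
  have w0 : 0 <= B * wt l by rewrite mulr_ge0// wt_ge0.
  have [l1|l1] := ltP (enorm l) 1.
    rewrite mulr1 /F1 (@le_trans _ _ (enorm l `^ (- (n%:R - a))))// ?lerDl//.
    by rewrite ler_piMr// /gauss -expR0 ler_expR oppr_le0 mulr_ge0 ?pi_ge0 ?dotrV_ge0.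
  rewrite mulr0 add0r (le_trans _ gB)// ler_piMl ?gauss_ge0//.
  exact: powRN_le1.
rewrite ge0_integralD_fin//; [|by move=> x; rewrite mulr_ge0// ?powR_ge0 ?wt_ge0..].
apply: lte_add_pinfty.
  by apply: integral_powN_lt1 => //; rewrite ltrBlDr ltrDl.
rewrite ge0_integralZ_fin//; [|exact: measurable_wt|exact: wt_ge0].
by rewrite lte_mul_pinfty ?lee_fin// integral_wt_lty.
Qed.

(** On the unit cube the integrand is bounded below. *)
Let F1_gt0 : (0 < \int[mu]_l (F1 l)%:E)%E.
Proof.
have n0 := riesz_dim_gt0.
have na : 0 <= n%:R - a by rewrite subr_ge0 ltW.
pose A := fun _ : 'I_n => `]0, 1[%classic : set R.
have mA i : measurable (A i) by exact: measurable_itv.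
pose c := n%:R `^ (- (n%:R - a)) * expR (- (pi * n%:R ^+ 2)) : R.
have c0 : 0 < c by rewrite mulr_gt0 ?powR_gt0 ?ltr0n ?expR_gt0.
pose B := [set x : 'rV[R]_n | forall i, A i (x ord0 i)].
have mB : measurable B by exact: measurable_box_rV.
apply: (@lt_le_trans _ _ (c%:E * mu B)%E).
  rewrite (lebesgue_rV_box mA) big1 ?mule1 ?lte_fin// => i _.
  by rewrite /A lebesgue_measure_itv/= lte_fin ltr01 -EFinD subr0.
rewrite -[B]setIT -(@integral_indic _ _ _ mu setT)//.
rewrite -ge0_integralZ_fin//; last exact: ltW.
apply: le_integral_fin => //.
- exact: measurable_funM.
- by move=> x; rewrite mulr_ge0// ltW.
move=> x; rewrite indicE; case: (boolP (x \in B)) => [|_]; last by rewrite mulr0 F1_ge0.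
rewrite inE mulr1 /c /F1 => Bx.
have xn : enorm x <= n%:R.
  apply: (le_trans (enorm_le_sum x)).
  have -> : (n%:R : R) = \sum_(i < n) 1 by rewrite sumr_const card_ord.
  apply: ler_sum => i _; have := Bx i; rewrite /A /= in_itv /= => /andP[x0 x1].
  by rewrite gtr0_norm// ltW.
have x0 : 0 < enorm x.
  rewrite enorm_gt0; apply/eqP => x0; have := Bx (Ordinal n0).
  by rewrite /A /= in_itv /= x0 mxE ltxx.
apply: ler_pM; rewrite ?powR_ge0 ?expR_ge0//.
  rewrite !powRN lef_pV2 ?posrE ?powR_gt0 ?ltr0n//.
  by apply: ge0_ler_powR; rewrite ?nnegrE// ltW.
rewrite /gauss ler_expR lerN2 ler_wpM2l ?pi_ge0// -enorm_sqr.
by rewrite lerXn2r ?nnegrE// ltW.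
Qed.

(** The integrand depends on [x] through [|x|] only, and dilating [l] by [|x|]
    shows the homogeneity of the integral. *)
Lemma riesz_gauss1 : exists2 C1 : R, 0 < C1 & forall x, x != 0 ->
  (\int[mu]_l (enorm l `^ (- (n%:R - a)) * gauss (enorm l *: x))%:E =
   (C1 * enorm x `^ (- a))%:E)%E.
Proof.
have [C C0 CE] := integral_scaled (n%:R - a) mF1 F1_ge0 F1_lty.
exists C.
  have := CE 0 1 ltr01; rewrite powR1 mulr1.
  under eq_integral do rewrite mul1r invr1 subr0 scale1r.
  by move=> E; have := F1_gt0; rewrite E lte_fin.
move=> x x0; have e0 : 0 < enorm x by rewrite enorm_gt0.
have r0 : 0 < (enorm x)^-1 by rewrite invr_gt0.
have E : (enorm x)^-1 `^ (n%:R - (n%:R - a)) = enorm x `^ (- a).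
  by rewrite opprB addrCA subrr addr0 -(powR_inv1 (enorm_ge0 x)) -powRrM mulN1r.
rewrite -E -(CE 0 _ r0); apply: eq_integral => l _; congr EFin.
rewrite subr0 invrK /F1 enormZ ger0_norm ?enorm_ge0//.
rewrite powRM ?enorm_ge0// mulrA mulrA -powRM ?enorm_ge0 ?(ltW r0)// mulVf ?gt_eqF//.
rewrite powR1 mul1r; congr (_ * _); apply: gauss_scaleE; exact: mulrC.
Qed.

Let F2 l := enorm l `^ (- (2 * n%:R - a)) * expR (- (pi * (enorm l)^-1 ^+ 2)).

Let mF2 : measurable_fun setT F2.
Proof.
apply: measurable_funM; first exact: measurable_powN.
apply: (measurableT_comp (f := expR)); first exact: measurable_expR.
apply: measurable_funN; apply: measurable_funM => //; apply: measurable_funX.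
have -> : (fun x : 'rV[R]_n => (enorm x)^-1) = fun x => enorm x `^ (- 1).
  by apply/funext => x; rewrite powR_inv1// enorm_ge0.
exact: measurable_powN.
Qed.

Let F2_ge0 l : 0 <= F2 l. Proof. by rewrite mulr_ge0 ?powR_ge0 ?expR_ge0. Qed.

Let F2_lty : (\int[mu]_l (F2 l)%:E < +oo)%E.
Proof.
have [B B0 BP] := pow_expN_bounded (2 * n) (pi_gt0 R).
have s0 : n%:R < 2 * n%:R - a :> R by have := a_lt; lra.
have s1 : 0 < 2 * n%:R - a :> R by rewrite (lt_trans _ s0)// ltr0n riesz_dim_gt0.
have m1 : measurable_fun setT (fun x : 'rV[R]_n => B * (enorm x <= 1)%R%:R).
  apply: measurable_funM => //; apply: measurable_le_nat => //.
  exact: measurable_enormT.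
have m2 := measurable_powN_ge (2 * n%:R - a) (1 : R) (n := n).
apply: (@le_lt_trans _ _ (\int[mu]_x (B * (enorm x <= 1)%R%:R +
    enorm x `^ (- (2 * n%:R - a)) * (1 <= enorm x)%R%:R)%:E)%E).
  apply: le_integral_fin => //; first exact: measurable_funD.
  move=> l; have p0 := powR_ge0 (enorm l) (- (2 * n%:R - a)).
  have [l1|l1] := leP 1 (enorm l).
    rewrite mulr1 /F2 (@le_trans _ _ (enorm l `^ (- (2 * n%:R - a))))//.
      by rewrite ler_piMr// -expR0 ler_expR oppr_le0 mulr_ge0 ?pi_ge0 ?sqr_ge0.
    by rewrite lerDr mulr_ge0.
  rewrite (ltW l1) mulr1 mulr0 addr0 /F2.
  have [l0|l0] := eqVneq (enorm l) 0.
    by rewrite l0 powR0 ?mul0r// oppr_eq0 gt_eqF.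
  have {}l0 : 0 < enorm l by rewrite lt_neqAle eq_sym l0 enorm_ge0.
  have := BP (enorm l)^-1; rewrite invr_ge0 ltW// => /(_ isT); apply: le_trans.
  rewrite ler_wpM2r ?expR_ge0//.
  have -> : enorm l `^ (- (2 * n%:R - a)) = (enorm l)^-1 `^ (2 * n%:R - a).
    by rewrite -(powR_inv1 (ltW l0)) -powRrM mulN1r.
  apply: (@le_trans _ _ ((enorm l)^-1 `^ (2 * n)%:R)).
    by apply: ler_powR; rewrite ?invf_ge1 ?(ltW l1)// natrM lerBlDr lerDl ltW.
  rewrite powR_mulrn ?invr_ge0 ?(ltW l0)// lerXn2r ?nnegrE ?addr_ge0 ?invr_ge0 ?(ltW l0)//.
  by rewrite lerDr.
rewrite ge0_integralD_fin//; [|by move=> x; rewrite mulr_ge0// ?powR_ge0..].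
apply: lte_add_pinfty; last exact: integral_powN_ge1.
rewrite ge0_integralZ_fin//; last first.
  by apply: measurable_le_nat => //; exact: measurable_enormT.
by rewrite lte_mul_pinfty ?lee_fin// lebesgue_ball_lty.
Qed.

(** As [riesz_gauss1], after the inversion of the dilation parameter. The
    exponent [2 n - a] is the one that the Fourier transform, which turns
    [gauss (r xi)] into [r^-n gauss (x / r)], produces from [n - a]. *)
Lemma riesz_gauss2 : exists2 C2 : R, 0 <= C2 & forall x, x != 0 ->
  (\int[mu]_l (enorm l `^ (- (2 * n%:R - a)) * gauss ((enorm l)^-1 *: x))%:E =
   (C2 * enorm x `^ (- (n%:R - a)))%:E)%E.
Proof.
have [C C0 CE] := integral_scaled (2 * n%:R - a) mF2 F2_ge0 F2_lty.
exists C => // x x0; have e0 : 0 < enorm x by rewrite enorm_gt0.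
have -> : - (n%:R - a) = n%:R - (2 * n%:R - a) by ring.
rewrite -(CE 0 _ e0); apply: eq_integral => l _; congr EFin.
rewrite subr0 /F2 enormZ ger0_norm ?invr_ge0 ?enorm_ge0//.
rewrite powRM ?invr_ge0 ?enorm_ge0// mulrA mulrA -powRM ?invr_ge0 ?enorm_ge0//.
rewrite divff ?gt_eqF// powR1 mul1r; congr (_ * _).
rewrite /gauss dotrVZl dotrVZr -enorm_sqr invfM invrK; congr (expR (- (pi * _))).
by rewrite mulrA -expr2 -exprMn mulrC.
Qed.

End riesz_constants.

Section riesz_kernel.
Variables (R : realType) (n : nat) (a : R).
Hypotheses (a_gt0 : 0 < a) (a_lt : a < n%:R).
Notation mu := (lebesgue_rV R n).
Implicit Types (x y xi l : 'rV[R]_n).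

Let n_gt0 : (0 < n)%N := riesz_dim_gt0 a_gt0 a_lt.
Let na_gt0 : 0 < n%:R - a. Proof. by rewrite subr_gt0. Qed.

(** The Riesz kernel up to its constant. *)
Definition rk x : R := enorm x `^ (- (n%:R - a)).

Lemma rk_ge0 x : 0 <= rk x. Proof. exact: powR_ge0. Qed.

Lemma measurable_rk d (T : measurableType d) (f : T -> 'rV[R]_n) :
  measurable_fun setT f -> measurable_fun setT (fun t => rk (f t)).
Proof. by move=> mf; apply: measurable_funpow; exact: measurable_enorm. Qed.

(** Near the singularity the kernel is integrable, away from it the weight
    is. *)
Lemma rk_wt_bounded : exists2 M : R, 0 <= M & forall y,
  (\int[mu]_x (rk (x - y) * wt x)%:E <= M%:E)%E.
Proof.
have [|C C0 CE] := @integral_powN_lt R n (n%:R - a) (ltW na_gt0).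
  by rewrite ltrBlDr ltrDl.
pose W := fine (\int[mu]_x (wt x)%:E).
have w0 : (0 <= \int[mu]_x (wt x)%:E)%E.
  by apply: integral_ge0 => x _; rewrite lee_fin wt_ge0.
have WE : (\int[mu]_x (wt x)%:E = W%:E)%E.
  by rewrite /W fineK// ge0_fin_numE// integral_wt_lty.
have W0 : 0 <= W by rewrite -lee_fin -WE.
exists (C + W); first exact: addr_ge0.
move=> y; have mxy : measurable_fun setT (fun x : 'rV[R]_n => x - y).
  exact: measurable_rVB.
have m0 := measurable_enorm mxy.
have m1 : measurable_fun setT (fun x => rk (x - y) * (enorm (x - y) < 1)%R%:R).
  by apply: measurable_funM; [exact: measurable_rk|exact: measurable_lt_nat].
have mw := @measurable_wt R n.
apply: (@le_trans _ _ (\int[mu]_x (rk (x - y) * (enorm (x - y) < 1)%R%:R +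
    wt x)%:E)%E).
  apply: le_integral_fin.
  - by apply: measurable_funM => //; exact: measurable_rk.
  - exact: measurable_funD.
  - by move=> x; rewrite mulr_ge0// ?rk_ge0 ?wt_ge0.
  move=> x; have [x1|x1] := ltP (enorm (x - y)) 1.
    rewrite mulr1 (@le_trans _ _ (rk (x - y)))//.
      by rewrite ler_piMr ?rk_ge0 ?wt_le1.
    by rewrite lerDl wt_ge0.
  rewrite mulr0 add0r ler_piMl ?wt_ge0//.
  by apply: powRN_le1 => //; exact: ltW.
rewrite ge0_integralD_fin//; last 2 first.
- by move=> x; rewrite mulr_ge0// rk_ge0.
- exact: wt_ge0.
by rewrite WE EFinD leeD2r// (CE y 1 ltr01) powR1 mulr1.
Qed.

Lemma gauss_lty : (\int[mu]_x (gauss x)%:E < +oo)%E.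
Proof.
have [B B0 BP] := gauss_decay R n.
have mw : measurable_fun setT (fun x : 'rV[R]_n => B * wt x).
  by apply: measurable_funM => //; exact: measurable_wt.
apply: (@le_lt_trans _ _ (\int[mu]_x (B * wt x)%:E)%E).
  apply: le_integral_fin => //; first exact: measurable_gauss.
    by move=> x; exact: gauss_ge0.
  by move=> x; exact: gauss_le_decay.
rewrite ge0_integralZ_fin//; [|exact: measurable_wt|exact: wt_ge0].
by rewrite lte_mul_pinfty ?lee_fin// integral_wt_lty.
Qed.

Lemma gauss_scaled_lty (r : R) : 0 < r ->
  (\int[mu]_x (gauss (r *: x))%:E < +oo)%E.
Proof.
move=> r0; have r1 : r != 0 by rewrite gt_eqF.
have mg : measurable_fun setT (EFin \o @gauss R n).
  by apply/measurable_EFinP; exact: measurable_gauss.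
have -> : (\int[mu]_x (gauss (r *: x))%:E =
    \int[mu]_x (EFin \o @gauss R n) (r *: x + 0)%R)%E.
  by apply: eq_integral => x _; rewrite addr0.
rewrite (integral_rV_affine 0 r1 mg).
by apply: lte_mul_pinfty => //; rewrite ?lee_fin ?exprn_ge0 ?invr_ge0 ?gauss_lty.
Qed.

Let Fphi (phi : 'rV[R]_n -> R[i]) y xi : R[i] :=
  inv_fourier phi xi * cexpi (- (2 * pi * dotrV xi y)).

Section phi.
Variable phi : 'rV[R]_n -> R[i].
Hypothesis Sphi : schwartz phi.
Variable y : 'rV[R]_n.

Lemma cmeas_dot d (T : measurableType d) (f g : T -> 'rV[R]_n) :
  measurable_fun setT f -> measurable_fun setT g ->
  cmeas (fun t => cexpi (2 * pi * dotrV (f t) (g t))).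
Proof.
move=> mf mg; apply: cmeas_cexpi; apply: measurable_funM => //.
exact: measurable_dotrV.
Qed.

Lemma cmeas_dotN d (T : measurableType d) (f g : T -> 'rV[R]_n) :
  measurable_fun setT f -> measurable_fun setT g ->
  cmeas (fun t => cexpi (- (2 * pi * dotrV (f t) (g t)))).
Proof.
move=> mf mg; apply: cmeas_cexpi; apply: measurable_funN.
by apply: measurable_funM => //; exact: measurable_dotrV.
Qed.

Lemma cmeas_inv_fourier : cmeas (inv_fourier phi).
Proof.
apply: (@cmeas_cintegral R n n (fun xi x => phi x * cexpi (2 * pi * dotrV xi x))).
apply: cmeasM.
  apply: (cmeas_comp (schwartz_cmeas Sphi)); exact: measurable_snd.
by apply: cmeas_dot; [exact: measurable_fst|exact: measurable_snd].
Qed.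

Let cmeas_Fphi : cmeas (Fphi phi y).
Proof.
by apply: cmeasM; [exact: cmeas_inv_fourier|exact: cmeas_dotN].
Qed.

Let normc_Fphi xi : normc (Fphi phi y xi) = normc (inv_fourier phi xi).
Proof. by rewrite normcM normc_cexpi mulr1. Qed.

Lemma rpow_inv_fourier_lty :
  (\int[mu]_xi (enorm xi `^ (- a) * normc (inv_fourier phi xi))%:E < +oo)%E.
Proof.
have [B B0 BP] := inv_fourier_decay Sphi n.
apply: (integral_rw_le_lty a_gt0 a_lt _ _ B0 BP).
  by apply: cmeas_normc; exact: cmeas_inv_fourier.
by move=> x; exact: normc_ge0.
Qed.

Lemma schwartz_cintegrable : cintegrable phi.
Proof.
have [B B0 BP] := schwartz_wt Sphi.
apply: (cintegrable_le (b := fun x => B * wt x)) => //.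
- exact: schwartz_cmeas.
- by apply: measurable_funM => //; exact: measurable_wt.
rewrite ge0_integralZ_fin//; [|exact: measurable_wt|exact: wt_ge0].
by rewrite lte_mul_pinfty ?lee_fin// integral_wt_lty.
Qed.

(** Fubini's theorem and the transform of a scaled Gaussian. *)
Let gauss_multiplier (r : R) : 0 < r ->
  cintegral (fun xi => (gauss (r *: xi))%:C%C * Fphi phi y xi) =
  cintegral (fun x => ((r^-1 ^+ n * (gauss_mass R n * gauss (r^-1 *: (x - y))))%:C)%C * phi x).
Proof.
move=> r0.
pose K xi x := (gauss (r *: xi))%:C%C * cexpi (2 * pi * dotrV xi (x - y)) * phi x.
have mg : measurable_fun setT (fun xi : 'rV[R]_n => gauss (r *: xi)).
  by apply: measurable_gauss_comp; exact: measurable_rVZ.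
have mK : cmeas (fun p : 'rV[R]_n * 'rV[R]_n => K p.1 p.2).
  apply: cmeasM; last first.
    by apply: (cmeas_comp (schwartz_cmeas Sphi)); exact: measurable_snd.
  apply: cmeasM.
    apply: cmeas_real; exact: (measurableT_comp mg measurable_fst).
  apply: cmeas_dot; first exact: measurable_fst.
  by apply: measurable_rVB => //; exact: measurable_snd.
have nK xi x : normc (K xi x) = gauss (r *: xi) * normc (phi x).
  by rewrite /K !normcM normc_cexpi normc_real mulr1 ger0_norm ?gauss_ge0.
have mphi := cmeas_normc (schwartz_cmeas Sphi).
pose P := fine (\int[mu]_x (normc (phi x))%:E).
have PE : (\int[mu]_x (normc (phi x))%:E = P%:E)%E.
  have [_ foo] := schwartz_cintegrable; rewrite /P fineK// ge0_fin_numE//.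
  by apply: integral_ge0 => x _; rewrite lee_fin normc_ge0.
have P0 : 0 <= P.
  by rewrite -lee_fin -PE; apply: integral_ge0 => x _; rewrite lee_fin normc_ge0.
have Koo : (\int[mu]_xi \int[mu]_x (normc (K xi x))%:E < +oo)%E.
  under eq_integral => xi _.
    under eq_integral do rewrite nK.
    rewrite ge0_integralZ_fin ?gauss_ge0//; last by move=> x; exact: normc_ge0.
    rewrite PE -EFinM mulrC.
    over.
  rewrite ge0_integralZ_fin//; last by move=> x; exact: gauss_ge0.
  rewrite lte_mul_pinfty ?lee_fin//; exact: gauss_scaled_lty.
transitivity (cintegral (fun xi => cintegral (K xi))).
  apply: eq_cintegral => xi.
  rewrite /Fphi /inv_fourier mulrCA mulrC.
  rewrite -cintegralZ; last first.
    have : cintegrable (fun x => cexpi (2 * pi * dotrV xi x) * phi x).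
      apply: (cintegrableM (B := 1)) => //; first exact: cmeas_dot.
        by move=> x; rewrite normc_cexpi.
      exact: schwartz_cintegrable.
    by under eq_fun do rewrite mulrC.
  apply: eq_cintegral => x; rewrite /K dotrVDr dotrVNr.
  have -> : 2 * pi * (dotrV xi x - dotrV xi y) =
      2 * pi * dotrV xi x + - (2 * pi * dotrV xi y) by ring.
  by rewrite cexpiD; ring.
rewrite (cfubini mK Koo); apply: eq_cintegral => x; rewrite -fourier_gauss_scaled//.
rewrite mulrC -cintegralZ.
  by apply: eq_cintegral => xi; rewrite /K mulrC.
split.
  by apply: cmeasM; [exact: cmeas_real|exact: cmeas_dot].
under eq_integral do
  rewrite normcM normc_cexpi normc_real mulr1 ger0_norm ?gauss_ge0//.
exact: gauss_scaled_lty.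
Qed.

Lemma gauss_mass_ge0 : 0 <= gauss_mass R n.
Proof. by apply: Rintegral_ge0 => x _; exact: gauss_ge0. Qed.

Lemma integral_rk_schwartz_lty :
  (\int[mu]_x (rk (x - y) * normc (phi x))%:E < +oo)%E.
Proof.
have [M M0 MP] := rk_wt_bounded; have [B B0 BP] := schwartz_wt Sphi.
have mxy : measurable_fun setT (fun x : 'rV[R]_n => rk (x - y)).
  by apply: measurable_rk; exact: measurable_rVB.
have mw := @measurable_wt R n.
apply: (@le_lt_trans _ _ (\int[mu]_x (B * (rk (x - y) * wt x))%:E)%E).
  apply: le_integral_fin.
  - apply: measurable_funM => //; apply: cmeas_normc; exact: schwartz_cmeas.
  - by apply: measurable_funM => //; exact: measurable_funM.
  - by move=> x; rewrite mulr_ge0// ?rk_ge0 ?normc_ge0.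
  - by move=> x; rewrite mulrCA ler_wpM2l ?rk_ge0.
rewrite ge0_integralZ_fin//.
- by rewrite lte_mul_pinfty ?lee_fin// (le_lt_trans (MP y))// ltry.
- exact: measurable_funM.
- by move=> x; rewrite mulr_ge0// ?rk_ge0 ?wt_ge0.
Qed.

Lemma cintegrable_rpow :
  cintegrable (fun xi => ((enorm xi `^ (- a))%:C)%C *
    (inv_fourier phi xi * cexpi (- (2 * pi * dotrV xi y)))).
Proof.
split.
  by apply: cmeasM => //; apply: cmeas_real; exact: measurable_powN.
under eq_integral do
  rewrite normcM normc_real (ger0_norm (powR_ge0 _ _)) normc_Fphi.
exact: rpow_inv_fourier_lty.
Qed.

Lemma cintegrable_rk c : cintegrable (fun x => ((c * rk (x - y))%:C)%C * phi x).
Proof.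
have mr : measurable_fun setT (fun x : 'rV[R]_n => c * rk (x - y)).
  by apply: measurable_funM => //; apply: measurable_rk; exact: measurable_rVB.
split; first by apply: cmeasM; [exact: cmeas_real|exact: schwartz_cmeas].
under eq_integral do
  rewrite normcM normc_real normrM (ger0_norm (rk_ge0 _)) -mulrA.
rewrite ge0_integralZ_fin//.
- by rewrite lte_mul_pinfty ?lee_fin// integral_rk_schwartz_lty.
- apply: measurable_funM; first by apply: measurable_rk; exact: measurable_rVB.
  by apply: cmeas_normc; exact: schwartz_cmeas.
- by move=> x; rewrite mulr_ge0 ?rk_ge0 ?normc_ge0.
Qed.

Let measurable_inv_enorm : measurable_fun setT (fun l : 'rV[R]_n => (enorm l)^-1).
Proof.
have -> : (fun x : 'rV[R]_n => (enorm x)^-1) = fun x => enorm x `^ (- 1).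
  by apply/funext => x; rewrite powR_inv1// enorm_ge0.
exact: measurable_powN.
Qed.

Variables C1 C2 : R.
Hypotheses (C1_gt0 : 0 < C1) (C2_ge0 : 0 <= C2).
Hypothesis C1E : forall x, x != 0 ->
  (\int[mu]_l (enorm l `^ (- (n%:R - a)) * gauss (enorm l *: x))%:E =
   (C1 * enorm x `^ (- a))%:E)%E.
Hypothesis C2E : forall x, x != 0 ->
  (\int[mu]_l (enorm l `^ (- (2 * n%:R - a)) * gauss ((enorm l)^-1 *: x))%:E =
   (C2 * enorm x `^ (- (n%:R - a)))%:E)%E.

Let K1 xi l : R[i] :=
  ((enorm l `^ (- (n%:R - a)) * gauss (enorm l *: xi))%:C)%C * Fphi phi y xi.

Let K2 x l : R[i] :=
  ((gauss_mass R n * (enorm l `^ (- (2 * n%:R - a)) *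
    gauss ((enorm l)^-1 *: (x - y))))%:C)%C * phi x.

Let mK1 : cmeas (fun p : 'rV[R]_n * 'rV[R]_n => K1 p.1 p.2).
Proof.
apply: cmeasM; last by apply: (cmeas_comp cmeas_Fphi); exact: measurable_fst.
apply: cmeas_real; apply: measurable_funM.
  by apply: measurable_funpow; apply: measurable_enorm; exact: measurable_snd.
apply: measurable_gauss_comp; apply: measurable_rVZ; last exact: measurable_fst.
by apply: measurable_enorm; exact: measurable_snd.
Qed.

Let mK2 : cmeas (fun p : 'rV[R]_n * 'rV[R]_n => K2 p.1 p.2).
Proof.
apply: cmeasM; last first.
  by apply: (cmeas_comp (schwartz_cmeas Sphi)); exact: measurable_fst.
apply: cmeas_real; apply: measurable_funM => //; apply: measurable_funM.
  by apply: measurable_funpow; apply: measurable_enorm; exact: measurable_snd.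
apply: measurable_gauss_comp; apply: measurable_rVZ; last first.
  by apply: measurable_rVB => //; exact: measurable_fst.
exact: (measurableT_comp measurable_inv_enorm measurable_snd).
Qed.

Let mpow1 (z : 'rV[R]_n) : measurable_fun setT
  (fun l : 'rV[R]_n => enorm l `^ (- (n%:R - a)) * gauss (enorm l *: z)).
Proof.
apply: measurable_funM; first exact: measurable_powN.
by apply: measurable_gauss_comp; apply: measurable_rVZ => //; exact: measurable_enormT.
Qed.

Let mpow2 (z : 'rV[R]_n) : measurable_fun setT
  (fun l : 'rV[R]_n => enorm l `^ (- (2 * n%:R - a)) * gauss ((enorm l)^-1 *: z)).
Proof.
apply: measurable_funM; first exact: measurable_powN.
by apply: measurable_gauss_comp; apply: measurable_rVZ => //; exact: measurable_inv_enorm.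
Qed.

Let K1_int xi : xi != 0 ->
  cintegral (K1 xi) = ((C1 * enorm xi `^ (- a))%:C)%C * Fphi phi y xi.
Proof.
move=> xi0; apply: cintegral_realM => //; last exact: C1E.
by move=> l; rewrite mulr_ge0 ?powR_ge0 ?gauss_ge0.
Qed.

Let K2_int x : x != y ->
  cintegral (K2 x) = ((gauss_mass R n * (C2 * rk (x - y)))%:C)%C * phi x.
Proof.
move=> xy; have xy0 : x - y != 0 by rewrite subr_eq0.
have p0 l : 0 <= enorm l `^ (- (2 * n%:R - a)) * gauss ((enorm l)^-1 *: (x - y)).
  by rewrite mulr_ge0 ?powR_ge0 ?gauss_ge0.
apply: cintegral_realM.
- exact: measurable_funM.
- by move=> l; rewrite mulr_ge0 ?gauss_mass_ge0.
by rewrite ge0_integralZ_fin ?gauss_mass_ge0// C2E.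
Qed.

Let K1_lty : (\int[mu]_xi \int[mu]_l (normc (K1 xi l))%:E < +oo)%E.
Proof.
have mF : measurable_fun setT
    (fun xi => C1 * (enorm xi `^ (- a) * normc (inv_fourier phi xi))).
  apply: measurable_funM => //; apply: measurable_funM; first exact: measurable_powN.
  by apply: cmeas_normc; exact: cmeas_inv_fourier.
have p0 xi : 0 <= enorm xi `^ (- a) * normc (inv_fourier phi xi).
  by rewrite mulr_ge0 ?powR_ge0 ?normc_ge0.
rewrite (eq_integral_neq n_gt0 (b := 0) (g := fun xi => (C1 * (enorm xi `^ (- a) *
    normc (inv_fourier phi xi)))%:E))//.
- rewrite ge0_integralZ_fin ?(ltW C1_gt0)//.
    by rewrite lte_mul_pinfty ?lee_fin ?(ltW C1_gt0)// rpow_inv_fourier_lty.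
  apply: measurable_funM; first exact: measurable_powN.
  by apply: cmeas_normc; exact: cmeas_inv_fourier.
- exact: (measurable_normc_int mK1).
- exact/measurable_EFinP.
move=> xi xi0.
have g0 l : 0 <= enorm l `^ (- (n%:R - a)) * gauss (enorm l *: xi).
  by rewrite mulr_ge0 ?powR_ge0 ?gauss_ge0.
under eq_integral do rewrite normcM normc_real (ger0_norm (g0 _)) normc_Fphi mulrC.
rewrite ge0_integralZ_fin ?normc_ge0// C1E// -EFinM.
by congr EFin; ring.
Qed.

Let K2_lty : (\int[mu]_x \int[mu]_l (normc (K2 x l))%:E < +oo)%E.
Proof.
have mF : measurable_fun setT (fun x => rk (x - y) * normc (phi x)).
  apply: measurable_funM; first by apply: measurable_rk; exact: measurable_rVB.
  by apply: cmeas_normc; exact: schwartz_cmeas.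
have p0 x : 0 <= rk (x - y) * normc (phi x).
  by rewrite mulr_ge0 ?rk_ge0 ?normc_ge0.
have k0 : 0 <= gauss_mass R n * C2 by rewrite mulr_ge0 ?gauss_mass_ge0.
rewrite (eq_integral_neq n_gt0 (b := y) (g := fun x => (gauss_mass R n * C2 *
    (rk (x - y) * normc (phi x)))%:E))//.
- rewrite ge0_integralZ_fin//.
  by rewrite lte_mul_pinfty ?lee_fin// integral_rk_schwartz_lty.
- exact: (measurable_normc_int mK2).
- by apply/measurable_EFinP; exact: measurable_funM.
move=> x xy.
have xy0 : x - y != 0 by rewrite subr_eq0.
have g0 l : 0 <= enorm l `^ (- (2 * n%:R - a)) * gauss ((enorm l)^-1 *: (x - y)).
  by rewrite mulr_ge0 ?powR_ge0 ?gauss_ge0.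
have g1 l : 0 <= gauss_mass R n * (enorm l `^ (- (2 * n%:R - a)) *
    gauss ((enorm l)^-1 *: (x - y))).
  by rewrite mulr_ge0 ?gauss_mass_ge0.
under eq_integral do rewrite normcM normc_real (ger0_norm (g1 _)) mulrC.
rewrite ge0_integralZ_fin ?normc_ge0//; last exact: measurable_funM.
rewrite ge0_integralZ_fin ?gauss_mass_ge0// C2E// -!EFinM.
by congr EFin; rewrite /rk; ring.
Qed.

(** At a fixed dilation [|l|] this is [gauss_multiplier]; integrated over [l]
    it becomes the identity between the two powers. *)
Let K12 l : l != 0 -> cintegral (K1^~ l) = cintegral (K2^~ l).
Proof.
move=> l0; have e0 : 0 < enorm l by rewrite enorm_gt0.
have mgF : cmeas (fun xi => (gauss (enorm l *: xi))%:C%C * Fphi phi y xi).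
  by apply: cmeasM => //; apply: cmeas_real; apply: measurable_gauss_comp; exact: measurable_rVZ.
have igF : cintegrable (fun xi => (gauss (enorm l *: xi))%:C%C * Fphi phi y xi).
  have [B B0 BP] := inv_fourier_decay Sphi 0.
  split=> //; apply: (@le_lt_trans _ _ (\int[mu]_xi (B * gauss (enorm l *: xi))%:E)%E).
    apply: le_integral_fin.
    - exact: cmeas_normc.
    - by apply: measurable_funM => //; apply: measurable_gauss_comp; exact: measurable_rVZ.
    - by move=> xi; exact: normc_ge0.
    move=> xi; rewrite normcM normc_real ger0_norm ?gauss_ge0// mulrC.
    rewrite ler_wpM2r ?gauss_ge0// normc_Fphi.
    by have := BP xi; rewrite expr0 mul1r.
  rewrite ge0_integralZ_fin//.
  - by rewrite lte_mul_pinfty ?lee_fin// gauss_scaled_lty.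
  - by apply: measurable_gauss_comp; exact: measurable_rVZ.
  - by move=> x; exact: gauss_ge0.
transitivity (((enorm l `^ (- (n%:R - a)))%:C)%C *
    cintegral (fun xi => (gauss (enorm l *: xi))%:C%C * Fphi phi y xi)).
  rewrite -cintegralZ//; apply: eq_cintegral => xi.
  by rewrite /K1 rmorphM mulrA.
rewrite gauss_multiplier// -cintegralZ.
  apply: eq_cintegral => x; rewrite /K2 mulrA -rmorphM; congr ((_%:C)%C * _).
  have -> : - (2 * n%:R - a) = - (n%:R - a) + - n%:R by ring.
  rewrite powRD; last by apply/implyP; rewrite (gt_eqF e0).
  rewrite (powRN _ n%:R) powR_mulrn ?enorm_ge0// exprVn.
  by ring.
split.
  apply: cmeasM; last exact: schwartz_cmeas.
  apply: cmeas_real; apply: measurable_funM => //; apply: measurable_funM => //.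
  by apply: measurable_gauss_comp; apply: measurable_rVZ => //; exact: measurable_rVB.
have [mphi phioo] := schwartz_cintegrable.
have c0 : 0 <= (enorm l)^-1 ^+ n * gauss_mass R n.
  by rewrite mulr_ge0 ?gauss_mass_ge0 ?exprn_ge0 ?invr_ge0 ?enorm_ge0.
apply: (@le_lt_trans _ _ (\int[mu]_x ((enorm l)^-1 ^+ n * gauss_mass R n * normc (phi x))%:E)%E).
  apply: le_integral_fin.
  - apply: cmeas_normc; apply: cmeasM => //; apply: cmeas_real.
    apply: measurable_funM => //; apply: measurable_funM => //.
    by apply: measurable_gauss_comp; apply: measurable_rVZ => //; exact: measurable_rVB.
  - by apply: measurable_funM => //; exact: cmeas_normc.
  - by move=> x; exact: normc_ge0.
  move=> x; rewrite normcM normc_real ler_wpM2r ?normc_ge0// ger0_norm.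
    rewrite mulrA ler_piMr// /gauss -expR0 ler_expR oppr_le0.
    by rewrite mulr_ge0 ?pi_ge0 ?dotrV_ge0.
  by rewrite mulrA mulr_ge0 ?gauss_ge0.
rewrite ge0_integralZ_fin//.
- by rewrite lte_mul_pinfty ?lee_fin.
- exact: cmeas_normc.
- by move=> x; exact: normc_ge0.
Qed.

Lemma riesz_identity_aux :
  cintegral (fun xi => ((enorm xi `^ (- a))%:C)%C * Fphi phi y xi) =
  cintegral (fun x => ((gauss_mass R n * C2 / C1 * rk (x - y))%:C)%C * phi x).
Proof.
have iL := cintegrable_rpow; have [mL _] := iL.
have iR c := cintegrable_rk c; have mR c := (iR c).1.
have C1c : (C1%:C)%C != 0 by rewrite eq_complex /= eqxx andbT gt_eqF.
apply: (mulfI C1c); rewrite -cintegralZ// -cintegralZ//.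
transitivity (cintegral (fun xi => cintegral (K1 xi))).
  apply: (eq_cintegral_neq n_gt0 (b := 0)).
  - by apply: cmeasM => //; exact: cmeas_cst.
  - exact: (cmeas_cintegral mK1).
  by move=> xi xi0; rewrite K1_int// rmorphM mulrA.
transitivity (cintegral (fun x => cintegral (K2 x))); last first.
  apply: (eq_cintegral_neq n_gt0 (b := y)).
  - exact: (cmeas_cintegral mK2).
  - by apply: cmeasM => //; exact: cmeas_cst.
  move=> x xy; rewrite K2_int// [in RHS]mulrA -rmorphM; congr ((_%:C)%C * _).
  by field; rewrite gt_eqF.
rewrite (cfubini mK1 K1_lty) (cfubini mK2 K2_lty).
have ms : measurable_fun setT (fun p : 'rV[R]_n * 'rV[R]_n => (p.2, p.1)).
  by apply: measurable_fun_pair; [exact: measurable_snd|exact: measurable_fst].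
apply: (eq_cintegral_neq n_gt0 (b := 0)).
- exact: (cmeas_cintegral (K := fun l xi => K1 xi l) (cmeas_comp mK1 ms)).
- exact: (cmeas_cintegral (K := fun l xi => K2 xi l) (cmeas_comp mK2 ms)).
- exact: K12.
Qed.

End phi.

(** Up to a constant, [|x|^(a - n)] is the Fourier transform of [|xi|^-a]: by
    [riesz_gauss1] and [riesz_gauss2] both are superpositions of Gaussians,
    which correspond to each other. Testing at every [y] rather than only at
    the origin prepares the convolution with [f]. *)
Lemma riesz_identity : exists2 c : R, 0 <= c &
  forall (phi : 'rV[R]_n -> R[i]) y, schwartz phi ->
  cintegral (fun xi => ((enorm xi `^ (- a))%:C)%C *
    (inv_fourier phi xi * cexpi (- (2 * pi * dotrV xi y)))) =
  cintegral (fun x => ((c * rk (x - y))%:C)%C * phi x).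
Proof.
have [C1 C1_gt0 C1E] := riesz_gauss1 a_gt0 a_lt.
have [C2 C2_ge0 C2E] := riesz_gauss2 a_gt0 a_lt.
exists (gauss_mass R n * C2 / C1).
  by rewrite divr_ge0 ?(ltW C1_gt0)// mulr_ge0// gauss_mass_ge0.
by move=> phi y Sphi; exact: (riesz_identity_aux Sphi y C1_gt0 C2_ge0 C1E C2E).
Qed.

End riesz_kernel.

(** * Existence of the Riesz potential *)

Section riesz_existence.
Variables (R : realType) (n : nat) (a : R).
Hypotheses (a_gt0 : 0 < a) (a_lt : a < n%:R).
Notation mu := (lebesgue_rV R n).
Implicit Types (x y xi l : 'rV[R]_n) (f : 'rV[R]_n -> R[i]).

Lemma eq_cintegral_ae (h k : 'rV[R]_n -> R[i]) : cmeas h -> cmeas k ->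
  {ae mu, forall x, h x = k x} -> cintegral h = cintegral k.
Proof.
move=> [h1 h2] [k1 k2] hk; apply: complexP => /=; congr fine;
  apply: ae_eq_integral => //; try exact/measurable_EFinP;
  by move: hk; apply: filterS => x -> _.
Qed.

Lemma ae_cintegrable_slice (K : 'rV[R]_n -> 'rV[R]_n -> R[i]) :
  cmeas (fun p : 'rV[R]_n * 'rV[R]_n => K p.1 p.2) ->
  (\int[mu]_x \int[mu]_y (normc (K x y))%:E < +oo)%E ->
  {ae mu, forall x, cintegrable (K x)}.
Proof.
move=> mK Koo; have mN := measurable_normc_int mK.
have N0 x : (0 <= \int[mu]_y (normc (K x y))%:E)%E.
  by apply: integral_ge0 => y _; rewrite lee_fin normc_ge0.
have iN : mu.-integrable setT (fun x => \int[mu]_y (normc (K x y))%:E)%E.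
  by apply/integrableP; split => //; under eq_integral do rewrite gee0_abs//.
have := integrable_ae measurableT iN; apply: filterS => x /(_ I) xoo.
by split; [exact: cmeas_slice|rewrite -ge0_fin_numE].
Qed.

Section density.
Variable f : 'rV[R]_n -> R[i].
Hypothesis If : cintegrable f.

Let mf : cmeas f := If.1.

Definition L1n := fine (\int[mu]_x (normc (f x))%:E).

Lemma L1nE : (\int[mu]_x (normc (f x))%:E = L1n%:E)%E.
Proof.
rewrite /L1n fineK// ge0_fin_numE; first exact: If.2.
by apply: integral_ge0 => x _; rewrite lee_fin normc_ge0.
Qed.

Lemma L1n_ge0 : 0 <= L1n.
Proof.
by rewrite -lee_fin -L1nE; apply: integral_ge0 => x _; rewrite lee_fin normc_ge0.
Qed.

Lemma cmeas_fourier : cmeas (fourier f).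
Proof.
apply: (@cmeas_cintegral R n n (fun xi x => f x * cexpi (- (2 * pi * dotrV xi x)))).
apply: cmeasM.
  by apply: (cmeas_comp mf); exact: measurable_snd.
by apply: cmeas_dotN; [exact: measurable_fst|exact: measurable_snd].
Qed.

Lemma cintegrable_fourier xi :
  cintegrable (fun x => f x * cexpi (- (2 * pi * dotrV xi x))).
Proof.
have : cintegrable (fun x => cexpi (- (2 * pi * dotrV xi x)) * f x).
  apply: (cintegrableM (B := 1)) => //; first exact: cmeas_dotN.
  by move=> x; rewrite normc_cexpi.
by under eq_fun do rewrite mulrC.
Qed.

Lemma fourier_bounded xi : normc (fourier f xi) <= 2 * L1n.
Proof.
rewrite -lee_fin EFinM -L1nE.
have := le_normc_cintegral (cintegrable_fourier xi).1.
by under eq_integral do rewrite normcM normc_cexpi mulr1.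
Qed.

Lemma tempered_rpow_fourier :
  tempered_fun (fun xi => ((enorm xi `^ (- a))%:C)%C * fourier f xi).
Proof.
have mu' : cmeas (fun xi => ((enorm xi `^ (- a))%:C)%C * fourier f xi).
  by apply: cmeasM; [apply: cmeas_real; exact: measurable_powN|exact: cmeas_fourier].
split=> //; exists n.
have mi := @measurable_invX R n n.
apply: (@le_lt_trans _ _ (\int[mu]_x (2 * L1n * rw a x)%:E)%E).
  apply: le_integral_fin.
  - by apply: measurable_funM => //; exact: cmeas_normc.
  - by apply: measurable_funM => //; exact: measurable_rw.
  - by move=> x; rewrite divr_ge0 ?normc_ge0// exprn_ge0// ltW// enorm1_gt0.
  move=> x; rewrite normcM normc_real ger0_norm ?powR_ge0// /rw mulrAC mulrC.
  by rewrite ler_wpM2r ?fourier_bounded// rw_ge0.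
rewrite ge0_integralZ_fin//; [|by rewrite mulr_ge0// L1n_ge0|exact: measurable_rw|exact: rw_ge0].
by rewrite lte_mul_pinfty ?lee_fin ?mulr_ge0 ?L1n_ge0// integral_rw_lty.
Qed.

Variable c : R.
Hypothesis c_ge0 : 0 <= c.

Definition riesz_conv x := cintegral (fun y => ((c * rk a (x - y))%:C)%C * f y).

Let mK : cmeas (fun p : 'rV[R]_n * 'rV[R]_n => ((c * rk a (p.1 - p.2))%:C)%C * f p.2).
Proof.
apply: cmeasM; last by apply: (cmeas_comp mf); exact: measurable_snd.
apply: cmeas_real; apply: measurable_funM => //; apply: measurable_rk.
by apply: measurable_rVB; [exact: measurable_fst|exact: measurable_snd].
Qed.

Lemma cmeas_riesz_conv : cmeas riesz_conv.
Proof. exact: (cmeas_cintegral mK). Qed.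

(** Tonelli: integrate in [x] first. *)
Let wt_int_lty (phi : 'rV[R]_n -> R) (B : R) : measurable_fun setT phi ->
  (forall x, 0 <= phi x) -> 0 <= B -> (forall x, phi x <= B * wt x) ->
  (\int[mu]_x \int[mu]_y (phi x * (c * rk a (x - y) * normc (f y)))%:E < +oo)%E.
Proof.
move=> mphi phi0 B0 phiB; have [M M0 MP] := rk_wt_bounded a_gt0 a_lt.
pose H (p : 'rV[R]_n * 'rV[R]_n) := (phi p.1 * (c * rk a (p.1 - p.2) * normc (f p.2)))%:E.
have mH : measurable_fun setT H.
  apply/measurable_EFinP; apply: measurable_funM.
    exact: (measurableT_comp mphi measurable_fst).
  apply: measurable_funM.
    apply: measurable_funM => //; apply: measurable_rk.
    by apply: measurable_rVB; [exact: measurable_fst|exact: measurable_snd].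
  apply: cmeas_normc; apply: (cmeas_comp mf); exact: measurable_snd.
have H0 p : (0 <= H p)%E.
  by rewrite lee_fin !mulr_ge0 ?rk_ge0 ?normc_ge0.
have := fubini_tonelli (m1 := mu) (m2 := mu) H mH H0; rewrite /H /= => ->.
have mn := cmeas_normc mf.
apply: (@le_lt_trans _ _ (\int[mu]_y (B * c * M * normc (f y))%:E)%E).
  apply: ge0_le_integral => //.
  - by move=> y _; apply: integral_ge0 => x _; exact: (H0 (x, y)).
  - exact: (measurable_fun_fubini_tonelli_G H).
  - by apply/measurable_EFinP; exact: measurable_funM.
  move=> y _.
  have mr : measurable_fun setT (fun x : 'rV[R]_n => rk a (x - y)).
    by apply: measurable_rk; exact: measurable_rVB.
  have mw := @measurable_wt R n.
  apply: (@le_trans _ _ (\int[mu]_x (B * c * normc (f y) * (rk a (x - y) * wt x))%:E)%E).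
    apply: le_integral_fin.
    - apply: measurable_funM => //; apply: measurable_funM => //.
      exact: measurable_funM.
    - by apply: measurable_funM => //; exact: measurable_funM.
    - by move=> x; rewrite !mulr_ge0 ?rk_ge0 ?normc_ge0.
    move=> x; have := phiB x; rewrite -subr_ge0 => h.
    rewrite -subr_ge0.
    rewrite (_ : _ - _ = (B * wt x - phi x) * (c * rk a (x - y) * normc (f y))); last by ring.
    by rewrite !mulr_ge0 ?rk_ge0 ?normc_ge0.
  rewrite ge0_integralZ_fin ?mulr_ge0 ?normc_ge0//; last 2 first.
  - exact: measurable_funM.
  - by move=> x; rewrite mulr_ge0 ?rk_ge0 ?wt_ge0.
  have -> : B * c * M * normc (f y) = B * c * normc (f y) * M by ring.
  rewrite [leRHS]EFinM; apply: lee_wpmul2l; last exact: MP.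
  by rewrite lee_fin !mulr_ge0 ?normc_ge0.
rewrite ge0_integralZ_fin ?mulr_ge0//; last by move=> x; exact: normc_ge0.
by rewrite L1nE -EFinM ltry.
Qed.

Lemma tempered_riesz_conv : tempered_fun riesz_conv.
Proof.
split; first exact: cmeas_riesz_conv.
exists n.+1; have mw := @measurable_wt R n.
have w1 (x : 'rV[R]_n) : wt x <= 1 * wt x by rewrite mul1r.
have h := wt_int_lty mw (@wt_ge0 R n) ler01 w1.
have mn := cmeas_normc mf.
have msl x : measurable_fun setT (fun y => c * rk a (x - y) * normc (f y)).
  apply: measurable_funM => //; apply: measurable_funM => //.
  by apply: measurable_rk; exact: measurable_rVB.
have p0 x y : 0 <= c * rk a (x - y) * normc (f y).
  by rewrite !mulr_ge0 ?rk_ge0 ?normc_ge0.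
have mI : measurable_fun setT
    (fun x => \int[mu]_y (wt x * (c * rk a (x - y) * normc (f y)))%:E)%E.
  apply: (measurable_fun_fubini_tonelli_F (fun p : 'rV[R]_n * 'rV[R]_n =>
    (wt p.1 * (c * rk a (p.1 - p.2) * normc (f p.2)))%:E)).
    apply/measurable_EFinP; apply: measurable_funM.
      exact: (measurableT_comp mw measurable_fst).
    apply: measurable_funM.
      apply: measurable_funM => //; apply: measurable_rk.
      by apply: measurable_rVB; [exact: measurable_fst|exact: measurable_snd].
    apply: cmeas_normc; apply: (cmeas_comp mf); exact: measurable_snd.
  by move=> p; rewrite lee_fin mulr_ge0 ?wt_ge0.
apply: (@le_lt_trans _ _ (\int[mu]_x (2%:E *
    \int[mu]_y (wt x * (c * rk a (x - y) * normc (f y)))%:E))%E); last first.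
  rewrite ge0_integralZl//; last first.
    by move=> x _; apply: integral_ge0 => y _; rewrite lee_fin mulr_ge0 ?wt_ge0.
  by rewrite lte_mul_pinfty.
apply: ge0_le_integral => //.
- by move=> x _; rewrite lee_fin divr_ge0 ?normc_ge0// exprn_ge0// ltW// enorm1_gt0.
- apply/measurable_EFinP; apply: measurable_funM => //.
  by apply: cmeas_normc; exact: cmeas_riesz_conv.
- exact: measurable_funeM.
move=> x _; rewrite ge0_integralZ_fin ?wt_ge0// muleCA mulrC EFinM.
apply: lee_wpmul2l; first by rewrite lee_fin wt_ge0.
have h1 := le_normc_cintegral (cmeas_slice
  (K := fun x y => ((c * rk a (x - y))%:C)%C * f y) mK x).
have E : (\int[mu]_y (normc (((c * rk a (x - y))%:C)%C * f y))%:E =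
    \int[mu]_y (c * rk a (x - y) * normc (f y))%:E)%E.
  apply: eq_integral => y _.
  by rewrite normcM normc_real ger0_norm ?(mulr_ge0 c_ge0 (rk_ge0 _ _)).
by move: h1; rewrite /= E.
Qed.

Hypothesis cE : forall (phi : 'rV[R]_n -> R[i]) y, schwartz phi ->
  cintegral (fun xi => ((enorm xi `^ (- a))%:C)%C *
    (inv_fourier phi xi * cexpi (- (2 * pi * dotrV xi y)))) =
  cintegral (fun x => ((c * rk a (x - y))%:C)%C * phi x).

(** Fubini's theorem reduces to [riesz_identity] at each point [y]. The
    integral defining [riesz_conv] converges absolutely
    only almost everywhere. *)
Lemma riesz_conv_distr : is_distr_inv_fourier
  (fun xi => ((enorm xi `^ (- a))%:C)%C * fourier f xi) riesz_conv.
Proof.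
split; [exact: tempered_rpow_fourier|exact: tempered_riesz_conv|].
move=> phi Sphi; have mphi := schwartz_cmeas Sphi.
have [B B0 BP] := schwartz_wt Sphi.
pose K3 xi y := ((enorm xi `^ (- a))%:C)%C *
    (inv_fourier phi xi * cexpi (- (2 * pi * dotrV xi y))) * f y.
pose K4 x y := ((c * rk a (x - y))%:C)%C * phi x * f y.
have mK3 : cmeas (fun p : 'rV[R]_n * 'rV[R]_n => K3 p.1 p.2).
  apply: cmeasM; last by apply: (cmeas_comp mf); exact: measurable_snd.
  apply: cmeasM; last apply: cmeasM.
  - apply: cmeas_real; exact: (measurableT_comp (measurable_powN _) measurable_fst).
  - apply: (cmeas_comp (cmeas_inv_fourier Sphi)); exact: measurable_fst.
  - by apply: cmeas_dotN; [exact: measurable_fst|exact: measurable_snd].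
have mK4 : cmeas (fun p : 'rV[R]_n * 'rV[R]_n => K4 p.1 p.2).
  apply: cmeasM; last by apply: (cmeas_comp mf); exact: measurable_snd.
  apply: cmeasM; last by apply: (cmeas_comp mphi); exact: measurable_fst.
  apply: cmeas_real; apply: measurable_funM => //; apply: measurable_rk.
  by apply: measurable_rVB; [exact: measurable_fst|exact: measurable_snd].
have K3oo : (\int[mu]_xi \int[mu]_y (normc (K3 xi y))%:E < +oo)%E.
  under eq_integral => xi _.
    under eq_integral do rewrite /K3 !normcM normc_cexpi normc_real mulr1
      (ger0_norm (powR_ge0 _ _)).
    rewrite ge0_integralZ_fin ?mulr_ge0 ?powR_ge0 ?normc_ge0//; last 2 first.
    - exact: cmeas_normc.
    - by move=> x; exact: normc_ge0.
    rewrite L1nE -EFinM mulrC.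
    over.
  have mq : measurable_fun setT (fun x => enorm x `^ (- a) * normc (inv_fourier phi x)).
    apply: measurable_funM; first exact: measurable_powN.
    by apply: cmeas_normc; exact: (cmeas_inv_fourier Sphi).
  rewrite ge0_integralZ_fin ?L1n_ge0//; last first.
    by move=> x; rewrite mulr_ge0 ?powR_ge0 ?normc_ge0.
  by rewrite lte_mul_pinfty ?lee_fin ?L1n_ge0// (rpow_inv_fourier_lty a_gt0 a_lt Sphi).
have K4oo : (\int[mu]_x \int[mu]_y (normc (K4 x y))%:E < +oo)%E.
  apply: le_lt_trans (wt_int_lty (cmeas_normc mphi) (fun x => normc_ge0 _) B0 BP).
  rewrite le_eqVlt; apply/orP; left; apply/eqP.
  apply: eq_integral => x _; apply: eq_integral => y _.
  rewrite /K4 !normcM normc_real ger0_norm ?(mulr_ge0 c_ge0 (rk_ge0 _ _))//.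
  by congr EFin; ring.
symmetry; transitivity (cintegral (fun xi => cintegral (K3 xi))).
  apply: eq_cintegral => xi.
  rewrite /fourier mulrAC -cintegralZ; last exact: cintegrable_fourier.
  by apply: eq_cintegral => y; rewrite /K3; ring.
rewrite (cfubini mK3 K3oo).
transitivity (cintegral (fun x => cintegral (K4 x))).
  rewrite (cfubini mK4 K4oo); apply: eq_cintegral => y.
  transitivity (f y * cintegral (fun xi => ((enorm xi `^ (- a))%:C)%C *
    (inv_fourier phi xi * cexpi (- (2 * pi * dotrV xi y))))).
    rewrite -cintegralZ; last exact: (cintegrable_rpow a_gt0 a_lt Sphi).
    by apply: eq_cintegral => xi; rewrite mulrC.
  rewrite cE// -cintegralZ; last exact: (cintegrable_rk a_gt0 a_lt Sphi).
  by apply: eq_cintegral => xi; rewrite mulrC.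
apply: eq_cintegral_ae.
- exact: (cmeas_cintegral mK4).
- by apply: cmeasM => //; exact: cmeas_riesz_conv.
(* Weighting by [wt] makes the total mass finite, whence the integrability in
   [y] for almost every [x]. *)
pose K5 x y := (wt x)%:C%C * (((c * rk a (x - y))%:C)%C * f y).
have mw := @measurable_wt R n.
have mK5 : cmeas (fun p : 'rV[R]_n * 'rV[R]_n => K5 p.1 p.2).
  apply: cmeasM => //; apply: cmeas_real.
  exact: (measurableT_comp mw measurable_fst).
have K5oo : (\int[mu]_x \int[mu]_y (normc (K5 x y))%:E < +oo)%E.
  have w1 (x : 'rV[R]_n) : wt x <= 1 * wt x by rewrite mul1r.
  apply: le_lt_trans (wt_int_lty mw (@wt_ge0 R n) ler01 w1).
  rewrite le_eqVlt; apply/orP; left; apply/eqP.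
  apply: eq_integral => x _; apply: eq_integral => y _.
  by rewrite /K5 !normcM !normc_real (ger0_norm (wt_ge0 _))
    ger0_norm ?(mulr_ge0 c_ge0 (rk_ge0 _ _)).
have := ae_cintegrable_slice mK5 K5oo; apply: filterS => x iK5.
have wx : (wt x)%:C%C != 0 :> R[i] by rewrite eq_complex /= eqxx andbT gt_eqF// wt_gt0.
have iK : cintegrable (fun y => ((c * rk a (x - y))%:C)%C * f y).
  have := cintegrableZ ((wt x)%:C%C)^-1 iK5.
  by under eq_fun do rewrite /K5 mulrA mulVf// mul1r.
rewrite /riesz_conv mulrC -cintegralZ//.
by apply: eq_cintegral => y; rewrite /K4; ring.
Qed.

End density.
End riesz_existence.

(** * Test functions and uniqueness *)

Section test_functions.
Variables (R : realType) (n : nat).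
Implicit Types (x v : 'rV[R]_n) (p : 'I_n -> {poly R}).

Lemma poly_bounded (p : {poly R}) : exists2 B : R, 0 <= B & forall u : R,
  `|p.[u]| <= B * (1 + `|u|) ^+ size p.
Proof.
exists (\sum_(i < size p) `|p`_i|); first by apply: sumr_ge0.
move=> u; rewrite horner_coef (le_trans (ler_norm_sum _ _ _))// mulr_suml.
apply: ler_sum => i _; rewrite normrM ler_wpM2l// normrX.
have u1 : 1 <= 1 + `|u| by rewrite lerDl.
apply: (@le_trans _ _ ((1 + `|u|) ^+ i)).
  by rewrite lerXn2r ?nnegrE ?addr_ge0// lerDr.
by rewrite ler_weXn2l// ltnW.
Qed.

Variable q : 'I_n -> {poly R}.
Hypothesis q_ge : forall i (u : R), u ^+ 2 <= (q i).[u].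

Let g i (p : {poly R}) (u : R) := p.[u] * expR (- (q i).[u]).

Let g_decay i (p : {poly R}) N : exists2 B : R, 0 <= B & forall u,
  (1 + `|u|) ^+ N * `|g i p u| <= B.
Proof.
have [A A0 AP] := poly_bounded p.
have [B B0 BP] := pow_expN_bounded (size p + N) (ltr01 : (0 : R) < 1).
exists (A * B); first exact: mulr_ge0.
move=> u; have u0 : 0 <= 1 + `|u| by rewrite addr_ge0.
rewrite /g normrM (ger0_norm (expR_ge0 _)).
apply: (@le_trans _ _ (A * ((1 + `|u|) ^+ (size p + N) * expR (- (1 * `|u| ^+ 2))))).
  rewrite mul1r exprD [X in X <= _]mulrA.
  rewrite (_ : A * _ = ((1 + `|u|) ^+ N * (A * (1 + `|u|) ^+ size p)) * expR (- `|u| ^+ 2)); last by ring.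
  apply: ler_pM; rewrite ?mulr_ge0 ?exprn_ge0 ?expR_ge0//.
    by rewrite ler_wpM2l ?exprn_ge0.
  by rewrite ler_expR lerN2 real_normK ?num_real// q_ge.
by rewrite ler_wpM2l// BP.
Qed.

(** [g i p] has the derivative [g i (dp i p)], so derivatives of any order
    stay within this class of functions. *)
Let dp i (p : {poly R}) : {poly R} := p^`() - p * (q i)^`().

Let g_derive i (p : {poly R}) (u : R) : is_derive u 1 (g i p) (g i (dp i p) u).
Proof.
have D1 := is_derive_comp (f := expR) (is_derive_expR _)
  (is_derive_opp (is_derive_poly (q i) u)).
apply: (is_derive_eq (is_derive_mul (is_derive_poly p u) D1)).
by rewrite /g /dp hornerD hornerN hornerM; ring.
Qed.

Let g_continuous i (p : {poly R}) : continuous (g i p).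
Proof.
move=> u; apply: differentiable_continuous.
by apply/derivable1_diffP; have [] := g_derive i p u.
Qed.

(** Products of functions of one coordinate each, a class of Schwartz functions
    closed under partial derivatives in which everything is explicit. *)
Definition test_prod p x := \prod_i g i (p i) (x ord0 i).

Let upd p j : 'I_n -> {poly R} := fun i => if i == j then dp j (p j) else p i.

Lemma derive_of_line (h : 'rV[R]_n -> R) v x (a : R) :
  is_derive (0 : R) 1 (fun u => h (x + u *: v)) a -> is_derive x v h a.
Proof.
have E : (fun k : R => k^-1 *: ((h \o shift x) (k *: v) - h x)) =
   (fun k => k^-1 *: (((fun u => h (x + u *: v)) \o shift 0) (k *: (1 : R)) -
     (fun u => h (x + u *: v)) 0)).
  apply/funext => k /=; congr (_ *: (h _ - h _)); last by rewrite scale0r addr0.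
  by rewrite addr0 [k *: 1]mulr1 addrC.
move=> [d e]; split; first by rewrite /derivable E.
by rewrite -e /derive E.
Qed.

Lemma test_prod_derive p j x :
  is_derive x (delta_mx ord0 j) (test_prod p) (test_prod (upd p j) x).
Proof.
apply: derive_of_line.
pose K := \prod_(i | i != j) g i (p i) (x ord0 i).
have -> : (fun u : R => test_prod p (x + u *: delta_mx ord0 j)) =
    fun u => g j (p j) (u + x ord0 j) * K.
  apply/funext => u; rewrite /test_prod (bigD1 j)//= !mxE !eqxx mulr1 addrC.
  congr (_ * _); apply: eq_bigr => i ij; rewrite !mxE eqxx (negPf ij).
  by rewrite mulr0 addr0.
have D : is_derive (0 + x ord0 j) 1 (g j (p j)) (g j (dp j (p j)) (x ord0 j)).
  by rewrite add0r; exact: g_derive.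
have D' : is_derive (0 : R) 1 (fun u => g j (p j) (u + x ord0 j)) (g j (dp j (p j)) (x ord0 j)).
  exact: (is_derive_translate D).
have D2 : is_derive (0 : R) 1 (fun u => g j (p j) (u + x ord0 j) * K) _ :=
  is_derive_mul D' (is_derive_cst1 K 0).
refine (is_derive_eq D2 _).
rewrite mulr0 addr0 /test_prod (bigD1 j)//= /upd eqxx; congr (_ * _).
by apply: eq_bigr => i ij; rewrite (negPf ij).
Qed.

Lemma test_prod_continuous p : continuous (test_prod p).
Proof.
have H (s : seq 'I_n) : continuous (fun x : 'rV[R]_n => \prod_(i <- s) g i (p i) (x ord0 i)).
  elim: s => [|i s IHs] x.
    rewrite (_ : (fun _ => _) = cst 1); first exact: cst_continuous.
    by apply/funext => y; rewrite big_nil.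
  rewrite (_ : (fun _ => _) = (fun y : 'rV[R]_n =>
      g i (p i) (y ord0 i) * \prod_(j <- s) g j (p j) (y ord0 j))); last first.
    by apply/funext => y; rewrite big_cons.
  have h1 : {for x, continuous (fun y : 'rV[R]_n => g i (p i) (y ord0 i))}.
    apply: (continuous_comp (f := fun x : 'rV[R]_n => x ord0 i)).
      exact: coord_continuous.
    exact: g_continuous.
  exact: (continuousM h1 (IHs x)).
exact: H.
Qed.

Lemma test_prod_iter s p : exists p', iter_partial s (test_prod p) = test_prod p'.
Proof.
elim: s => [|i s [p' IHs]]; first by exists p.
exists (upd p' i); rewrite /= IHs; apply/funext => x.
by have := @derive_val _ _ _ _ _ _ _ (test_prod_derive p' i x).
Qed.

(** [1 + |x|] is at most the product of the [1 + |x_i|]. *)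
Lemma test_prod_schwartz p : rschwartz (test_prod p).
Proof.
split=> s => [x _|N]; have [p' ->] := test_prod_iter s p.
  split; first exact: test_prod_continuous.
  by move=> i; exact: (@ex_derive _ _ _ _ _ _ _ (test_prod_derive p' i x)).
have /choice[B BP] : forall i, exists B : R, forall u, (1 + `|u|) ^+ N * `|g i (p' i) u| <= B.
  by move=> i; have [B _ BP] := g_decay i (p' i) N; exists B.
exists (\prod_i B i) => x.
apply: (@le_trans _ _ (\prod_i ((1 + `|x ord0 i|) ^+ N * `|g i (p' i) (x ord0 i)|))); last first.
  apply: ler_prod => i _; rewrite BP andbT mulr_ge0// exprn_ge0// addr_ge0//.
rewrite big_split /= /test_prod normr_prod ler_wpM2r//.
  by apply: prodr_ge0 => i _; rewrite normr_ge0.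
rewrite prodrXl lerXn2r ?nnegrE ?(ltW (enorm1_gt0 _))//.
  by apply: prodr_ge0 => i _; rewrite addr_ge0.
apply: (@le_trans _ _ (1 + \sum_i `|x ord0 i|)).
  by rewrite lerD2l enorm_le_sum.
elim: (index_enum _) => [|i t IHt]; first by rewrite !big_nil addr0.
rewrite !big_cons mulrDl mul1r.
have h : 1 <= \prod_(j <- t) (1 + `|x ord0 j|).
  by apply: (le_trans _ IHt); rewrite lerDl sumr_ge0.
rewrite addrCA addrC lerD//.
by rewrite ler_peMr.
Qed.

End test_functions.

Section boxes.
Variables (R : realType) (n : nat).
Notation mu := (lebesgue_rV R n).

Definition box (c r : 'I_n -> R) : set 'rV[R]_n :=
  [set x | forall i, `|x ord0 i - c i| < r i].

Definition boxes : set (set 'rV[R]_n) := [set B | exists c r, B = box c r].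

Lemma measurable_box c r : measurable (box c r).
Proof.
rewrite (_ : box c r = [set x : 'rV[R]_n | forall i,
    `](c i - r i), (c i + r i)[%classic (x ord0 i)]).
  by apply: (@measurable_box_rV R n (fun i => `](c i - r i), (c i + r i)[%classic)) => i;
    exact: measurable_itv.
apply/seteqP; split => x /= xB i.
  by have := xB i; rewrite ltr_distl in_itv.
by have := xB i; rewrite ltr_distl in_itv.
Qed.

(** The intersection of two intervals is an interval, possibly of negative
    radius. *)
Lemma boxes_setI : setI_closed boxes.
Proof.
move=> _ _ [c [r ->]] [c' [r' ->]].
pose lo i := Num.max (c i - r i) (c' i - r' i).
pose hi i := Num.min (c i + r i) (c' i + r' i).
exists (fun i => (lo i + hi i) / 2), (fun i => (hi i - lo i) / 2).
apply/seteqP; split => x /=.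
  move=> [xB xB'] i; have := xB i; have := xB' i; rewrite !ltr_distl.
  move=> /andP[a1 a2] /andP[b1 b2].
  have l1 : lo i < x ord0 i by rewrite gt_max b1 a1.
  have l2 : x ord0 i < hi i by rewrite lt_min b2 a2.
  by apply/andP; split; lra.
move=> xB; split => i; have := xB i; rewrite !ltr_distl => /andP[h1 h2].
  have l1 : c i - r i <= lo i by rewrite le_max lexx.
  have l2 : hi i <= c i + r i by rewrite ge_min lexx.
  by apply/andP; split; lra.
have l1 : c' i - r' i <= lo i by rewrite le_max lexx orbT.
have l2 : hi i <= c' i + r' i by rewrite ge_min lexx orbT.
by apply/andP; split; lra.
Qed.

Lemma nat_gt_real (t : R) : exists k : nat, t < k.+1%:R.
Proof.
exists (Num.bound `|t|); rewrite (le_lt_trans (ler_norm t))//.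
by rewrite (lt_le_trans (archi_boundP (normr_ge0 t)))// ler_nat.
Qed.

Lemma nat_gt_coords (x : 'rV[R]_n) (t : R) : exists k : nat,
  t < k.+1%:R /\ forall i, `|x ord0 i| < k.+1%:R.
Proof.
have [k kP] := nat_gt_real (t + `|t| + enorm x); exists k.
have t0 := normr_ge0 t; have x0 := enorm_ge0 x; have tt := ler_norm t; split; first lra.
move=> i; have := ler_coord_enorm x i; have := ler_norm (- t); rewrite normrN; lra.
Qed.

(** A half space is a union of boxes one face of which lies on its boundary. *)
Lemma measurable_boxes : @measurable _ 'rV[R]_n `<=` <<s boxes >>.
Proof.
pose T := g_sigma_algebraType boxes.
have mid : measurable_fun [set: T] (fun x : T => x : 'rV[R]_n).
  apply/measurable_fun_rVP => i.
  apply: (measurability _ (RGenOInfty.measurableE R)) => //.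
  move=> _ [_ [a ->] <-]; rewrite setTI.
  rewrite (_ : _ @^-1` _ = \bigcup_(k : nat)
      box (fun j => if j == i then a + k.+1%:R else 0) (fun=> k.+1%:R)).
    apply: bigcupT_measurable => k; apply: sub_sigma_algebra.
    by exists (fun j => if j == i then a + k.+1%:R else 0), (fun=> k.+1%:R).
  apply/seteqP; split => x /=; rewrite in_itv /= andbT.
    move=> ax; have [k [k1 k2]] := nat_gt_coords x (x ord0 i - a).
    exists k => // j; case: eqP => [->|_]; last by rewrite subr0 k2.
    by rewrite ltr_distl; apply/andP; split; lra.
  move=> [k _ /(_ i)]; rewrite eqxx ltr_distl => /andP[]; lra.
by move=> A mA; have := mid measurableT A mA; rewrite setTI.
Qed.

(** Dynkin's pi-lambda theorem for the vanishing of integrals. *)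
Lemma ae_eq0_of_boxes (H : 'rV[R]_n -> R) : mu.-integrable setT (EFin \o H) ->
  (forall c r, (\int[mu]_x (H x * \1_(box c r) x)%:E = 0)%E) ->
  {ae mu, forall x, H x = 0}.
Proof.
move=> iH H0; have mH : measurable_fun setT H.
  by have /measurable_EFinP := measurable_int _ iH.
have iHA A : measurable A -> mu.-integrable setT (fun x => (H x * \1_A x)%:E).
  move=> mA; apply: le_integrable iH => //.
    by apply/measurable_EFinP; exact: measurable_funM.
  move=> x _ /=; rewrite lee_fin normrM indicE.
  by case: (x \in A); rewrite ?normr1 ?mulr1 ?normr0 ?mulr0.
pose L := [set A | measurable A /\ (\int[mu]_x (H x * \1_A x)%:E = 0)%E].
have Lnd : ndseq_closed L.
  move=> F ndF LF; have mF k := (LF k).1; have mU : measurable (\bigcup_k F k).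
    exact: bigcupT_measurable.
  split => //.
  have h : ((\int[mu]_x (H x * \1_(F k) x)%:E)%E @[k --> \oo] -->
      \int[mu]_x (H x * \1_(\bigcup_k F k) x)%:E)%E.
    apply: (dominated_cvg measurableT (g := fun x => `|H x|%:E)) => //.
    - by move=> k; exact: (measurable_int _ (iHA _ (mF k))).
    - move=> x _; apply: cvg_near_cst.
      have [[k _ Fkx]|nFx] := pselect ((\bigcup_k F k) x).
        near=> m; have km : (k <= m)%N by near: m; exact: nbhs_infty_ge.
        have /subsetPset Fkm := ndF k m km.
        congr ((_ * _)%:E); rewrite !indicE !mem_set//; first by exists k.
        exact: Fkm.
      near=> m; congr ((_ * _)%:E); rewrite !indicE !memNset// => Fmx.
      by apply: nFx; exists m.
    - by have := integrable_norm iH.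
    - move=> k x _; rewrite /= lee_fin normrM indicE.
      by case: (x \in F k); rewrite ?normr1 ?mulr1 ?normr0 ?mulr0.
  have E : (fun k => \int[mu]_x (H x * \1_(F k) x)%:E)%E = fun=> 0%E.
    by apply/funext => k; exact: (LF k).2.
  rewrite E in h; move/cvg_lim: h => <-//; exact: lim_cst.
have Lsd : setSD_closed L.
  move=> A B BA [mA A0] [mB B0]; split; first exact: measurableD.
  have E x : (H x * \1_(A `\` B) x)%:E = ((H x * \1_A x)%:E - (H x * \1_B x)%:E)%E.
    rewrite -EFinD -mulrBr; congr ((_ * _)%:E); rewrite !indicE in_setD.
    have [xB|xB] := boolP (x \in B); last by rewrite andbT subr0.
    by rewrite (mem_set (BA _ (set_mem xB))) subrr.
  under eq_integral do rewrite E.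
  by rewrite integralB ?A0 ?B0 ?sube0//; exact: iHA.
have Lbox : boxes `<=` L.
  by move=> _ [c [r ->]]; split; [exact: measurable_box|exact: H0].
have LT : L setT.
  pose F k := box (fun=> 0) (fun=> k.+1%:R).
  have -> : setT = \bigcup_k F k.
    apply/seteqP; split => x // _; have [k [_ kP]] := nat_gt_coords x 0.
    by exists k => // i; rewrite subr0.
  apply: Lnd; last by move=> k; apply: Lbox; exists (fun=> 0), (fun=> k.+1%:R).
  move=> k m km; apply/subsetPset => x xF i; apply: lt_le_trans (xF i) _.
  by rewrite ler_nat ltnS.
have Lall A : measurable A -> L A.
  move=> mA; apply: (lambda_system_subset boxes_setI (D := setT)) (measurable_boxes mA) => //.
have := @integral_ae_eq _ _ _ mu setT measurableT (cst 0%E) (EFin \o H) iH.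
move=> h; have : ae_eq mu setT (EFin \o H) (cst 0%E).
  apply: h => // E _ mE; rewrite integral0 integral_mkcond.
  have [_] := Lall E mE => <-; apply: eq_integral => x _.
  rewrite patchE indicE; case: (x \in E); first by rewrite mulr1.
  by rewrite mulr0.
by apply: filterS => x /(_ I) /= [].
Unshelve. all: by end_near. Qed.

End boxes.

Section uniqueness.
Variables (R : realType) (n : nat).
Notation mu := (lebesgue_rV R n).
Implicit Types (c r : 'I_n -> R) (x : 'rV[R]_n).

(** The first term gives the Gaussian decay, the second one cuts off outside
    the interval of centre [c i] and radius [r i] as [m] grows. *)
Definition cutq c r (m : nat) (i : 'I_n) : {poly R} :=
  'X^2 + m.+1%:R *: ((r i)^-1 *: ('X - (c i)%:P)) ^+ (2 * m.+1).

Lemma cutqE c r m i (u : R) :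
  (cutq c r m i).[u] = u ^+ 2 + m.+1%:R * (((u - c i) / r i) ^+ 2) ^+ m.+1.
Proof.
rewrite /cutq hornerD hornerXn hornerZ horner_exp hornerZ hornerXsubC -exprM.
by rewrite [(r i)^-1 * _]mulrC.
Qed.

Lemma cutq_ge c r m i (u : R) : u ^+ 2 <= (cutq c r m i).[u].
Proof. by rewrite cutqE lerDl mulr_ge0// exprn_ge0// sqr_ge0. Qed.

Definition cutoff c r m x := \prod_i expR (- (m.+1%:R * (((x ord0 i - c i) / r i) ^+ 2) ^+ m.+1)).

Definition test c r m := test_prod (cutq c r m) (fun=> 1).

Lemma testE c r m x : test c r m x = expR (- dotrV x x) * cutoff c r m x.
Proof.
rewrite /test /test_prod /cutoff /dotrV -sumrN expR_sum -big_split /=.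
by apply: eq_bigr => i _; rewrite hornerC mul1r cutqE opprD expRD expr2.
Qed.

Lemma cutoff_ge0 c r m x : 0 <= cutoff c r m x.
Proof. by apply: prodr_ge0 => i _; exact: expR_ge0. Qed.

Lemma cutoff_le1 c r m x : cutoff c r m x <= 1.
Proof.
apply: prodr_ile1 => i _; rewrite expR_ge0/= -expR0 ler_expR oppr_le0.
by rewrite mulr_ge0// exprn_ge0// sqr_ge0.
Qed.

Lemma rschwartz0 : rschwartz (fun _ : 'rV[R]_n => 0 : R).
Proof.
have E s : iter_partial s (fun _ : 'rV[R]_n => 0 : R) = fun=> 0.
  elim: s => [//|i s /= ->]; apply/funext => x; exact: derive_cst.
split=> s => [x _|N]; rewrite E; first by split => [|i]; [exact: cst_continuous|].
by exists 0 => x; rewrite normr0 mulr0.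
Qed.

(** The exponent tends to [0] for [v < 1], where powers win over [m], and to
    infinity for [v >= 1], the end point included because of the factor
    [m + 1]. *)
Lemma cutoff1_cvg (v : R) : 0 <= v ->
  expR (- (m.+1%:R * v ^+ m.+1)) @[m --> \oo] --> ((v < 1)%R%:R : R).
Proof.
move=> v0; have [v1|v1] := ltP v 1; last first.
  apply: (@squeeze_cvgr _ _ _ _ (cst 0) (fun m => expR (1 *- m))); last 2 first.
  - exact: cvg_cst.
  - exact: cvgn_expR.
  apply: nearW => m /=; rewrite expR_ge0/= ler_expR lerN2.
  apply: (@le_trans _ _ (m.+1%:R)); first by rewrite ler_nat.
  by rewrite ler_peMr// exprn_ege1.
rewrite -[X in _ --> X](_ : expR (- (0 : R)) = 1%:R); last by rewrite oppr0 expR0.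
apply: continuous_cvg; first exact: continuous_expR.
apply: cvgN.
have [->|v_neq0] := eqVneq v 0.
  rewrite (_ : (fun _ => _) = cst 0); first exact: cvg_cst.
  by apply/funext => m; rewrite exprS mul0r mulr0.
have {}v0 : 0 < v by rewrite lt_neqAle eq_sym v_neq0.
(* With [v = u ^ 2], one factor [u ^ m] absorbs [m] and the other one tends
   to zero. *)
pose u := Num.sqrt v; have u0 : 0 < u by rewrite sqrtr_gt0.
have uE : v = u * u by rewrite -expr2 sqr_sqrtr// ltW.
have u1 : u < 1 by rewrite -sqrtr1 ltr_sqrt.
have d0 : 0 < 1 - u by rewrite subr_gt0.
have mu_le (m : nat) : m.+1%:R * u ^+ m.+1 <= (1 - u)^-1.
  have u1' : `|u| < 1 by rewrite gtr0_norm.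
  have := geometric_le_lim m.+1 ler01 u0 u1'; rewrite mul1r; apply: le_trans.
  have -> : m.+1%:R * u ^+ m.+1 = \sum_(0 <= k < m.+1) u ^+ m.+1.
    by rewrite sumr_const_nat subn0 mulr_natl.
  rewrite /series /geometric /= !big_mkord; apply: ler_sum => k _.
  by rewrite mul1r ler_wiXn2l ?ltW// ltnW.
apply: (@squeeze_cvgr _ _ _ _ (cst 0) (fun m => (1 - u)^-1 * u ^+ m)); last 2 first.
- exact: cvg_cst.
- rewrite -[X in _ --> X](mulr0 (1 - u)^-1); apply: cvgM; first exact: cvg_cst.
  by apply: cvg_expr; rewrite gtr0_norm.
apply: nearW => m /=; rewrite mulr_ge0 ?exprn_ge0 ?(ltW v0)//=.
rewrite uE exprMn mulrA; apply: ler_pM; rewrite ?mulr_ge0 ?exprn_ge0 ?(ltW u0)//.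
by rewrite ler_wiXn2l ?ltW.
Qed.

Lemma cutoff_cvg c r x : (forall i, 0 < r i) ->
  cutoff c r m x @[m --> \oo] --> (\1_(box c r) x : R).
Proof.
move=> r0.
have -> : (\1_(box c r) x : R) = \prod_i ((((x ord0 i - c i) / r i) ^+ 2 < 1)%R%:R : R).
  have E i : (((x ord0 i - c i) / r i) ^+ 2 < 1) = (`|x ord0 i - c i| < r i).
    rewrite -real_normK ?num_real// expr_lt1// normf_div (gtr0_norm (r0 i)).
    by rewrite ltr_pdivrMr// mul1r.
  under eq_bigr do rewrite E.
  rewrite indicE; case: (boolP (x \in box c r)) => [|].
    rewrite inE => xB; rewrite big1// => i _; by rewrite xB.
  rewrite notin_setE => /existsNP[i /negP]; rewrite -leNgt leNgt => /negPf xi.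
  by rewrite (bigD1 i)//= xi mul0r.
rewrite /cutoff; elim: (index_enum _) => [|i s IHs].
  rewrite big_nil (_ : (fun _ => _) = cst 1); first exact: cvg_cst.
  by apply/funext => m; rewrite big_nil.
rewrite big_cons (_ : (fun _ => _) = fun m =>
  expR (- (m.+1%:R * (((x ord0 i - c i) / r i) ^+ 2) ^+ m.+1)) *
  \prod_(j <- s) expR (- (m.+1%:R * (((x ord0 j - c j) / r j) ^+ 2) ^+ m.+1))); last first.
  by apply/funext => m; rewrite big_cons.
by apply: cvgM IHs; apply: cutoff1_cvg; exact: sqr_ge0.
Qed.

(** The products with a Gaussian are integrable, and dominated convergence
    along the cutoffs yields their integrals over boxes. *)
Lemma distr_eq0 (h : 'rV[R]_n -> R) : measurable_fun setT h ->
  (exists N : nat, (\int[mu]_x (`|h x| / (1 + enorm x) ^+ N)%:E < +oo)%E) ->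
  (forall c r m, (\int[mu]_x (h x * test c r m x)%:E = 0)%E) ->
  {ae mu, forall x, h x = 0}.
Proof.
move=> mh [N hN] h0.
pose H x := h x * expR (- dotrV x x).
have [B B0 BP] := pow_expN_bounded N (ltr01 : (0 : R) < 1).
have mg : measurable_fun setT (fun x : 'rV[R]_n => expR (- dotrV x x)).
  apply: (measurableT_comp (f := expR)); first exact: measurable_expR.
  by apply: measurable_funN; exact: measurable_dotrV.
have mH : measurable_fun setT H by exact: measurable_funM.
have mN : measurable_fun setT (fun x => `|h x| / (1 + enorm x) ^+ N).
  by apply: measurable_funM; [exact: measurableT_comp|exact: measurable_invX].
have N0 x : 0 <= `|h x| / (1 + enorm x) ^+ N by rewrite mulr_ge0// invX_ge0.
have iH : mu.-integrable setT (EFin \o H).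
  have iN : mu.-integrable setT (EFin \o (fun x => B * (`|h x| / (1 + enorm x) ^+ N))).
    apply: ge0_integrable_fin; first exact: measurable_funM.
      by move=> x; rewrite mulr_ge0.
    by rewrite ge0_integralZ_fin// lte_mul_pinfty ?lee_fin.
  apply: le_integrable iN => //; first exact/measurable_EFinP.
  move=> x _ /=; rewrite lee_fin /H normrM (ger0_norm (expR_ge0 _)) [leRHS]ger0_norm; last first.
    by rewrite mulr_ge0.
  rewrite mulrCA ler_wpM2l// ler_pdivlMr ?exprn_gt0 ?enorm1_gt0//.
  by have := BP (enorm x) (enorm_ge0 x); rewrite mul1r enorm_sqr mulrC.
have HE : {ae mu, forall x, H x = 0}.
  apply: (ae_eq0_of_boxes iH) => c r.
  have [r0|] := pselect (forall i, 0 < r i); last first.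
    move=> /existsNP[i /negP]; rewrite -leNgt => ri.
    rewrite (eq_integral (cst 0%E)) ?integral0// => x _.
    rewrite indicE memNset ?mulr0// => /(_ i); apply/negP; rewrite -leNgt.
    by rewrite (le_trans ri).
  have h1 : ((\int[mu]_x (H x * cutoff c r m x)%:E)%E @[m --> \oo] -->
      \int[mu]_x (H x * \1_(box c r) x)%:E)%E.
    apply: (dominated_cvg measurableT (g := fun x => `|H x|%:E)) => //.
    - move=> m; apply/measurable_EFinP; apply: measurable_funM => //.
      apply: measurable_prod => i _.
      apply: (measurableT_comp (f := expR)); first exact: measurable_expR.
      apply: measurable_funN; apply: measurable_funM => //; apply: measurable_funX.
      apply: measurable_funX; apply: measurable_funM => //.
      by apply: measurable_funB => //; exact: measurable_coord_rV.
    - move=> x _; apply: cvg_EFin; first exact: nearW.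
      by apply: cvgM; [exact: cvg_cst|exact: cutoff_cvg].
    - by have := integrable_norm iH.
    - move=> m x _; rewrite /= lee_fin normrM ler_piMr//.
      by rewrite ger0_norm ?cutoff_ge0 ?cutoff_le1.
  rewrite (_ : (fun _ => _) = fun=> 0%E) in h1; last first.
    apply/funext => m; rewrite -(h0 c r m); apply: eq_integral => x _.
    by rewrite testE mulrA.
  by move/cvg_lim: h1 => <-//; exact: lim_cst.
apply: filterS HE => x /eqP; rewrite mulf_eq0 (gt_eqF (expR_gt0 _)) orbF.
by move/eqP.
Qed.

End uniqueness.

Section distr_unique.
Variables (R : realType) (n : nat).
Notation mu := (lebesgue_rV R n).
Implicit Types (h k : 'rV[R]_n -> R).

(** The growth condition of [tempered_fun] for real-valued functions. *)
Definition moderate h := measurable_fun setT h /\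
  exists N : nat, (\int[mu]_x (`|h x| / (1 + enorm x) ^+ N)%:E < +oo)%E.

Lemma moderateB h k : moderate h -> moderate k -> moderate (fun x => h x - k x).
Proof.
move=> [mh [N hN]] [mk [M kM]]; split; first exact: measurable_funB.
exists (N + M)%N.
have m1 : measurable_fun setT (fun x => `|h x| / (1 + enorm x) ^+ N).
  by apply: measurable_funM; [exact: measurableT_comp|exact: measurable_invX].
have m2 : measurable_fun setT (fun x => `|k x| / (1 + enorm x) ^+ M).
  by apply: measurable_funM; [exact: measurableT_comp|exact: measurable_invX].
apply: (@le_lt_trans _ _ (\int[mu]_x (`|h x| / (1 + enorm x) ^+ N +
    `|k x| / (1 + enorm x) ^+ M)%:E)%E).
  apply: le_integral_fin.
  - apply: measurable_funM; last exact: measurable_invX.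
    by apply: measurableT_comp => //; exact: measurable_funB.
  - exact: measurable_funD.
  - by move=> x; rewrite mulr_ge0// invX_ge0.
  move=> x; rewrite (@le_trans _ _ ((`|h x| + `|k x|) / (1 + enorm x) ^+ (N + M)))//.
    by rewrite ler_wpM2r ?invX_ge0// ler_normB.
  have le_inv (p q : nat) : (p <= q)%N -> (1 + enorm x) ^- q <= (1 + enorm x) ^- p.
    move=> pq; rewrite lef_pV2 ?posrE ?exprn_gt0 ?enorm1_gt0//.
    by rewrite ler_weXn2l// enorm1_ge1.
  rewrite mulrDl; apply: lerD; apply: ler_wpM2l => //; apply: le_inv.
    exact: leq_addr.
  exact: leq_addl.
rewrite ge0_integralD_fin//.
- exact: lte_add_pinfty.
- by move=> x; rewrite mulr_ge0// invX_ge0.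
- by move=> x; rewrite mulr_ge0// invX_ge0.
Qed.

Lemma moderate_integrable h (phi : 'rV[R]_n -> R) : moderate h -> rschwartz phi ->
  mu.-integrable setT (EFin \o (fun x => h x * phi x)).
Proof.
move=> [mh [N hN]] Sphi; have mphi := rschwartz_measurable Sphi.
have [_ bp] := Sphi; have [B BP] := bp [::] N.
have B0 : 0 <= B.
  by apply: le_trans (BP 0); rewrite mulr_ge0// exprn_ge0// ltW// enorm1_gt0.
have m1 : measurable_fun setT (fun x => `|h x| / (1 + enorm x) ^+ N).
  by apply: measurable_funM; [exact: measurableT_comp|exact: measurable_invX].
have n0 x : 0 <= `|h x| / (1 + enorm x) ^+ N by rewrite mulr_ge0// invX_ge0.
have iN : mu.-integrable setT (EFin \o (fun x => B * (`|h x| / (1 + enorm x) ^+ N))).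
  apply: ge0_integrable_fin; first exact: measurable_funM.
    by move=> x; rewrite mulr_ge0.
  by rewrite ge0_integralZ_fin// lte_mul_pinfty ?lee_fin.
apply: le_integrable iN => //; first by apply/measurable_EFinP; exact: measurable_funM.
move=> x _ /=; rewrite lee_fin normrM [leRHS]ger0_norm; last by rewrite mulr_ge0.
rewrite mulrCA ler_wpM2l// ler_pdivlMr ?exprn_gt0 ?enorm1_gt0// mulrC.
exact: BP.
Qed.

Lemma moderate_unique h k : moderate h -> moderate k ->
  (forall phi, rschwartz phi ->
    \int[mu]_x (h x * phi x) = \int[mu]_x (k x * phi x)) ->
  {ae mu, forall x, h x = k x}.
Proof.
move=> Mh Mk hk; have [mhk [N hkN]] := moderateB Mh Mk.
have : {ae mu, forall x, h x - k x = 0}.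
  apply: distr_eq0 => //; first by exists N.
  move=> c r m; have St := test_prod_schwartz (cutq_ge c r m) (fun=> 1).
  have ih := moderate_integrable Mh St; have ik := moderate_integrable Mk St.
  have ihk := moderate_integrable (moderateB Mh Mk) St.
  rewrite -[LHS]fineK; last exact: (integrable_fin_num measurableT ihk).
  congr EFin; transitivity (\int[mu]_x (h x * test c r m x - k x * test c r m x)).
    by apply: eq_Rintegral => x _; rewrite mulrBl.
  by rewrite RintegralB// hk// subrr.
by apply: filterS => x /eqP; rewrite subr_eq0 => /eqP.
Qed.

Lemma tempered_moderate (g : 'rV[R]_n -> R[i]) : tempered_fun g ->
  moderate (fun x => complex.Re (g x)) /\ moderate (fun x => complex.Im (g x)).
Proof.
move=> [[m1 m2] [N gN]].
have mi := @measurable_invX R n N.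
have mn : measurable_fun setT (fun x => normc (g x) / (1 + enorm x) ^+ N).
  by apply: measurable_funM => //; exact: cmeas_normc.
split; split => //; exists N; apply: le_lt_trans gN; apply: le_integral_fin => //.
- by apply: measurable_funM => //; exact: measurableT_comp.
- by move=> x; rewrite mulr_ge0// invX_ge0.
- by move=> x; rewrite ler_wpM2r ?invX_ge0// Re_le_normc.
- by apply: measurable_funM => //; exact: measurableT_comp.
- by move=> x; rewrite mulr_ge0// invX_ge0.
- by move=> x; rewrite ler_wpM2r ?invX_ge0// Im_le_normc.
Qed.

Lemma distr_inv_fourier_unique (u g g' : 'rV[R]_n -> R[i]) :
  is_distr_inv_fourier u g -> is_distr_inv_fourier u g' ->
  {ae mu, forall x, g x = g' x}.
Proof.
move=> [_ tg gP] [_ tg' g'P].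
have [Mr Mi] := tempered_moderate tg; have [Mr' Mi'] := tempered_moderate tg'.
have E phi : rschwartz phi -> cintegral (fun x => g x * (phi x)%:C%C) =
    cintegral (fun x => g' x * (phi x)%:C%C).
  move=> Sphi; have Sc : schwartz (fun x => (phi x)%:C%C).
    by apply/schwartzE; split => //; exact: rschwartz0.
  by rewrite gP// g'P.
have Er : {ae mu, forall x, complex.Re (g x) = complex.Re (g' x)}.
  apply: moderate_unique => // phi /E /(congr1 (@complex.Re R)) /= H.
  have e (f : 'rV[R]_n -> R[i]) : \int[mu]_x (complex.Re (f x) * phi x) =
      \int[mu]_x complex.Re (f x * (phi x)%:C%C).
    by apply: eq_Rintegral => x _; rewrite ReM/= mulr0 subr0.
  by rewrite !e.
have Ei : {ae mu, forall x, complex.Im (g x) = complex.Im (g' x)}.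
  apply: moderate_unique => // phi /E /(congr1 (@complex.Im R)) /= H.
  have e (f : 'rV[R]_n -> R[i]) : \int[mu]_x (complex.Im (f x) * phi x) =
      \int[mu]_x complex.Im (f x * (phi x)%:C%C).
    by apply: eq_Rintegral => x _; rewrite ImM/= mulr0 add0r.
  by rewrite !e.
by apply: filterS2 Er Ei => x; exact: complexP.
Qed.

End distr_unique.

(** * Lipschitz functions and the decay of their Fourier transforms *)

Section lipschitz.
Variable R : realType.

Lemma MVT_le_lt (g g' : R -> R) (a b M : R) : a < b ->
  (forall t, a <= t <= b -> is_derive t 1 g (g' t) /\ `|g' t| <= M) ->
  `|g b - g a| <= M * `|b - a|.
Proof.
move=> ab H; have [||c cab ->] := @MVT R g g' a b ab.
- move=> t; rewrite in_itv /= => /andP[t1 t2].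
  by have [] := H t _; rewrite ?(ltW t1) ?(ltW t2).
- apply: (derivable_within_continuous (f := g)) => t; rewrite in_itv /= => tab.
  by have [[]] := H t tab.
rewrite normrM ler_wpM2r//; move: cab; rewrite in_itv /= => /andP[c1 c2].
by have [] := H c _; rewrite ?(ltW c1) ?(ltW c2).
Qed.

Lemma MVT_le (g g' : R -> R) (a b M : R) :
  (forall t, Num.min a b <= t <= Num.max a b -> is_derive t 1 g (g' t) /\ `|g' t| <= M) ->
  `|g b - g a| <= M * `|b - a|.
Proof.
have [ab H|ba H|-> _] := ltgtP a b; last by rewrite !subrr normr0 mulr0.
- exact: (MVT_le_lt (g' := g') ab H).
- by rewrite distrC (distrC b); exact: (MVT_le_lt (g' := g') ba H).
Qed.

Lemma ler_norm_sin (t : R) : `|sin t| <= `|t|.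
Proof.
have := @MVT_le sin cos 0 t 1; rewrite sin0 !subr0 mul1r; apply=> s _; split.
  exact: is_derive_sin.
by rewrite ler_norml cos_le1 cos_geN1.
Qed.

Lemma ler_norm_cosB1 (t : R) : `|cos t - 1| <= `|t|.
Proof.
have := @MVT_le cos (fun s => - sin s) 0 t 1; rewrite cos0 !subr0 mul1r; apply=> s _; split.
  exact: is_derive_cos.
by rewrite normrN ler_norml sin_le1 sin_geN1.
Qed.

Lemma normc_cexpiB1 (t : R) : normc (cexpi t - 1) <= 2 * `|t|.
Proof.
rewrite (le_trans (normc_le_ReIm _))//= oppr0 addr0.
by have := ler_norm_sin t; have := ler_norm_cosB1 t; lra.
Qed.

Variable n : nat.
Implicit Types (x y z : 'rV[R]_n).

(** Cubes rather than balls: moving one coordinate of a point towards that of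
    another one does not leave a cube. *)
Definition cube z (e : R) x := forall i, `|x ord0 i - z ord0 i| < e.

Lemma enorm_cube z e x : enorm (x - z) < e -> cube z e x.
Proof.
move=> xz i; apply: le_lt_trans xz.
by have := ler_coord_enorm (x - z) i; rewrite !mxE.
Qed.

Lemma nbhs_cube z (P : 'rV[R]_n -> Prop) : (\forall x \near z, P x) ->
  exists2 e : R, 0 < e & forall x, cube z e x -> P x.
Proof.
move=> /nbhs_ballP[e /= e0 zP]; exists e => // x xz; apply: zP; split => // i j.
by rewrite (ord1 i) /ball /= distrC.
Qed.

(** Change the coordinates one at a time, and apply the mean value theorem to
    each step. *)
Lemma cube_lipschitz (f : 'rV[R]_n -> R) z e M :
  0 <= M ->
  (forall i x, cube z e x ->
    derivable f x (delta_mx ord0 i) /\ `|'D_(delta_mx ord0 i) f x| <= M) ->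
  forall x y, cube z e x -> cube z e y ->
  `|f x - f y| <= M * n%:R * enorm (x - y).
Proof.
move=> M0 H x y zx zy.
pose w (k : nat) : 'rV[R]_n := \row_i (if (i < k)%N then x ord0 i else y ord0 i).
have w0 : w 0%N = y by apply/rowP => i; rewrite mxE ltn0.
have wn : w n = x by apply/rowP => i; rewrite mxE ltn_ord.
rewrite -{1}wn -{1}w0 -(telescope_sumr (fun k => f (w k)) (leq0n n)) big_mkord.
rewrite (le_trans (ler_norm_sum _ _ _))//.
have -> : M * n%:R * enorm (x - y) = \sum_(i < n) M * enorm (x - y).
  by rewrite sumr_const card_ord -mulr_natl; ring.
apply: ler_sum => k _.
have wS : w k.+1 = w k + (x ord0 k - y ord0 k) *: delta_mx ord0 k.
  apply/rowP => i; rewrite !mxE eqxx ltnS /=.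
  have [->|ik] := eqVneq i k; first by rewrite leqnn ltnn mulr1 addrCA subrr addr0.
  by rewrite mulr0 addr0 ltn_neqAle -val_eqE /= in ik *; rewrite ik.
pose g (u : R) := f (w k + u *: delta_mx ord0 k).
have -> : f (w k.+1) - f (w k) = g (x ord0 k - y ord0 k) - g 0.
  by rewrite /g -wS scale0r addr0.
apply: (@le_trans _ _ (M * `|x ord0 k - y ord0 k - 0|)); last first.
  rewrite subr0 ler_wpM2l//.
  by have := ler_coord_enorm (x - y) k; rewrite !mxE.
apply: (@MVT_le g (fun u => 'D_(delta_mx ord0 k) f (w k + u *: delta_mx ord0 k))).
move=> u ub.
have cu : cube z e (w k + u *: delta_mx ord0 k).
  move=> i; rewrite !mxE eqxx /=; have [->|ik] := eqVneq i k; last first.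
    by rewrite mulr0 addr0; case: ifP.
  rewrite ltnn mulr1; have := zx k; have := zy k.
  rewrite !ltr_distl => /andP[b1 b2] /andP[b3 b4].
  move: ub; rewrite ge_min le_max => /andP[/orP[]u1 /orP[]u2];
    clear -u1 u2 b1 b2 b3 b4; apply/andP; split; lra.
have [d1 d2] := H k _ cu; split; last exact: d2.
exact: derivable_line.
Qed.

(** The first partial derivatives are continuous, hence locally bounded. *)
Lemma smooth_lipschitz (f : 'rV[R]_n -> R) (U : set 'rV[R]_n) z : open U -> U z ->
  smooth_on U f -> exists e L : R, [/\ 0 < e, 0 <= L,
    forall x y, cube z e x -> cube z e y -> `|f x - f y| <= L * enorm (x - y) &
    forall x, cube z e x -> U x].
Proof.
move=> oU Uz sf.
have nU : \forall x \near z, U x by exact: open_nbhs_nbhs.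
have np i : \forall x \near z,
    `|'D_(delta_mx ord0 i) f x| < `|'D_(delta_mx ord0 i) f z| + 1.
  have [c _] := sf [:: i] z Uz.
  have : \forall x \near z,
      `|'D_(delta_mx ord0 i) f z - 'D_(delta_mx ord0 i) f x| < 1.
    have {}c : 'D_(delta_mx ord0 i) f x @[x --> z] --> 'D_(delta_mx ord0 i) f z := c.
    by move/cvgrPdist_lt : c => /(_ 1 ltr01).
  apply: filterS => x h.
  have := ler_normB ('D_(delta_mx ord0 i) f z) ('D_(delta_mx ord0 i) f z - 'D_(delta_mx ord0 i) f x).
  by rewrite opprB addrCA subrr addr0; lra.
have npA : \forall x \near z, forall i,
    `|'D_(delta_mx ord0 i) f x| < `|'D_(delta_mx ord0 i) f z| + 1.
  exact: (@filter_forall _ 'I_n (fun i x => `|'D_(delta_mx ord0 i) f x| <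
    `|'D_(delta_mx ord0 i) f z| + 1) (nbhs z) _ np).
have [e e0 eP] := nbhs_cube (filterI nU npA).
pose M := \sum_i (`|'D_(delta_mx ord0 i) f z| + 1).
have M0 : 0 <= M by apply: sumr_ge0 => i _; rewrite addr_ge0.
exists e, (M * n%:R); split => //; first by rewrite mulr_ge0.
  apply: cube_lipschitz => // i x /eP[Ux Dx]; split.
    by have [_] := sf [::] x Ux; apply.
  rewrite (le_trans (ltW (Dx i)))// /M (bigD1 i)//= lerDl.
  by apply: sumr_ge0 => j _; apply: addr_ge0.
by move=> x /eP[].
Qed.

End lipschitz.

Section fourier_lipschitz.
Variables (R : realType) (n : nat).
Notation mu := (lebesgue_rV R n).
Variable Psi : 'rV[R]_n -> R[i].
Variables (L B rho : R).
Hypotheses (L0 : 0 <= L) (B0 : 0 <= B) (rho0 : 0 <= rho).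
Hypothesis PsiL : forall x y, normc (Psi x - Psi y) <= L * enorm (x - y).
Hypothesis PsiB : forall x, normc (Psi x) <= B.
Hypothesis Psi_supp : forall x, rho < enorm x -> Psi x = 0.

Lemma lipschitz_cmeas : cmeas Psi.
Proof.
have lip (f : 'rV[R]_n -> R) : (forall x y, `|f x - f y| <= L * enorm (x - y)) ->
    measurable_fun setT f.
  move=> fL; apply: continuous_measurable_rV => x.
  apply/(@cvgrPdist_lt _ _ _ (nbhs x) (nbhs_filter x)) => e e0.
  pose d := e / (1 + L * (1 + n%:R)).
  have k0 : 0 < 1 + L * (1 + n%:R) by rewrite ltr_pwDl// mulr_ge0 ?addr_ge0.
  have d0 : 0 < d by rewrite divr_gt0.
  apply/nbhs_ballP; exists d => //= y [_ xy].
  apply: (le_lt_trans (fL _ _)).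
  have h : enorm (x - y) <= n%:R * d.
    apply: (le_trans (enorm_le_sum _)).
    have -> : n%:R * d = \sum_(i < n) d by rewrite sumr_const card_ord mulr_natl.
    by apply: ler_sum => i _; rewrite !mxE; exact/ltW/xy.
  apply: (@le_lt_trans _ _ (L * (n%:R * d))); first by rewrite ler_wpM2l.
  have -> : L * (n%:R * d) = L * n%:R * e / (1 + L * (1 + n%:R)) by rewrite /d !mulrA.
  rewrite ltr_pdivrMr// (mulrC e) ltr_pM2r// mulrDr mulr1.
  by move: L0 => /=; lra.
split; apply: lip => x y.
  by rewrite -ReN -ReD (le_trans (Re_le_normc _)).
by rewrite -ImN -ImD (le_trans (Im_le_normc _)).
Qed.

Let V := fine (\int[mu]_x (enorm x <= rho + 1)%R%:R%:E).

Let mball r : measurable_fun setT (fun x : 'rV[R]_n => (enorm x <= r)%R%:R : R).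
Proof. by apply: measurable_le_nat => //; exact: measurable_enormT. Qed.

Let VE : (\int[mu]_x (enorm x <= rho + 1)%R%:R%:E = V%:E)%E.
Proof.
rewrite /V fineK// ge0_fin_numE ?lebesgue_ball_lty//.
by apply: integral_ge0 => x _; rewrite lee_fin.
Qed.

Let V0 : 0 <= V.
Proof.
by rewrite -lee_fin -VE; apply: integral_ge0 => x _; rewrite lee_fin.
Qed.

(** The radius [rho + 1] makes room for a translate by a vector of norm at
    most one. *)
Let cintegral_ball_le (h : 'rV[R]_n -> R[i]) M : 0 <= M -> cmeas h ->
  (forall x, normc (h x) <= M * (enorm x <= rho + 1)%R%:R) ->
  cintegrable h /\ normc (cintegral h) <= 2 * M * V.
Proof.
move=> M0 mh hM.
have le : (\int[mu]_x (normc (h x))%:E <= M%:E * V%:E)%E.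
  rewrite -VE -ge0_integralZ_fin//; apply: le_integral_fin => //.
  - exact: cmeas_normc.
  - exact: measurable_funM.
  - by move=> x; exact: normc_ge0.
split; first by split=> //; rewrite (le_lt_trans le)// -EFinM ltry.
rewrite -lee_fin (le_trans (le_normc_cintegral mh))// -mulrA EFinM.
by apply: lee_wpmul2l; rewrite ?lee_fin.
Qed.

Let ball_nat (x : 'rV[R]_n) (b : R) : 0 <= b -> Psi x = 0 \/ enorm x <= rho + 1 ->
  normc (Psi x) <= b -> normc (Psi x) <= b * (enorm x <= rho + 1)%R%:R.
Proof.
move=> b0 [->|->]; last by rewrite mulr1.
by rewrite normc0 => _; rewrite mulr_ge0.
Qed.

Let Psi_or x : Psi x = 0 \/ enorm x <= rho + 1.
Proof.
have [h|/Psi_supp ->] := leP (enorm x) rho; last by left.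
by right; rewrite (le_trans h)// lerDl.
Qed.

Lemma lipschitz_cintegrable : cintegrable Psi.
Proof.
have [] := @cintegral_ball_le Psi B B0 lipschitz_cmeas _ => // x.
exact: ball_nat.
Qed.

Let cint_mod y : cintegrable (fun x => Psi x * cexpi (- (2 * pi * dotrV y x))).
Proof.
have : cintegrable (fun x => cexpi (- (2 * pi * dotrV y x)) * Psi x).
  apply: (cintegrableM (B := 1)); first by apply: cmeas_dotN.
    by move=> x; rewrite normc_cexpi.
  exact: lipschitz_cintegrable.
by under eq_fun do rewrite mulrC.
Qed.

(** The support is bounded, and so [|exp(- 2 pi i y.x) - 1|] is at most a
    multiple of [|y|] on it. *)
Lemma fourier_lip_near0 : exists2 C : R, 0 <= C & forall y,
  normc (fourier Psi y - cintegral Psi) <= C * enorm y.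
Proof.
pose M := B * (2 * (2 * pi * (rho + 1))).
have M0 : 0 <= M by rewrite !mulr_ge0 ?pi_ge0 ?addr_ge0.
exists (2 * M * V); first exact: mulr_ge0 (mulr_ge0 (ler0n _ 2) M0) V0.
move=> y.
have -> : fourier Psi y - cintegral Psi =
    cintegral (fun x => Psi x * (cexpi (- (2 * pi * dotrV y x)) - 1)).
  transitivity (cintegral (fun x => Psi x * cexpi (- (2 * pi * dotrV y x)) + (-1) * Psi x)).
    rewrite cintegralD ?cintegralZ ?mulN1r//; first exact: lipschitz_cintegrable.
    by apply: cintegrableZ; exact: lipschitz_cintegrable.
  by apply: eq_cintegral => x; rewrite mulrBr mulr1 mulN1r.
have me : cmeas (fun x => Psi x * (cexpi (- (2 * pi * dotrV y x)) - 1)).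
  apply: cmeasM; first exact: lipschitz_cmeas.
  by apply: cmeasB; [apply: cmeas_dotN|exact: cmeas_cst].
have My : 0 <= M * enorm y by rewrite mulr_ge0 ?enorm_ge0.
have -> : 2 * M * V * enorm y = 2 * (M * enorm y) * V by ring.
apply: (cintegral_ball_le My me _).2 => x.
have [x1|x1] := leP (enorm x) (rho + 1); last first.
  by rewrite Psi_supp ?mul0r ?normc0 ?mulr0// (le_lt_trans _ x1)// lerDl.
rewrite mulr1 normcM /M -[leRHS]mulrA.
apply: ler_pM => //; [exact: normc_ge0|exact: normc_ge0|].
rewrite (le_trans (normc_cexpiB1 _))// normrN normrM ger0_norm ?mulr_ge0 ?pi_ge0//.
rewrite -!mulrA !ler_wpM2l ?pi_ge0//.
by rewrite (le_trans (ler_norm_dotrV _ _))// mulrC ler_wpM2r ?enorm_ge0.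
Qed.

(** Translating by half a period changes the sign of the character, so that
    twice the transform is the transform of a difference of [Psi]. *)
Lemma fourier_lip_decay : exists2 C : R, 0 <= C & forall y,
  normc (fourier Psi y) * enorm y <= C.
Proof.
exists (L * V + B * V); first by rewrite addr_ge0 ?mulr_ge0.
move=> y; have [y0|y0] := ltP (enorm y) 2^-1.
  have mF := (cint_mod y).1.
  have := (cintegral_ball_le B0 mF _).2; rewrite -/(fourier Psi y) => h.
  have {}h : normc (fourier Psi y) <= 2 * B * V.
    by apply: h => x; rewrite normcM normc_cexpi mulr1; exact: ball_nat.
  apply: (@le_trans _ _ (2 * B * V * 2^-1)).
    by rewrite ler_pM ?normc_ge0 ?enorm_ge0// ltW.
  rewrite -mulrA mulrC mulrA (mulrC _ 2) mulrA.
  have := mulr_ge0 L0 V0; lra.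
have e0 : 0 < enorm y by rewrite (lt_le_trans _ y0).
(* Half a period of the character at [y], of norm at most one since
   [1 / 2 <= |y|]. *)
pose eta := (2 * enorm y ^+ 2)^-1 *: y.
have etaE : dotrV y eta = 2^-1.
  by rewrite dotrVZr -enorm_sqr; field; rewrite gt_eqF.
have neta : enorm eta = (2 * enorm y)^-1.
  rewrite enormZ ger0_norm ?invr_ge0 ?mulr_ge0 ?exprn_ge0 ?enorm_ge0//.
  by field; rewrite gt_eqF.
have eta1 : enorm eta <= 1 by rewrite neta invf_le1 ?mulr_gt0//; lra.
pose D x := (Psi x - Psi (x + eta)) * cexpi (- (2 * pi * dotrV y x)).
have mt : measurable_fun setT (fun x : 'rV[R]_n => x + eta) by exact: measurable_rVD.
have mD : cmeas D.
  apply: cmeasM; last by apply: cmeas_dotN.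
  by apply: cmeasB; [|apply: cmeas_comp mt]; exact: lipschitz_cmeas.
have DE : cintegral D = 2 * fourier Psi y.
  have h x : Psi (x + eta) * cexpi (- (2 * pi * dotrV y (x + eta))) =
      - (Psi (x + eta) * cexpi (- (2 * pi * dotrV y x))).
    have -> : - (2 * pi * dotrV y (x + eta)) = - (2 * pi * dotrV y x) + - pi.
      by rewrite dotrVDr etaE; field.
    rewrite cexpiD mulrA; have -> : cexpi (- pi : R) = -1.
      by rewrite /cexpi cosN sinN cospi sinpi oppr0; apply: complexP; rewrite /= ?oppr0.
    by rewrite mulrN1.
  have T := cintegral_translate eta (cint_mod y).1.
  have iT : cintegrable (fun x => Psi (x + eta) * cexpi (- (2 * pi * dotrV y (x + eta)))).
    have [m1 f1] := cint_mod y; split; first exact: (cmeas_comp m1 mt).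
    have := ge0_integral_translate eta (cmeas_normc m1).
    by move=> ->.
  transitivity (cintegral (fun x => Psi x * cexpi (- (2 * pi * dotrV y x)) +
      Psi (x + eta) * cexpi (- (2 * pi * dotrV y (x + eta))))).
    by apply: eq_cintegral => x; rewrite h /D mulrBl.
  rewrite cintegralD; [|exact: cint_mod|exact: iT].
  by rewrite T -/(fourier Psi y) mulr2n mulrDl mul1r.
have Le : 0 <= L * enorm eta by rewrite mulr_ge0 ?enorm_ge0.
have := (cintegral_ball_le Le mD _).2; rewrite DE normcM => h.
have {}h : normc (2 : R[i]) * normc (fourier Psi y) <= 2 * (L * enorm eta) * V.
  apply: h => x; rewrite normcM normc_cexpi mulr1.
  have [x1|x1] := leP (enorm x) (rho + 1).
    by rewrite mulr1 (le_trans (PsiL _ _))// opprD addrA subrr add0r enormN.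
  rewrite mulr0 !Psi_supp ?subrr ?normc0//.
    have := ler_enormB x (- eta); rewrite opprK enormN; lra.
  by rewrite (le_lt_trans _ x1)// lerDl.
have n2 : normc (2 : R[i]) = 2.
  have -> : (2 : R[i]) = (2 : R)%:C%C by rewrite rmorph_nat.
  by rewrite normc_real normr_nat.
rewrite n2 neta in h.
have {}h : normc (fourier Psi y) <= L * (2 * enorm y)^-1 * V.
  by rewrite -(@ler_pM2l _ 2)// (le_trans h)// !mulrA.
apply: (@le_trans _ _ (L * (2 * enorm y)^-1 * V * enorm y)).
  by rewrite ler_wpM2r ?enorm_ge0.
have -> : L * (2 * enorm y)^-1 * V * enorm y = L * V / 2 by field; rewrite gt_eqF.
have := mulr_ge0 L0 V0; have := mulr_ge0 B0 V0; lra.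
Qed.

End fourier_lipschitz.

(** * Directions detected by the constraint *)

Section chart.
Variables (R : realType) (l k : nat).

(** The rows of [A] are dual to the columns [J], so the coordinates of a
    vector of the subspace in this basis are its entries in these columns. *)
Lemma chart_mem (J : 'I_k -> 'I_l) (V : grassmannian R l k) A (v : 'rV[R[i]]_l) :
  grassmannian_chart J V A ->
  (v \in val V <-> forall m, v ord0 m = \sum_j v ord0 (J j) * A j m).
Proof.
move=> [AJ ->]; split=> [|vE]; last first.
  have -> : v = \sum_j v ord0 (J j) *: row j A.
    by apply/rowP => m; rewrite summxE vE; apply: eq_bigr => j _; rewrite !mxE.
  apply: memv_suml => j _; apply/memvZ/memv_span/mapP.
  by exists j => //; rewrite mem_enum.
pose N : 'M[R[i]]_l := 1%:M - colsub J 1%:M *m A.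
have NE (u : 'rV[R[i]]_l) m : (u *m N) ord0 m = u ord0 m - \sum_j u ord0 (J j) * A j m.
  rewrite /N mulmxBr mulmx1 mulmxA !mxE; congr (_ - _); apply: eq_bigr => j _.
  congr (_ * _); rewrite !mxE (bigD1 (J j))//= !mxE eqxx mulr1 big1 ?addr0// => i ij.
  by rewrite !mxE (negPf ij) mulr0.
have sub : (<<[seq row i A | i : 'I_k]>> <= lker (linfun (mulmxr N)))%VS.
  apply/span_subvP => _ /mapP[i _ ->]; rewrite memv_ker lfunE /=; apply/eqP/rowP => m.
  rewrite NE !mxE (bigD1 i)//= big1 ?addr0; last first.
    move=> j ji; have := congr1 (fun B : 'M[R[i]]_(k, k) => B i j) AJ; rewrite !mxE eq_sym (negPf ji).
    by move=> ->; rewrite mul0r.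
  have := congr1 (fun B : 'M[R[i]]_(k, k) => B i i) AJ; rewrite !mxE eqxx => ->.
  by rewrite mul1r subrr.
move=> /(subvP sub); rewrite memv_ker lfunE /= => /eqP vN m.
by have := NE v m; rewrite vN mxE => /esym/eqP; rewrite subr_eq0 => /eqP.
Qed.

End chart.

Section spanning.
Variables (F : fieldType) (l : nat) (P : 'rV[F]_l -> Prop).

(** As long as the subspace is proper, it has a nonzero orthogonal vector [v]
    for the bilinear pairing, and a vector [e] that [v] does not annihilate
    enlarges it. *)
Lemma separating_subspace : P 0 -> (forall u v, P u -> P v -> P (u + v)) ->
  (forall a v, P v -> P (a *: v)) ->
  (forall v : 'rV_l, v != 0 -> exists2 e : 'rV_l, P e & \sum_m v ord0 m * e ord0 m != 0) ->
  forall v, P v.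
Proof.
move=> P0 PD PZ sep.
suff H c : exists2 M : 'M[F]_l, (minn c l <= \rank M)%N &
    forall u : 'rV_l, (u <= M)%MS -> P u.
  have [M rM MP] := H l; rewrite minnn in rM => v; apply: MP.
  by apply: submx_full; rewrite /row_full eqn_leq rank_leq_col.
elim: c => [|c [M rM MP]].
  by exists 0; [rewrite min0n|move=> u; rewrite submx0 => /eqP ->].
have [ge|lt] := leqP l (\rank M).
  by exists M => //; rewrite (leq_trans _ ge)// geq_minr.
have : kermx M^T != 0 by rewrite kermx_eq0 /row_free mxrank_tr neq_ltn lt.
move=> /rowV0Pn[v /sub_kermxP vM v0]; have [e Pe ve] := sep v v0.
have vE : (v *m e^T) ord0 ord0 = \sum_m v ord0 m * e ord0 m.
  by rewrite mxE; apply: eq_bigr => m _; rewrite mxE.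
have eM : ~~ (e <= M)%MS.
  apply: contra ve => /submxP[D eD].
  by rewrite -vE eD trmx_mul mulmxA vM mul0mx mxE.
exists (M + e)%MS.
  apply: leq_trans (_ : (\rank M < \rank (M + e)%MS)%N); last first.
    apply: rank_ltmx; rewrite ltmxE addsmxSl /=.
    by apply: contra eM => h; apply: submx_trans h; exact: addsmxSr.
  apply: (@leq_trans (minn c l).+1); last by rewrite ltnS.
  by rewrite -minnSS leq_min geq_minl (leq_trans (geq_minr _ _)).
move=> u /sub_addsmxP[[D1 D2] -> /=]; apply: PD; first by apply: MP; exact: submxMl.
by rewrite (mx11_scalar D2) mul_scalar_mx; exact: PZ.
Qed.

End spanning.

Section fourier_swap.
Variables (R : realType) (n : nat).
Variables (f h : 'rV[R]_n -> R[i]) (If : cintegrable f) (Ih : cintegrable h).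

(** Parseval's formula, for a dilate and translate of one of the functions. *)
Lemma fourier_swap (r : R) (x0 : 'rV[R]_n) :
  cintegral (fun y => f y * fourier h (r *: (y - x0))) =
  cintegral (fun xi => h xi * cexpi (2 * pi * dotrV (r *: x0) xi) * fourier f (r *: xi)).
Proof.
have [[mf foo] [mh hoo]] := (If, Ih).
pose K (y xi : 'rV[R]_n) := f y * (h xi * cexpi (- (2 * pi * dotrV (r *: (y - x0)) xi))).
have mK : cmeas (fun p : 'rV[R]_n * 'rV[R]_n => K p.1 p.2).
  apply: cmeasM; first by apply: (cmeas_comp mf); exact: measurable_fst.
  apply: cmeasM; first by apply: (cmeas_comp mh); exact: measurable_snd.
  apply: cmeas_dotN; last exact: measurable_snd.
  by apply: measurable_rVZ => //; apply: measurable_rVB => //; exact: measurable_fst.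
have nK y xi : normc (K y xi) = normc (f y) * normc (h xi).
  by rewrite !normcM normc_cexpi mulr1.
have Koo : (\int[lebesgue_rV R n]_y \int[lebesgue_rV R n]_xi (normc (K y xi))%:E < +oo)%E.
  have E y : (\int[lebesgue_rV R n]_xi (normc (K y xi))%:E = (L1n h * normc (f y))%:E)%E.
    under eq_integral do rewrite nK.
    rewrite ge0_integralZ_fin ?normc_ge0//; last 2 first.
    - exact: cmeas_normc.
    - by move=> x; exact: normc_ge0.
    by rewrite L1nE// -EFinM mulrC.
  under eq_integral do rewrite E.
  rewrite ge0_integralZ_fin ?L1n_ge0//; last 2 first.
  - exact: cmeas_normc.
  - by move=> x; exact: normc_ge0.
  by rewrite L1nE// -EFinM ltry.
have := cfubini mK Koo.
have -> : cintegral (fun y => cintegral (K y)) =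
    cintegral (fun y => f y * fourier h (r *: (y - x0))).
  by apply: eq_cintegral => y; rewrite cintegralZ//; exact: cintegrable_fourier.
move=> ->; apply: eq_cintegral => xi.
rewrite /fourier -cintegralZ; last exact: cintegrable_fourier.
apply: eq_cintegral => y; rewrite /K.
have -> : - (2 * pi * dotrV (r *: (y - x0)) xi) =
    2 * pi * dotrV (r *: x0) xi + - (2 * pi * dotrV (r *: xi) y).
  by rewrite !dotrVZl dotrVDl dotrVNl (dotrVC xi y); ring.
by rewrite cexpiD; ring.
Qed.

End fourier_swap.

Section multipliers.
Variables (R : realType) (n l k : nat) (Omega : sphere R n -> grassmannian R l k).
Implicit Types (f : 'rV[R]_n -> 'rV[R[i]]_l) (e : 'rV[R[i]]_l).

(** The vectors for which a correction of the Riesz kernel is available. The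
    first estimate makes [e] the value of [Phi] at the origin. *)
Definition orthogonal_limit e :=
  exists (Phi : 'I_l -> 'rV[R]_n -> R[i]) (C : R),
  [/\ 0 <= C, forall m, cmeas (Phi m),
      forall m y, normc (Phi m y - e ord0 m) <= C * enorm y,
      forall m y, normc (Phi m y) * enorm y <= C &
      forall f, W1 Omega f -> forall (x0 : 'rV[R]_n) (r : R), 0 < r ->
        cintegral (fun y => \sum_m f y ord0 m * Phi m (r *: (y - x0))) = 0].

(** The first bound is used in the unit ball, the second one outside. *)
Lemma near_decay_bounded (Phi : 'rV[R]_n -> R[i]) z (C : R) : 0 <= C ->
  (forall y, normc (Phi y - z) <= C * enorm y) ->
  (forall y, normc (Phi y) * enorm y <= C) ->
  forall y, normc (Phi y) <= normc z + C.
Proof.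
move=> C0 near decay y; have [y1|y1] := leP (enorm y) 1.
  rewrite -{1}(subrK z (Phi y)) (le_trans (normcD _ _))// addrC lerD2l.
  by rewrite (le_trans (near y))// ler_piMr.
rewrite (@le_trans _ _ C) ?lerDr ?normc_ge0// (le_trans _ (decay y))//.
by rewrite ler_peMr ?normc_ge0// ltW.
Qed.

Lemma L1_fun_cintegrable f j : L1_fun f -> cintegrable (fun x => f x ord0 j).
Proof. by move=> /(_ j)[h1 h2]; exact: cintegrableP. Qed.

Lemma cintegrable_dilate (Phi : 'rV[R]_n -> R[i]) (B : R) (h : 'rV[R]_n -> R[i]) r x0 :
  cmeas Phi -> (forall y, normc (Phi y) <= B) -> cintegrable h ->
  cintegrable (fun y => h y * Phi (r *: (y - x0))).
Proof.
move=> mP PB Ih; have : cintegrable (fun y => Phi (r *: (y - x0)) * h y).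
  apply: (cintegrableM (B := B)) => //; apply: (cmeas_comp mP).
  by apply: measurable_rVZ => //; apply: measurable_rVB.
by under eq_fun do rewrite mulrC.
Qed.

Lemma orthogonal_limit0 : orthogonal_limit 0.
Proof.
exists (fun _ _ => 0), 0; split => //.
- by move=> m y; rewrite mxE subrr normc0 mul0r.
- by move=> m y; rewrite normc0 mul0r.
move=> f _ x0 r _; rewrite -[RHS](@cintegral0 R n); apply: eq_cintegral => y.
by rewrite big1// => m _; rewrite mulr0.
Qed.

Lemma orthogonal_limitD e1 e2 :
  orthogonal_limit e1 -> orthogonal_limit e2 -> orthogonal_limit (e1 + e2).
Proof.
move=> [P1 [C1 [C10 m1 n1 d1 o1]]] [P2 [C2 [C20 m2 n2 d2 o2]]].
exists (fun m y => P1 m y + P2 m y), (C1 + C2); split.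
- exact: addr_ge0.
- by move=> m; exact: cmeasD.
- move=> m y; rewrite !mxE opprD addrACA mulrDl (le_trans (normcD _ _))//.
  exact: lerD.
- move=> m y; apply: (@le_trans _ _ (normc (P1 m y) * enorm y + normc (P2 m y) * enorm y)).
    by rewrite -mulrDl ler_wpM2r ?enorm_ge0// normcD.
  exact: lerD.
move=> f Wf x0 r r0; have If m := L1_fun_cintegrable m Wf.1.
have I1 m := cintegrable_dilate r x0 (m1 m) (near_decay_bounded C10 (n1 m) (d1 m)) (If m).
have I2 m := cintegrable_dilate r x0 (m2 m) (near_decay_bounded C20 (n2 m) (d2 m)) (If m).
have h1 := o1 f Wf x0 r r0; have h2 := o2 f Wf x0 r r0.
rewrite cintegral_sum// in h1; rewrite cintegral_sum// in h2.
transitivity (cintegral (fun y => \sum_m (f y ord0 m * P1 m (r *: (y - x0)) +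
    f y ord0 m * P2 m (r *: (y - x0))))).
  by apply: eq_cintegral => y; apply: eq_bigr => m _; rewrite mulrDr.
rewrite cintegral_sum; last by move=> m; exact: cintegrableD.
under eq_bigr do rewrite cintegralD//.
by rewrite big_split /= h1 h2 addr0.
Qed.

Lemma orthogonal_limitZ a e : orthogonal_limit e -> orthogonal_limit (a *: e).
Proof.
move=> [P1 [C1 [C10 m1 n1 d1 o1]]].
exists (fun m y => a * P1 m y), (normc a * C1); split.
- by rewrite mulr_ge0 ?normc_ge0.
- by move=> m; apply: cmeasM => //; exact: cmeas_cst.
- by move=> m y; rewrite !mxE -mulrBr normcM -mulrA ler_wpM2l ?normc_ge0.
- by move=> m y; rewrite normcM -mulrA ler_wpM2l ?normc_ge0.
move=> f Wf x0 r r0; have If m := L1_fun_cintegrable m Wf.1.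
have I1 m := cintegrable_dilate r x0 (m1 m) (near_decay_bounded C10 (n1 m) (d1 m)) (If m).
transitivity (a * cintegral (fun y => \sum_m f y ord0 m * P1 m (r *: (y - x0)))).
  rewrite -cintegralZ; last exact: cintegrable_sum.
  by apply: eq_cintegral => y; rewrite mulr_sumr; apply: eq_bigr => m _; rewrite mulrCA.
by rewrite o1// mulr0.
Qed.

End multipliers.

Section bump.
Variables (R : realType) (n : nat).
Notation mu := (lebesgue_rV R n).
Variables (z : 'rV[R]_n) (delta : R).
Hypothesis delta_gt0 : 0 < delta.

Definition bump (x : 'rV[R]_n) : R := Num.max 0 (delta - enorm (x - z)).

Lemma bump_ge0 x : 0 <= bump x.
Proof. by rewrite /bump le_max lexx. Qed.

Lemma bump_le x : bump x <= delta.
Proof. by rewrite /bump ge_max ltW//= lerBlDr lerDl enorm_ge0. Qed.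

Lemma bump_out x : delta <= enorm (x - z) -> bump x = 0.
Proof. by move=> h; rewrite /bump max_l// subr_le0. Qed.

Lemma bump_lipschitz x y : `|bump x - bump y| <= enorm (x - y).
Proof.
have h u v : bump u - bump v <= enorm (u - v).
  have hv := bump_ge0 v; rewrite /bump in hv *.
  have t : enorm (v - z) <= enorm (u - v) + enorm (u - z).
    by rewrite (enormB u v) (le_trans _ (ler_enormD _ _))// addrA subrK.
  have e0 := enorm_ge0 (u - v).
  case: (leP 0 (delta - enorm (u - z))) => h1; case: (leP 0 (delta - enorm (v - z))) => h2;
    by lra.
by rewrite ler_norml h andbT -(opprK (bump x - bump y)) lerN2 opprB enormB h.
Qed.

Variables (w : 'rV[R]_n -> R[i]) (L B : R).
Hypotheses (L0 : 0 <= L) (B0 : 0 <= B).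
Hypothesis wL : forall x y, enorm (x - z) < delta -> enorm (y - z) < delta ->
  normc (w x - w y) <= L * enorm (x - y).
Hypothesis wB : forall x, enorm (x - z) < delta -> normc (w x) <= B.

(** The bump vanishes on the boundary of the ball, so bounds on [w] inside the
    ball suffice. *)
Lemma bumpM_lipschitz x y :
  normc ((bump x)%:C%C * w x - (bump y)%:C%C * w y) <= (B + delta * L) * enorm (x - y).
Proof.
have C0 : 0 <= (B + delta * L) * enorm (x - y).
  by rewrite mulr_ge0 ?enorm_ge0// addr_ge0// mulr_ge0// ltW.
have nb u : normc (bump u)%:C%C = bump u by rewrite normc_real ger0_norm ?bump_ge0.
have one u v : enorm (u - z) < delta -> bump v = 0 ->
    normc ((bump u)%:C%C * w u) <= (B + delta * L) * enorm (u - v).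
  move=> hu bv; rewrite normcM nb mulrC mulrDl.
  rewrite (@le_trans _ _ (B * enorm (u - v)))//; last first.
    by rewrite lerDl mulr_ge0 ?enorm_ge0// mulr_ge0// ltW.
  apply: ler_pM; rewrite ?normc_ge0 ?bump_ge0 ?wB//.
  by have := bump_lipschitz u v; rewrite bv subr0 ger0_norm ?bump_ge0.
have [hx|/bump_out bx] := ltP (enorm (x - z)) delta; last first.
  rewrite bx mul0r sub0r normcNE enormB.
  have [hy|/bump_out by0] := ltP (enorm (y - z)) delta; first exact: one.
  by rewrite by0 mul0r normc0 enormB.
have [hy|/bump_out by0] := ltP (enorm (y - z)) delta; last first.
  by rewrite by0 mul0r subr0; exact: one.
have -> : (bump x)%:C%C * w x - (bump y)%:C%C * w y =
    ((bump x)%:C%C - (bump y)%:C%C) * w x + (bump y)%:C%C * (w x - w y) by ring.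
rewrite (le_trans (normcD _ _))// [leRHS]mulrDl lerD//.
  rewrite normcM mulrC ler_pM ?normc_ge0 ?wB//.
  by rewrite -rmorphB normc_real bump_lipschitz.
rewrite normcM nb -mulrA ler_pM ?normc_ge0 ?bump_ge0 ?bump_le//.
exact: wL.
Qed.

Lemma bumpM_bounded x : normc ((bump x)%:C%C * w x) <= delta * B.
Proof.
have [hx|/bump_out ->] := ltP (enorm (x - z)) delta; last first.
  by rewrite mul0r normc0 mulr_ge0// ltW.
rewrite normcM normc_real ger0_norm ?bump_ge0//.
by rewrite ler_pM ?bump_ge0 ?bump_le ?normc_ge0 ?wB.
Qed.

Lemma bumpM_supp x : enorm z + delta < enorm x -> (bump x)%:C%C * w x = 0.
Proof.
move=> h; rewrite bump_out ?mul0r//.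
by have := ler_enormB x z; lra.
Qed.

End bump.

Section bump_mass.
Variables (R : realType) (n : nat).
Notation mu := (lebesgue_rV R n).
Variables (z : 'rV[R]_n) (delta : R).
Hypothesis delta_gt0 : 0 < delta.

Lemma measurable_bump : measurable_fun setT (bump z delta).
Proof.
apply: measurable_maxr => //; apply: measurable_funB => //.
by apply: measurable_enorm; apply: measurable_rVB.
Qed.

(** The bump is at least half its height on a small box around its centre. *)
Lemma bump_mass_gt0 : (0 < \int[mu]_x (bump z delta x)%:E)%E.
Proof.
pose h := delta / (2 * (1 + n%:R)).
have n1 : 0 < 1 + n%:R :> R by rewrite ltr_pwDl.
have h0 : 0 < h by rewrite divr_gt0 ?mulr_gt0.
pose A i := `]z ord0 i - h, z ord0 i + h[%classic : set R.
pose D := [set x : 'rV[R]_n | forall i, A i (x ord0 i)].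
have mD : measurable D by apply: measurable_box_rV => i; exact: measurable_itv.
have muD : mu D = ((2 * h) ^+ n)%:E.
  rewrite lebesgue_rV_box; last by move=> i; exact: measurable_itv.
  rewrite (eq_bigr (fun=> (2 * h)%:E)) => [|i _].
    by rewrite prodEFin prodr_const card_ord.
  rewrite lebesgue_measure_itv /= lte_fin ifT; last by rewrite ltrBlDr -addrA ltrDl addr_gt0.
  by rewrite -EFinD; congr EFin; ring.
apply: (@lt_le_trans _ _ ((delta / 2)%:E * mu D)%E).
  by rewrite muD -EFinM lte_fin mulr_gt0 ?exprn_gt0 ?divr_gt0 ?mulr_gt0.
rewrite -[mu D]mul1e -integral_cst// -ge0_integralZl//; last by rewrite lee_fin divr_ge0 ?ltW.
apply: (@le_trans _ _ (\int[mu]_(x in D) (bump z delta x)%:E)%E); last first.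
  apply: ge0_subset_integral => //; last by move=> x _; rewrite lee_fin bump_ge0.
  by apply/measurable_EFinP; exact: measurable_bump.
apply: ge0_le_integral => //.
- by move=> x _; rewrite mule1 lee_fin divr_ge0 ?ltW.
- apply/measurable_EFinP; apply: measurable_funTS; exact: measurable_bump.
move=> x Dx; rewrite mule1 lee_fin /bump le_max; apply/orP; right.
have : enorm (x - z) <= n%:R * h.
  rewrite (le_trans (enorm_le_sum _))//.
  have -> : n%:R * h = \sum_(i < n) h by rewrite sumr_const card_ord mulr_natl.
  apply: ler_sum => i _; rewrite !mxE ltW// ltr_distl.
  by have := Dx i; rewrite /A /= in_itv /=.
have : n%:R * h <= delta / 2.
  rewrite /h invfM !mulrA ler_pdivrMr//.
  have := ltW delta_gt0; have := ler0n R n => a b.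
  have := mulr_ge0 a b; lra.
lra.
Qed.

Lemma bump_mass : exists2 I : R, 0 < I & (\int[mu]_x (bump z delta x)%:E = I%:E)%E.
Proof.
have b0 : (0 <= \int[mu]_x (bump z delta x)%:E)%E.
  by apply: integral_ge0 => x _; rewrite lee_fin bump_ge0.
have IE : (\int[mu]_x (bump z delta x)%:E = (fine (\int[mu]_x (bump z delta x)%:E))%:E)%E.
  rewrite fineK// ge0_fin_numE//.
  have mball : measurable_fun setT (fun x : 'rV[R]_n => (enorm x <= enorm z + delta)%R%:R : R).
    by apply: measurable_le_nat => //; exact: measurable_enormT.
  apply: (@le_lt_trans _ _ (\int[mu]_x (delta * (enorm x <= enorm z + delta)%R%:R)%:E)%E).
    apply: le_integral_fin => //; [exact: measurable_bump|exact: measurable_funM|exact: bump_ge0|].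
    move=> x; have [_|xz] := leP (enorm x) (enorm z + delta); first by rewrite mulr1 bump_le.
    by rewrite bump_out ?mulr0//; have := ler_enormB x z; lra.
  rewrite ge0_integralZ_fin ?(ltW delta_gt0)//.
  by rewrite lte_mul_pinfty ?lee_fin ?(ltW delta_gt0)// lebesgue_ball_lty.
by exists (fine (\int[mu]_x (bump z delta x)%:E)) => //; rewrite -lte_fin -IE bump_mass_gt0.
Qed.

End bump_mass.

Section local_lipschitz.
Variables (R : realType) (n : nat).
Implicit Types (g h : 'rV[R]_n -> R[i]) (z : 'rV[R]_n).

(** Lipschitz on a whole neighbourhood of [z]. *)
Definition lipschitz_at z g := exists (e L : R), [/\ 0 < e, 0 <= L &
  forall x y, enorm (x - z) < e -> enorm (y - z) < e ->
    normc (g x - g y) <= L * enorm (x - y)].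

Lemma lipschitz_at_cst z (c : R[i]) : lipschitz_at z (fun=> c).
Proof. by exists 1, 0; split => // x y _ _; rewrite subrr normc0 mul0r. Qed.

Lemma lipschitz_atD z g h : lipschitz_at z g -> lipschitz_at z h ->
  lipschitz_at z (fun x => g x + h x).
Proof.
move=> [e [L [e0 L0 gL]]] [e' [L' [e0' L0' hL]]].
exists (Num.min e e'), (L + L'); split; first by rewrite lt_min e0.
  exact: addr_ge0.
move=> x y; rewrite !lt_min => /andP[x1 x2] /andP[y1 y2].
by rewrite opprD addrACA (le_trans (normcD _ _))// mulrDl lerD ?gL ?hL.
Qed.

Lemma lipschitz_atZ z c g : lipschitz_at z g -> lipschitz_at z (fun x => c * g x).
Proof.
move=> [e [L [e0 L0 gL]]]; exists e, (normc c * L); split => //.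
  by rewrite mulr_ge0 ?normc_ge0.
by move=> x y xe ye; rewrite -mulrBr normcM -mulrA ler_wpM2l ?normc_ge0 ?gL.
Qed.

Lemma lipschitz_at_sum z I (s : seq I) (F : I -> 'rV[R]_n -> R[i]) :
  (forall i, lipschitz_at z (F i)) -> lipschitz_at z (fun x => \sum_(i <- s) F i x).
Proof.
move=> H; elim: s => [|i s IHs].
  by under eq_fun do rewrite big_nil; exact: lipschitz_at_cst.
by under eq_fun do rewrite big_cons; exact: lipschitz_atD.
Qed.

Lemma lipschitz_at_uniform z (l : nat) (F : 'I_l -> 'rV[R]_n -> R[i]) :
  (forall i, lipschitz_at z (F i)) -> exists (e L : R), [/\ 0 < e, 0 <= L &
  forall i x y, enorm (x - z) < e -> enorm (y - z) < e ->
    normc (F i x - F i y) <= L * enorm (x - y)].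
Proof.
move=> H; suff [e [L [e0 L0 P]]] : exists (e L : R), [/\ 0 < e, 0 <= L &
    forall i, i \in index_enum 'I_l -> forall x y, enorm (x - z) < e ->
    enorm (y - z) < e -> normc (F i x - F i y) <= L * enorm (x - y)].
  by exists e, L; split => // i; apply: P; rewrite mem_index_enum.
elim: (index_enum _) => [|i s [e [L [e0 L0 P]]]]; first by exists 1, 0.
have [e' [L' [e0' L0' P']]] := H i.
exists (Num.min e e'), (L + L'); split; [by rewrite lt_min e0|exact: addr_ge0|].
move=> j; rewrite inE => js x y; rewrite !lt_min => /andP[x1 x2] /andP[y1 y2].
rewrite mulrDl; have n0 := enorm_ge0 (x - y).
move: js => /orP[/eqP->|js].
  by rewrite (le_trans (P' x y x2 y2))// lerDr mulr_ge0.
by rewrite (le_trans (P j js x y x1 y1))// lerDl mulr_ge0.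
Qed.

Lemma csmooth_lipschitz_at (U : set 'rV[R]_n) z g : open U -> U z ->
  csmooth_on U g -> lipschitz_at z g.
Proof.
move=> oU Uz [/(smooth_lipschitz oU Uz)[e [L [e0 L0 gL _]]]
  /(smooth_lipschitz oU Uz)[e' [L' [e0' L0' gL' _]]]].
exists (Num.min e e'), (L + L'); split; [by rewrite lt_min e0|exact: addr_ge0|].
move=> x y; rewrite !lt_min => /andP[x1 x2] /andP[y1 y2].
rewrite (le_trans (normc_le_ReIm _))// ReD ImD ReN ImN mulrDl lerD//.
  by apply: gL; exact: enorm_cube.
by apply: gL'; exact: enorm_cube.
Qed.

(** The radial projection onto the sphere. *)
Definition radial (x : 'rV[R]_n) := (enorm x)^-1 *: x.

Lemma radial_lipschitz x y : x != 0 -> y != 0 ->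
  enorm (radial x - radial y) <= 2 * enorm (x - y) / enorm x.
Proof.
move=> x0 y0; have nx : 0 < enorm x by rewrite enorm_gt0.
have ny : 0 < enorm y by rewrite enorm_gt0.
have -> : radial x - radial y =
    (enorm x)^-1 *: (x - y) + ((enorm x)^-1 - (enorm y)^-1) *: y.
  by rewrite /radial scalerBr scalerBl addrA subrK.
rewrite (le_trans (ler_enormD _ _))// !enormZ.
have -> : `|(enorm x)^-1| = (enorm x)^-1 by rewrite ger0_norm// invr_ge0 ltW.
have -> : `|(enorm x)^-1 - (enorm y)^-1| * enorm y = `|enorm y - enorm x| / enorm x.
  have -> : (enorm x)^-1 - (enorm y)^-1 = (enorm y - enorm x) / enorm x / enorm y.
    by field; rewrite !gt_eqF.
  rewrite !normrM (ger0_norm (x := (enorm y)^-1)) ?invr_ge0 ?(ltW ny)//.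
  by rewrite (ger0_norm (x := (enorm x)^-1)) ?invr_ge0 ?(ltW nx)// mulfVK// gt_eqF.
rewrite mulrC -mulrDl ler_pM2r ?invr_gt0//.
have : `|enorm y - enorm x| <= enorm (x - y).
  have := ler_enormB x y; have := ler_enormB y x; rewrite (enormB y x) => h1 h2.
  by rewrite ler_norml; apply/andP; split; lra.
lra.
Qed.

Lemma radial_near z x : enorm z = 1 -> enorm (x - z) < 2^-1 ->
  x != 0 /\ enorm (radial x - z) <= 4 * enorm (x - z).
Proof.
move=> z1 xz; have nx : 2^-1 <= enorm x.
  by have := ler_enormB z x; rewrite enormB; lra.
have x0 : x != 0 by rewrite -enorm_gt0 (lt_le_trans _ nx).
have z0 : z != 0 by rewrite -enorm_gt0 z1.
split => //; have := radial_lipschitz x0 z0.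
have -> : radial z = z by rewrite /radial z1 invr1 scale1r.
move=> /le_trans; apply; rewrite ler_pdivrMr ?enorm_gt0//.
have := ler_wpM2l (enorm_ge0 (x - z)) nx; lra.
Qed.

Lemma lipschitz_at_radial z g : enorm z = 1 -> lipschitz_at z g ->
  lipschitz_at z (fun x => g (radial x)).
Proof.
move=> z1 [e [L [e0 L0 gL]]]; exists (Num.min 2^-1 (e / 4)), (L * 4); split.
- by rewrite lt_min invr_gt0 divr_gt0// andbT.
- by rewrite mulr_ge0.
move=> x y; rewrite !lt_min => /andP[x1 x2] /andP[y1 y2].
have [x0 xz] := radial_near z1 x1; have [y0 yz] := radial_near z1 y1.
rewrite (le_trans (gL _ _ _ _))//; [lra|lra|].
rewrite -mulrA ler_wpM2l// (le_trans (radial_lipschitz x0 y0))//.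
rewrite ler_pdivrMr ?enorm_gt0//.
have nx : 2^-1 <= enorm x by have := ler_enormB z x; rewrite enormB; lra.
have := ler_wpM2l (enorm_ge0 (x - y)) nx; lra.
Qed.

End local_lipschitz.

Section all_orthogonal_limits.
Variables (R : realType) (n l k : nat) (Omega : sphere R n -> grassmannian R l k).
Hypothesis Omega_smooth : smooth_grassmannian_map Omega.
Notation mu := (lebesgue_rV R n).

(** Localize an equation of the constraint near the direction [zeta0] by a
    bump; the limit is the integral of the localized covector. *)
Lemma separating_orthogonal_limit (zeta0 : sphere R n) (v : 'rV[R[i]]_l) :
  v \notin val (Omega zeta0) ->
  exists2 e, orthogonal_limit Omega e & \sum_m v ord0 m * e ord0 m != 0.
Proof.
move=> vO; have [U [J [A [oU Uz sA cA]]]] := Omega_smooth zeta0.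
set z := val zeta0 in Uz; have z1 : enorm z = 1 by apply/eqP/(valP zeta0).
have [m0 t0] : exists m0, v ord0 m0 - \sum_j v ord0 (J j) * A z j m0 != 0.
  apply: contrapT => H; move/negP: vO; apply.
  apply/(chart_mem _ (cA zeta0 Uz)) => m; apply/eqP; rewrite -subr_eq0.
  by apply: contrapT => /negP h; apply: H; exists m.
set t := _ - _ in t0.
(* The covector of the chart equation for the entry [m0] at the direction of
   [x]; its pairing with [v] at [z] is [t]. *)
pose w (m : 'I_l) (x : 'rV[R]_n) : R[i] :=
  (m == m0)%:R - \sum_j (J j == m)%:R * A (radial x) j m0.
have wE (u : 'rV[R[i]]_l) x :
    \sum_m u ord0 m * w m x = u ord0 m0 - \sum_j u ord0 (J j) * A (radial x) j m0.
  under eq_bigr do rewrite mulrBr.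
  rewrite sumrB; congr (_ - _).
    by rewrite (bigD1 m0)//= eqxx mulr1 big1 ?addr0// => m /negPf->; rewrite mulr0.
  under eq_bigr do rewrite mulr_sumr.
  rewrite exchange_big /=; apply: eq_bigr => j _.
  rewrite (bigD1 (J j))//= eqxx mul1r big1 ?addr0// => m; rewrite eq_sym => /negPf->.
  by rewrite mul0r mulr0.
have wlip m : lipschitz_at z (w m).
  apply: lipschitz_atD; first exact: lipschitz_at_cst.
  under eq_fun do rewrite -mulN1r.
  apply: lipschitz_atZ; apply: lipschitz_at_sum => j; apply: lipschitz_atZ.
  apply: (lipschitz_at_radial (g := fun x => A x j m0)) => //.
  exact: csmooth_lipschitz_at (sA j m0).
have [e1 [L [e10 L0 wL]]] := lipschitz_at_uniform wlip.
have [e2 e20 e2U] : exists2 e : R, 0 < e & forall x, cube z e x -> U x.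
  by apply: nbhs_cube; exact: open_nbhs_nbhs.
pose S := \sum_m normc (v ord0 m).
have S0 : 0 <= S by apply: sumr_ge0 => m _; exact: normc_ge0.
(* At distance less than [e3] from [z] the pairing of the covector with [v]
   differs from [t] by at most [|t| / 4]. *)
pose e3 := normc t / (4 * (S * L + 1)).
have nt : 0 < normc t by rewrite lt_neqAle normc_ge0 eq_sym normc_eq0E t0.
have SL : 0 <= S * L by rewrite mulr_ge0.
have e30 : 0 < e3 by rewrite divr_gt0// mulr_gt0// ltr_wpDl.
pose delta := Num.min (Num.min 2^-1 e1) (Num.min (e2 / 4) e3).
have e24 : 0 < e2 / 4 by rewrite divr_gt0.
have d0 : 0 < delta by rewrite !lt_min invr_gt0 ltr0n e10 e24 e30.
have dP x : enorm (x - z) < delta -> [/\ enorm (x - z) < 2^-1,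
    enorm (x - z) < e1, enorm (x - z) < e2 / 4 & enorm (x - z) < e3].
  by rewrite !lt_min => /andP[/andP[? ?] /andP[? ?]].
pose B := \sum_m normc (w m z) + L * delta.
have B0 : 0 <= B.
  rewrite addr_ge0 ?mulr_ge0 ?(ltW d0)//.
  by apply: sumr_ge0 => m _; exact: normc_ge0.
have ez : enorm (z - z) < delta by rewrite subrr enorm0.
have wLd m x y : enorm (x - z) < delta -> enorm (y - z) < delta ->
    normc (w m x - w m y) <= L * enorm (x - y).
  by move=> /dP[_ x1 _ _] /dP[_ y1 _ _]; exact: wL.
have wB m x : enorm (x - z) < delta -> normc (w m x) <= B.
  move=> xd; rewrite -(subrK (w m z) (w m x)) (le_trans (normcD _ _))// addrC lerD//.
    by rewrite (bigD1 m)//= lerDl; apply: sumr_ge0 => i _; exact: normc_ge0.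
  by rewrite (le_trans (wLd m x z xd ez))// ler_wpM2l// ltW.
pose Psi m x := (bump z delta x)%:C%C * w m x.
have PL m := bumpM_lipschitz d0 L0 B0 (wLd m) (wB m).
have PB m := bumpM_bounded d0 B0 (wB m).
have PS m := @bumpM_supp R n z delta (w m).
have K0 : 0 <= B + delta * L by rewrite addr_ge0// mulr_ge0// ltW.
have dB0 : 0 <= delta * B by rewrite mulr_ge0// ltW.
have rho0 : 0 <= enorm z + delta by rewrite addr_ge0 ?enorm_ge0// ltW.
have iPsi m : cintegrable (Psi m) := lipschitz_cintegrable K0 dB0 (PL m) (PB m) (PS m).
have mPsi m : cmeas (Psi m) := lipschitz_cmeas K0 (PL m).
pose e : 'rV[R[i]]_l := \row_m cintegral (Psi m).
exists e.
  pose C1 m := s2val (cid2 (fourier_lip_near0 K0 dB0 rho0 (PL m) (PB m) (PS m))).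
  have C1P m := s2valP (cid2 (fourier_lip_near0 K0 dB0 rho0 (PL m) (PB m) (PS m))).
  have C1P' m := s2valP' (cid2 (fourier_lip_near0 K0 dB0 rho0 (PL m) (PB m) (PS m))).
  pose C2 m := s2val (cid2 (fourier_lip_decay K0 dB0 (PL m) (PB m) (PS m))).
  have C2P m := s2valP (cid2 (fourier_lip_decay K0 dB0 (PL m) (PB m) (PS m))).
  have C2P' m := s2valP' (cid2 (fourier_lip_decay K0 dB0 (PL m) (PB m) (PS m))).
  have C12 m : C1 m <= \sum_i (C1 i + C2 i) /\ C2 m <= \sum_i (C1 i + C2 i).
    have h0 : 0 <= \sum_(i | i != m) (C1 i + C2 i).
      by apply: sumr_ge0 => i _; apply: addr_ge0; [exact: C1P|exact: C2P].
    have h1 : 0 <= C1 m := C1P m; have h2 : 0 <= C2 m := C2P m.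
    by rewrite (bigD1 m)//=; split; lra.
  exists (fun m => fourier (Psi m)), (\sum_i (C1 i + C2 i)); split.
  - by apply: sumr_ge0 => i _; apply: addr_ge0; [exact: C1P|exact: C2P].
  - by move=> m; exact: cmeas_fourier.
  - move=> m y; rewrite mxE (le_trans (C1P' m y))//.
    by rewrite ler_wpM2r ?enorm_ge0//; exact: (C12 m).1.
  - by move=> m y; rewrite (le_trans (C2P' m y))//; exact: (C12 m).2.
  move=> f Wf x0 r r0; have If m := L1_fun_cintegrable m Wf.1.
  have bF m : exists B', forall y, normc (fourier (Psi m) y) <= B'.
    by exists (2 * L1n (Psi m)) => y; exact: fourier_bounded.
  rewrite cintegral_sum; last first.
    move=> m; have [B' BP] := bF m; apply: cintegrable_dilate BP _ => //.
    exact: cmeas_fourier.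
  under eq_bigr do rewrite fourier_swap//.
  rewrite -cintegral_sum; last first.
    move=> m; under eq_fun do rewrite -mulrA mulrC.
    apply: (cintegrableM (B := 2 * L1n (fun x => f x ord0 m))) => //.
      apply: cmeasM; first by apply: cmeas_dot.
      apply: (cmeas_comp (cmeas_fourier (If m))).
      by apply: measurable_rVZ.
    by move=> x; rewrite normcM normc_cexpi mul1r fourier_bounded.
  rewrite -[RHS](@cintegral0 R n); apply: eq_cintegral => xi.
  have [xid|/bump_out bx] := ltP (enorm (xi - z)) delta; last first.
    by rewrite big1// => m _; rewrite /Psi bx !mul0r.
  have [x1 _ x3 _] := dP _ xid; have [xi0 xiz] := radial_near z1 x1.
  have rxi0 : r *: xi != 0 by rewrite scaler_eq0 gt_eqF.
  have dE : val (direction rxi0) = radial xi.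
    rewrite /= enormZ gtr0_norm// scalerA invfM -mulrA (mulrC _ r) mulrA mulVf ?gt_eqF//.
    by rewrite mul1r.
  have Ux : U (val (direction rxi0)).
    by rewrite dE; apply/e2U/enorm_cube; lra.
  have := Wf.2 _ rxi0; move/(chart_mem _ (cA _ Ux)) => /(_ m0) vE.
  rewrite dE in vE.
  transitivity ((bump z delta xi)%:C%C * cexpi (2 * pi * dotrV (r *: x0) xi) *
      \sum_m vfourier f (r *: xi) ord0 m * w m xi).
    by rewrite mulr_sumr; apply: eq_bigr => m _; rewrite /Psi mxE; ring.
  by rewrite wE vE subrr mulr0.
pose T x := \sum_m v ord0 m * w m x.
have Tz : T z = t by rewrite /T wE /radial z1 invr1 scale1r.
have mb := measurable_bump z delta.
have [Bi Bi0 BiE] := bump_mass z d0.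
have sE : \sum_m v ord0 m * e ord0 m = cintegral (fun x => (bump z delta x)%:C%C * T x).
  under eq_bigr do rewrite mxE -cintegralZ//.
  rewrite -cintegral_sum; last by move=> m; exact: cintegrableZ.
  apply: eq_cintegral => x; rewrite /T mulr_sumr; apply: eq_bigr => m _.
  by rewrite /Psi mulrCA.
pose E x := (bump z delta x)%:C%C * (T x - t).
have iT : cintegrable (fun x => (bump z delta x)%:C%C * T x).
  have -> : (fun x => (bump z delta x)%:C%C * T x) = fun x => \sum_m v ord0 m * Psi m x.
    apply/funext => x; rewrite /T mulr_sumr; apply: eq_bigr => m _.
    by rewrite /Psi mulrCA.
  by apply: cintegrable_sum => m; exact: cintegrableZ.
have it : cintegrable (fun x => t * (bump z delta x)%:C%C).
  apply: cintegrableZ; apply: cintegrable_real => //; first exact: bump_ge0.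
  by rewrite BiE ltry.
have EE : cintegral E = cintegral (fun x => (bump z delta x)%:C%C * T x) - Bi%:C%C * t.
  transitivity (cintegral (fun x => (bump z delta x)%:C%C * T x +
      (-1) * (t * (bump z delta x)%:C%C))).
    by apply: eq_cintegral => x; rewrite /E; ring.
  rewrite cintegralD//; last exact: cintegrableZ.
  rewrite cintegralZ// mulN1r; congr (_ - _).
  rewrite -(cintegral_realM t mb (bump_ge0 _ _) BiE).
  by apply: eq_cintegral => x; rewrite mulrC.
have mE : cmeas E.
  have -> : E = fun x => (bump z delta x)%:C%C * T x - t * (bump z delta x)%:C%C.
    by apply/funext => x; rewrite /E; ring.
  by apply: cmeasB; [exact: iT.1|exact: it.1].
have En : normc (cintegral E) <= 2 * (normc t / 4 * Bi).
  rewrite -lee_fin (le_trans (le_normc_cintegral mE))// EFinM lee_wpmul2l//.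
  rewrite EFinM -BiE -ge0_integralZ_fin//; last 2 first.
  - by rewrite divr_ge0 ?normc_ge0.
  - exact: bump_ge0.
  apply: le_integral_fin.
  - exact: cmeas_normc.
  - exact: measurable_funM.
  - by move=> x; exact: normc_ge0.
  move=> x; rewrite /E normcM normc_real ger0_norm ?bump_ge0//.
  have [xd|/bump_out ->] := ltP (enorm (x - z)) delta; last by rewrite mul0r mulr0.
  rewrite mulrC ler_wpM2r ?bump_ge0//.
  have [_ _ _ x3] := dP _ xd.
  rewrite -{1}Tz /T -sumrB; apply: (@le_trans _ _ (\sum_m normc (v ord0 m) * (L * enorm (x - z)))).
    rewrite (le_trans (normc_sum _ _ _))//; apply: ler_sum => m _.
    by rewrite -mulrBr normcM ler_wpM2l ?normc_ge0// wLd.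
  rewrite -mulr_suml -/S mulrA.
  apply: (@le_trans _ _ ((S * L + 1) * e3)).
    by apply: ler_pM => //; [exact: enorm_ge0|rewrite lerDl|exact: ltW].
  have c0 : S * L + 1 != 0 by rewrite gt_eqF// ltr_wpDl.
  by rewrite /e3 le_eqVlt; apply/orP; left; apply/eqP; field.
(* If the integral vanished, then [|t| <= |t| / 2]. *)
rewrite sE; apply/negP => /eqP s0; rewrite s0 sub0r in EE.
move: En; rewrite EE normcNE normcM normc_real gtr0_norm//.
by have := mulr_gt0 nt Bi0; nra.
Qed.

Lemma every_vector_orthogonal_limit :
  \bigcap_(zeta in [set: sphere R n]) [set v | v \in val (Omega zeta)] = [set 0] ->
  forall e, orthogonal_limit Omega e.
Proof.
move=> cancellation; apply: separating_subspace.
- exact: orthogonal_limit0.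
- by move=> u v; exact: orthogonal_limitD.
- by move=> a v; exact: orthogonal_limitZ.
move=> v v0; have [zeta0 vO] : exists zeta0, v \notin val (Omega zeta0).
  apply: contrapT => H; have : [set 0] v.
    rewrite -cancellation => zeta _ /=; apply: contrapT => /negP h.
    by apply: H; exists zeta.
  by move=> /= v0'; rewrite v0' eqxx in v0.
exact: separating_orthogonal_limit vO.
Qed.

End all_orthogonal_limits.

(** * The kernel estimate *)

Section kernel.
Variables (R : realType) (n : nat) (a : R).
Hypotheses (a_gt0 : 0 < a) (a_lt : a < n%:R).
Notation mu := (lebesgue_rV R n).

Let be := n%:R - a.
Let be_gt0 : 0 < be. Proof. by rewrite subr_gt0. Qed.

Lemma real_complexM (s t : R) : (s * t)%:C%C = s%:C%C * t%:C%C.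
Proof. exact: (rmorphM (real_complex R)). Qed.

Lemma powRN_anti (g m x : R) : 0 <= g -> 0 < m -> m <= x -> x `^ (- g) <= m `^ (- g).
Proof.
move=> g0 m0 mx; have x0 := lt_le_trans m0 mx.
rewrite !powRN lef_pV2 ?posrE ?powR_gt0//.
by apply: ge0_ler_powR => //; rewrite nnegrE ltW.
Qed.

Lemma powRN_lipschitz (g m s t : R) : 0 <= g -> 0 < m -> m <= s -> m <= t ->
  `|s `^ (- g) - t `^ (- g)| <= g * m `^ (- (g + 1)) * `|s - t|.
Proof.
move=> g0 m0 ms mt.
apply: (@MVT_le _ (@powR R ^~ (- g)) (fun x => - g * x `^ (- g - 1))) => x.
rewrite ge_min => /andP[tx _]; have mx : m <= x by case/orP: tx => h; apply: le_trans h.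
have x0 := lt_le_trans m0 mx; split; first exact: is_derive1_powR.
rewrite normrM normrN !ger0_norm ?powR_ge0// ler_wpM2l//.
by rewrite -opprD; apply: powRN_anti => //; rewrite addr_ge0.
Qed.

Lemma powR_neg_add (t r s : R) : 0 < t -> t `^ (- r) * t `^ (- s) = t `^ (- (r + s)).
Proof. by move=> t0; rewrite opprD powRD//; apply/implyP; rewrite (gt_eqF t0). Qed.

Variables (e : R[i]) (C : R) (Phi : 'rV[R]_n -> R[i]).
Hypotheses (C0 : 0 <= C) (mPhi : cmeas Phi).
Hypothesis near : forall y, normc (Phi y - e) <= C * enorm y.
Hypothesis decay : forall y, normc (Phi y) * enorm y <= C.

(** One coordinate of the kernel of [e . I_a f], corrected by a dilate of
    [Phi], which is chosen so that the leading term of the kernel cancels for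
    [x] far away from [y]. *)
Definition corrected_kernel (x y : 'rV[R]_n) : R[i] :=
  (rk a (x - y))%:C%C * e - (rk a x)%:C%C * Phi ((enorm x)^-1 *: y).

Definition weighted_kernel x y : R := enorm x `^ (- a) * normc (corrected_kernel x y).

Lemma weighted_kernel_ge0 x y : 0 <= weighted_kernel x y.
Proof. by rewrite mulr_ge0 ?powR_ge0 ?normc_ge0. Qed.

Lemma cmeas_corrected_kernel d (T : measurableType d) (f g : T -> 'rV[R]_n) :
  measurable_fun setT f -> measurable_fun setT g ->
  cmeas (fun t => corrected_kernel (f t) (g t)).
Proof.
move=> mf mg; apply: cmeasB; apply: cmeasM; first 2 last.
- by apply: cmeas_real; exact: measurable_rk.
- apply: (cmeas_comp mPhi); apply: measurable_rVZ => //.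
  under eq_fun do rewrite -powR_inv1 ?enorm_ge0//.
  by apply: measurable_funpow; exact: measurable_enorm.
- by apply: cmeas_real; apply: measurable_rk; exact: measurable_rVB.
- exact: cmeas_cst.
Qed.

Let D1 := be * 2^-1 `^ (- (be + 1)) * normc e + C.

Let D10 : 0 <= D1.
Proof. by rewrite addr_ge0// mulr_ge0 ?normc_ge0// mulr_ge0 ?powR_ge0// ltW. Qed.

(** The mean value theorem bounds the change of [rk a] from [x] to [x - u],
    and [Phi] is close to [e] since its argument has norm [1 / |x|]. *)
Lemma kernel_far x u : enorm u = 1 -> 2 <= enorm x ->
  weighted_kernel x u <= D1 * enorm x `^ (- n.+1%:R).
Proof.
move=> u1 x2; set t := enorm x in x2 *.
have t0 : 0 < t by lra.
have -> : - n.+1%:R = - (a + (be + 1)) :> R by rewrite /be -natr1; lra.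
rewrite -powR_neg_add// mulrCA ler_wpM2l ?powR_ge0//.
have -> : corrected_kernel x u = (rk a (x - u) - rk a x)%:C%C * e +
    (rk a x)%:C%C * (e - Phi ((enorm x)^-1 *: u)).
  by rewrite rmorphB /corrected_kernel mulrBl mulrBr addrA subrK.
rewrite (le_trans (normcD _ _))// /D1 mulrDl lerD//.
  rewrite normcM normc_real mulrAC ler_wpM2r ?normc_ge0//.
  have h1 := ler_enormB x u; have h2 := ler_enormD (x - u) u.
  rewrite subrK in h2; rewrite u1 -/t in h1 h2.
  have m0 : 0 < t * 2^-1 by rewrite mulr_gt0.
  have l1 : t * 2^-1 <= enorm (x - u) by lra.
  have l2 : t * 2^-1 <= t by lra.
  apply: (le_trans (powRN_lipschitz (ltW be_gt0) m0 l1 l2)).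
  have h3 := ler_enormD (x) (- u); rewrite enormN u1 -/t in h3.
  have : `|enorm (x - u) - t| <= 1 by rewrite ler_norml; apply/andP; split; lra.
  have b0 : 0 <= be * (t * 2^-1) `^ (- (be + 1)) by rewrite mulr_ge0 ?powR_ge0// ltW.
  move=> /(ler_wpM2l b0) /le_trans; apply.
  by rewrite mulr1 powRM ?(ltW t0)// -mulrA ler_wpM2l ?(ltW be_gt0)// mulrC.
rewrite normcM normc_real ger0_norm ?rk_ge0// normcBC -powR_neg_add//.
rewrite mulrCA ler_wpM2l ?powR_ge0//.
by rewrite (le_trans (near _))// enormZ u1 mulr1 powR_inv1 ?(ltW t0)// ger0_norm// invr_ge0 ltW.
Qed.

(** The singularities at [0] and at [u] are a unit distance apart: where one
    of the powers is large, the other one is bounded. In the correction, the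
    decay of [Phi] gains a factor [|x|]. *)
Lemma kernel_near x u : enorm u = 1 -> enorm x < 2 ->
  weighted_kernel x u <=
  normc e * 2^-1 `^ (- a) * (enorm (x - u) `^ (- be) * (enorm (x - u) < 3)%R%:R) +
  normc e * 2^-1 `^ (- be) * enorm x `^ (- a) + C * enorm x `^ (- (n%:R - 1)).
Proof.
move=> u1 x2; set t := enorm x in x2 *.
have xu : enorm (x - u) < 3 by have := ler_enormD x (- u); rewrite enormN u1 -/t; lra.
have xu' : t < 2^-1 -> 2^-1 <= enorm (x - u).
  by have := ler_enormB u x; rewrite enormB u1 -/t; lra.
have p1 : 0 <= normc e * 2^-1 `^ (- a) * (enorm (x - u) `^ (- be) * (enorm (x - u) < 3)%R%:R).
  by rewrite mulr_ge0 ?mulr_ge0 ?powR_ge0 ?normc_ge0.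
have p2 : 0 <= normc e * 2^-1 `^ (- be) * t `^ (- a).
  by rewrite mulr_ge0 ?mulr_ge0 ?powR_ge0 ?normc_ge0.
have p3 : 0 <= C * t `^ (- (n%:R - 1)) by rewrite mulr_ge0 ?powR_ge0.
have [t0|t0] := eqVneq t 0.
  by rewrite /weighted_kernel -/t {1}t0 powR0 ?mul0r ?addr_ge0// oppr_eq0 gt_eqF.
have {}t0 : 0 < t by rewrite lt_neqAle eq_sym t0 enorm_ge0.
have K : weighted_kernel x u <= normc e * (t `^ (- a) * enorm (x - u) `^ (- be)) +
    t `^ (- a) * t `^ (- be) * normc (Phi (t^-1 *: u)).
  rewrite /weighted_kernel (le_trans (ler_wpM2l (powR_ge0 _ _) (normcD _ _)))//.
  rewrite normcNE !normcM !normc_real !(ger0_norm (rk_ge0 _ _)) /rk -/t -/be mulrDr.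
  by rewrite [X in _ <= X + _]mulrC -!mulrA.
apply: (le_trans K); clear K; apply: lerD.
  have [th|th] := leP 2^-1 t.
    apply: ler_wpDr; first exact: p2.
    rewrite xu mulr1 -mulrA; apply: ler_wpM2l; first exact: normc_ge0.
    apply: ler_wpM2r; first exact: powR_ge0.
    by apply: powRN_anti th; [exact: ltW|rewrite invr_gt0].
  apply: ler_wpDl; first exact: p1.
  rewrite -mulrA; apply: ler_wpM2l; first exact: normc_ge0.
  rewrite mulrC; apply: ler_wpM2r; first exact: powR_ge0.
  apply: powRN_anti; [exact: ltW|by rewrite invr_gt0|].
  exact: xu'.
rewrite powR_neg_add//.
have -> : - (a + be) = - (n%:R - 1 + 1) by rewrite /be subrK addrC subrK.
rewrite -powR_neg_add//.
have -> : t `^ (-1) = t^-1 by rewrite powR_inv1// ltW.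
rewrite -mulrA [leRHS]mulrC.
apply: ler_wpM2l; first exact: powR_ge0.
by have := decay (t^-1 *: u); rewrite enormZ u1 mulr1 ger0_norm ?invr_ge0 ?(ltW t0)// mulrC.
Qed.

(** All exponents are integrable: [n + 1 > n] at infinity, and [n - a], [a]
    and [n - 1] are less than [n] at the singularities. *)
Lemma kernel_bound_unit : exists2 M : R, 0 <= M & forall u, enorm u = 1 ->
  (\int[mu]_x (weighted_kernel x u)%:E <= M%:E)%E.
Proof.
have n1 : 0 <= n%:R - 1 :> R by rewrite subr_ge0 ler1n (riesz_dim_gt0 a_gt0 a_lt).
have nn : n%:R < n.+1%:R :> R by rewrite ltr_nat.
have [c1 c10 c1E] := @integral_powN_ge R n _ nn.
have [|c2 c20 c2E] := @integral_powN_lt R n be (ltW be_gt0).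
  by rewrite /be ltrBlDr ltrDl.
have [c3 c30 c3E] := @integral_powN_lt R n a (ltW a_gt0) a_lt.
have [|c4 c40 c4E] := @integral_powN_lt R n (n%:R - 1) n1.
  by rewrite ltrBlDr ltrDl.
pose q2 := normc e * 2^-1 `^ (- a); pose q3 := normc e * 2^-1 `^ (- be).
have q20 : 0 <= q2 by rewrite mulr_ge0 ?powR_ge0 ?normc_ge0.
have q30 : 0 <= q3 by rewrite mulr_ge0 ?powR_ge0 ?normc_ge0.
pose M := D1 * (c1 * 2 `^ (n%:R - n.+1%:R)) + q2 * (c2 * 3 `^ (n%:R - be)) +
  q3 * (c3 * 2 `^ (n%:R - a)) + C * (c4 * 2 `^ (n%:R - (n%:R - 1))).
exists M; first by rewrite !addr_ge0// mulr_ge0// mulr_ge0 ?powR_ge0.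
move=> u u1.
pose T1 (x : 'rV[R]_n) := enorm x `^ (- n.+1%:R) * (2 <= enorm x)%R%:R.
pose T2 (x : 'rV[R]_n) := enorm (x - u) `^ (- be) * (enorm (x - u) < 3)%R%:R.
pose T3 (x : 'rV[R]_n) := enorm x `^ (- a) * (enorm x < 2)%R%:R.
pose T4 (x : 'rV[R]_n) := enorm x `^ (- (n%:R - 1)) * (enorm x < 2)%R%:R.
have T10 x : 0 <= T1 x by rewrite mulr_ge0 ?powR_ge0.
have T20 x : 0 <= T2 x by rewrite mulr_ge0 ?powR_ge0.
have T30 x : 0 <= T3 x by rewrite mulr_ge0 ?powR_ge0.
have T40 x : 0 <= T4 x by rewrite mulr_ge0 ?powR_ge0.
have m1 : measurable_fun setT T1 := measurable_powN_ge _ _.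
have m2 : measurable_fun setT T2.
  by apply: (measurableT_comp (measurable_powN_lt _ _)); apply: measurable_rVB.
have m3 : measurable_fun setT T3 := measurable_powN_lt _ _.
have m4 : measurable_fun setT T4 := measurable_powN_lt _ _.
have i1 : (\int[mu]_x (T1 x)%:E = (c1 * 2 `^ (n%:R - n.+1%:R))%:E)%E.
  by rewrite -(c1E 0)//; apply: eq_integral => x _; rewrite subr0.
have i2 : (\int[mu]_x (T2 x)%:E = (c2 * 3 `^ (n%:R - be))%:E)%E by rewrite -(c2E u).
have i3 : (\int[mu]_x (T3 x)%:E = (c3 * 2 `^ (n%:R - a))%:E)%E.
  by rewrite -(c3E 0)//; apply: eq_integral => x _; rewrite subr0.
have i4 : (\int[mu]_x (T4 x)%:E = (c4 * 2 `^ (n%:R - (n%:R - 1)))%:E)%E.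
  by rewrite -(c4E 0)//; apply: eq_integral => x _; rewrite subr0.
have mZ (k : R) (T : 'rV[R]_n -> R) :
  measurable_fun setT T -> measurable_fun setT (fun x => k * T x).
  by move=> mT; apply: measurable_funM.
have pZ (k : R) (T : 'rV[R]_n -> R) : 0 <= k -> (forall x, 0 <= T x) -> forall x, 0 <= k * T x.
  by move=> k0 T0 x; rewrite mulr_ge0.
apply: (@le_trans _ _ (\int[mu]_x (D1 * T1 x + q2 * T2 x + q3 * T3 x + C * T4 x)%:E)%E).
  apply: le_integral_fin.
  - apply: measurable_funM; first exact: measurable_powN.
    by apply: cmeas_normc; apply: cmeas_corrected_kernel.
  - by do !apply: measurable_funD; exact: mZ.
  - by move=> x; exact: weighted_kernel_ge0.
  move=> x; rewrite /T1 /T3 /T4; have [x2|x2] := leP 2 (enorm x).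
    by rewrite !mulr0 !addr0 mulr1 ler_wpDr ?pZ//; exact: kernel_far.
  rewrite !mulr0 add0r !mulr1; exact: kernel_near.
rewrite ge0_integralD_fin; [|by do !apply: measurable_funD; exact: mZ|exact: mZ| |exact: pZ].
  rewrite ge0_integralD_fin; [|by apply: measurable_funD; exact: mZ|exact: mZ| |exact: pZ].
    rewrite ge0_integralD_fin; [|exact: mZ|exact: mZ|exact: pZ|exact: pZ].
    by rewrite !ge0_integralZ_fin// i1 i2 i3 i4.
  by move=> x; rewrite addr_ge0// pZ.
by move=> x; rewrite !addr_ge0// pZ.
Qed.

Lemma weighted_kernel_homogeneous (r : R) x u : 0 < r ->
  weighted_kernel (r *: x) (r *: u) = r^-1 ^+ n * weighted_kernel x u.
Proof.
move=> r0.
have nE (z : 'rV[R]_n) s : enorm (r *: z) `^ s = r `^ s * enorm z `^ s.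
  by rewrite enormZ (gtr0_norm r0) powRM ?enorm_ge0 ?(ltW r0).
have dE : (enorm (r *: x))^-1 *: (r *: u) = (enorm x)^-1 *: u.
  by rewrite scalerA enormZ (gtr0_norm r0) invfM mulrAC mulVf ?mul1r// gt_eqF.
have KE : corrected_kernel (r *: x) (r *: u) = (r `^ (- be))%:C%C * corrected_kernel x u.
  have rkE (z : 'rV[R]_n) : (rk a (r *: z))%:C%C = (r `^ (- be))%:C%C * (rk a z)%:C%C.
    by rewrite /rk nE real_complexM.
  have xuE : r *: x - r *: u = r *: (x - u) by rewrite scalerBr.
  rewrite /corrected_kernel dE xuE; move: (x - u) => z.
  by rewrite (rkE x) (rkE z) mulrBr !mulrA.
have rE : r^-1 ^+ n = r `^ (- a) * r `^ (- be).
  by rewrite powR_neg_add// addrC subrK powRN powR_mulrn ?(ltW r0)// exprVn.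
rewrite /weighted_kernel KE nE rE normcM normc_real ger0_norm ?powR_ge0//.
by rewrite mulrACA.
Qed.

(** By homogeneity [y] may be taken on the unit sphere. *)
Lemma kernel_bound : exists2 M : R, 0 <= M & forall x0 y : 'rV[R]_n,
  (\int[mu]_x (weighted_kernel (x - x0) (y - x0))%:E <= M%:E)%E.
Proof.
have [M M0 MP] := kernel_bound_unit; exists M => // x0 y.
have mG : measurable_fun setT (fun x : 'rV[R]_n => (weighted_kernel (x - x0) (y - x0))%:E).
  apply/measurable_EFinP; apply: measurable_funM.
    by apply: measurable_funpow; apply: measurable_enorm; exact: measurable_rVB.
  by apply: cmeas_normc; apply: cmeas_corrected_kernel => //; exact: measurable_rVB.
have G0 x : (0 <= (weighted_kernel (x - x0) (y - x0))%:E)%E.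
  by rewrite lee_fin weighted_kernel_ge0.
(* At [y = x0] the kernel vanishes identically. *)
have [yx|yx] := eqVneq (y - x0) 0.
  rewrite integral0_eq// => x _; rewrite yx /weighted_kernel /corrected_kernel.
  have P0 : Phi 0 = e.
    apply/eqP; rewrite -subr_eq0 -normc_eq0E eq_le normc_ge0 andbT.
    by have := near 0; rewrite enorm0 mulr0.
  by rewrite scaler0 P0 subr0 subrr normc0 mulr0.
move: (y - x0) yx mG G0 => w w0 mG G0.
have r0 : 0 < enorm w by rewrite enorm_gt0.
have [u u1 wu] : exists2 u, enorm u = 1 & w = enorm w *: u.
  exists ((enorm w)^-1 *: w); last by rewrite scalerA divff ?scale1r// gt_eqF.
  by rewrite enormZ ger0_norm ?invr_ge0 ?(ltW r0)// mulVf ?gt_eqF.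
move: (enorm w) r0 wu => r r0 wu.
have scal (x : 'rV[R]_n) :
    weighted_kernel (r *: x + x0 - x0) w = r^-1 ^+ n * weighted_kernel x u.
  by rewrite addrK wu weighted_kernel_homogeneous.
have h1 : (\int[mu]_x (weighted_kernel (r *: x + x0 - x0)%R w)%:E =
    \int[mu]_x (r^-1 ^+ n * weighted_kernel x u)%:E)%E.
  by apply: eq_integral => x _; rewrite scal.
have h2 := etrans (esym h1) (ge0_integral_rV_affine x0 (lt0r_neq0 r0) mG G0).
have rn : (0 < (r^-1 ^+ n)%:E)%E by rewrite lte_fin exprn_gt0// invr_gt0.
rewrite -(@lee_pmul2l _ (r^-1 ^+ n)%:E)//.
move: h2; rewrite (gtr0_norm r0) => <-; rewrite ge0_integralZ_fin.
- by rewrite lee_pmul2l// MP.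
- by rewrite exprn_ge0// invr_ge0 ltW.
- apply: measurable_funM; first exact: measurable_powN.
  by apply: cmeas_normc; apply: cmeas_corrected_kernel.
- by move=> x; exact: weighted_kernel_ge0.
Qed.

End kernel.

(** * The weighted estimate *)

Section one_kernel.
Variables (R : realType) (n : nat) (a : R).
Notation mu := (lebesgue_rV R n).
Variables (e : R[i]) (Phi : 'rV[R]_n -> R[i]) (mPhi : cmeas Phi).
Variables (h : 'rV[R]_n -> R[i]) (Ih : cintegrable h) (x0 : 'rV[R]_n).

(** The weight is part of the kernel, so that Tonelli's theorem applies to a
    kernel of finite total mass; this also yields the integrability in [y] for
    almost every [x]. *)
Definition potential_kernel x y : R[i] :=
  (enorm (x - x0) `^ (- a))%:C%C * (h y * corrected_kernel a e Phi (x - x0) (y - x0)).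

Lemma normc_potential_kernel x y : normc (potential_kernel x y) =
  normc (h y) * weighted_kernel a e Phi (x - x0) (y - x0).
Proof.
by rewrite !normcM normc_real ger0_norm ?powR_ge0// /weighted_kernel mulrCA.
Qed.

Lemma potential_kernelE x y : potential_kernel x y =
  (enorm (x - x0) `^ (- a))%:C%C * (rk a (x - y))%:C%C * h y * e -
  (enorm (x - x0) `^ (- a))%:C%C * (rk a (x - x0))%:C%C *
    (h y * Phi ((enorm (x - x0))^-1 *: (y - x0))).
Proof.
have rkE : rk a (x - x0 - (y - x0)) = rk a (x - y) by rewrite opprB addrA subrK.
rewrite /potential_kernel /corrected_kernel rkE.
have gen (z1 z2 z3 z4 z5 z6 : R[i]) :
    z1 * (z5 * (z2 * z6 - z3 * z4)) = z1 * z2 * z5 * z6 - z1 * z3 * (z5 * z4) by ring.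
exact: gen.
Qed.

Lemma cmeas_potential_kernel :
  cmeas (fun p : 'rV[R]_n * 'rV[R]_n => potential_kernel p.1 p.2).
Proof.
have m1 : measurable_fun setT (fun p : 'rV[R]_n * 'rV[R]_n => p.1 - x0).
  by apply: measurable_rVB => //; exact: measurable_fst.
have m2 : measurable_fun setT (fun p : 'rV[R]_n * 'rV[R]_n => p.2 - x0).
  by apply: measurable_rVB => //; exact: measurable_snd.
apply: cmeasM.
  by apply: cmeas_real; apply: measurable_funpow; exact: measurable_enorm.
apply: cmeasM; first by apply: (cmeas_comp Ih.1); exact: measurable_snd.
exact: cmeas_corrected_kernel.
Qed.

(** Tonelli: integrate in [x] first. *)
Lemma potential_kernel_le (M : R) : 0 <= M ->
  (forall x0 y : 'rV[R]_n,
    \int[mu]_x (weighted_kernel a e Phi (x - x0)%R (y - x0)%R)%:E <= M%:E)%E ->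
  (\int[mu]_x \int[mu]_y (normc (potential_kernel x y))%:E <= (M * L1n h)%:E)%E.
Proof.
move=> M0 MP.
have mH : measurable_fun setT
    (fun p : 'rV[R]_n * 'rV[R]_n => (normc (potential_kernel p.1 p.2))%:E).
  by apply/measurable_EFinP; apply: cmeas_normc; exact: cmeas_potential_kernel.
have H0 (p : 'rV[R]_n * 'rV[R]_n) : (0 <= (normc (potential_kernel p.1 p.2))%:E)%E.
  by rewrite lee_fin normc_ge0.
rewrite (fubini_tonelli (m1 := mu) (m2 := mu) _ mH H0) /=.
have nh := cmeas_normc Ih.1.
apply: (@le_trans _ _ (\int[mu]_y (M * normc (h y))%:E)%E); last first.
  rewrite ge0_integralZ_fin//; last by move=> y; exact: normc_ge0.
  by rewrite L1nE// -EFinM.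
apply: ge0_le_integral => //.
- by move=> y _; apply: integral_ge0 => x _; exact: (H0 (x, y)).
- exact: (measurable_fun_fubini_tonelli_G _ mH H0).
- by apply/measurable_EFinP; exact: measurable_funM.
move=> y _; under eq_integral do rewrite normc_potential_kernel.
rewrite ge0_integralZ_fin ?normc_ge0//; last 2 first.
- apply: measurable_funM.
    by apply: measurable_funpow; apply: measurable_enorm; exact: measurable_rVB.
  by apply: cmeas_normc; apply: cmeas_corrected_kernel => //; exact: measurable_rVB.
- by move=> x; exact: weighted_kernel_ge0.
by rewrite mulrC EFinM lee_wpmul2l ?lee_fin ?normc_ge0.
Qed.

End one_kernel.

Section coordinate.
Variables (R : realType) (n l k : nat) (Omega : sphere R n -> grassmannian R l k).
Notation mu := (lebesgue_rV R n).
Variable a : R.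
Hypotheses (a_gt0 : 0 < a) (a_lt : a < n%:R).

Section pointwise.
Variables (Phi : 'I_l -> 'rV[R]_n -> R[i]) (j : 'I_l) (B : 'I_l -> R).
Hypothesis mPhi : forall m, cmeas (Phi m).
Hypothesis PhiB : forall m y, normc (Phi m y) <= B m.
Variables (f : 'rV[R]_n -> 'rV[R[i]]_l) (x0 x : 'rV[R]_n) (c : R).
Hypothesis If : L1_fun f.
Hypothesis orth : forall r : R, 0 < r ->
  cintegral (fun y => \sum_m f y ord0 m * Phi m (r *: (y - x0))) = 0.

Let K m := potential_kernel a ((delta_mx ord0 j : 'rV[R[i]]_l) ord0 m) (Phi m)
  (fun y => f y ord0 m) x0 x.

(** The correction terms add up to zero, and those of the uncorrected terms
    with [m != j] vanish. *)
Lemma riesz_conv_kernel : 0 <= c -> x != x0 -> (forall m, cintegrable (K m)) ->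
  enorm (x - x0) `^ (- a) * normc (riesz_conv a (fun y => f y ord0 j) c x) <=
  c * \sum_m normc (cintegral (K m)).
Proof.
move=> c0 xx0 IK; have x00 : x - x0 != 0 by rewrite subr_eq0.
have t0 : 0 < enorm (x - x0) by rewrite enorm_gt0.
have := orth (r := (enorm (x - x0))^-1); rewrite invr_gt0 => /(_ t0) o.
pose w := (enorm (x - x0) `^ (- a))%:C%C : R[i].
have w0 : w != 0 by rewrite /w eq_complex /= eqxx andbT gt_eqF// powR_gt0.
pose q := w * (rk a (x - x0))%:C%C.
pose P m y := f y ord0 m * Phi m ((enorm (x - x0))^-1 *: (y - x0)).
have {}o : cintegral (fun y => \sum_m P m y) = 0 := o.
have IP m : cintegrable (P m).
  exact: (cintegrable_dilate _ _ (mPhi m) (PhiB m) (L1_fun_cintegrable m If)).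
pose A m y := w * (rk a (x - y))%:C%C * f y ord0 m * (delta_mx ord0 j : 'rV[R[i]]_l) ord0 m.
have AE m y : A m y = K m y + q * P m y.
  have addE (z1 z2 z3 : R[i]) : z1 = z2 - z3 -> z2 = z1 + z3 by move=> ->; rewrite subrK.
  by apply: addE; exact: potential_kernelE.
have IA m : cintegrable (A m).
  have -> : A m = fun y => K m y + q * P m y by apply/funext => y; exact: AE.
  by apply: cintegrableD => //; exact: cintegrableZ.
have sA : \sum_m cintegral (A m) = \sum_m cintegral (K m).
  transitivity (\sum_m (cintegral (K m) + q * cintegral (P m))).
    apply: eq_bigr => m _; rewrite -cintegralZ// -cintegralD//; last exact: cintegrableZ.
    by apply: eq_cintegral => y; exact: AE.
  by rewrite big_split /= -mulr_sumr -(cintegral_sum _ IP) o mulr0 addr0.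
have sAj : \sum_m cintegral (A m) = cintegral (A j).
  rewrite (bigD1 j)//= big1 ?addr0// => m mj.
  rewrite -[RHS](@cintegral0 R n); apply: eq_cintegral => y.
  by rewrite /A mxE (negPf mj) andbF mulr0.
pose Q y := (rk a (x - y))%:C%C * f y ord0 j.
have AQ y : A j y = w * Q y by rewrite /A /Q mxE !eqxx mulr1 mulrA.
have IQ : cintegrable Q.
  have -> : Q = fun y => w^-1 * A j y by apply/funext => y; rewrite AQ mulKf.
  exact: cintegrableZ.
have rE : riesz_conv a (fun y => f y ord0 j) c x = c%:C%C * cintegral Q.
  rewrite /riesz_conv -cintegralZ//; apply: eq_cintegral => y.
  by rewrite /Q real_complexM mulrA.
have wr : w * riesz_conv a (fun y => f y ord0 j) c x = c%:C%C * \sum_m cintegral (K m).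
  rewrite rE -sA sAj mulrCA; congr (_ * _); rewrite -cintegralZ//.
  by apply: eq_cintegral => y; rewrite AQ.
have := congr1 (@normc R) wr; rewrite !normcM !normc_real !ger0_norm ?powR_ge0// => ->.
by rewrite ler_wpM2l// normc_sum.
Qed.

End pointwise.

Lemma normc_le_cenorm (v : 'rV[R[i]]_l) m : normc (v ord0 m) <= cenorm v.
Proof.
rewrite /cenorm -{1}(ger0_norm (normc_ge0 (v ord0 m))) -sqrtr_sqr ler_wsqrtr//.
by rewrite (bigD1 m)//= lerDl sumr_ge0// => i _; rewrite sqr_ge0.
Qed.

Lemma cenorm_le_sum (v : 'rV[R[i]]_l) : cenorm v <= \sum_m normc (v ord0 m).
Proof.
have s0 : 0 <= \sum_m normc (v ord0 m) by apply: sumr_ge0 => m _; exact: normc_ge0.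
rewrite -(ger0_norm s0) -sqrtr_sqr ler_wsqrtr// expr2 mulr_suml.
apply: ler_sum => m _; rewrite expr2 ler_wpM2l ?normc_ge0//.
by rewrite (bigD1 m)//= lerDl sumr_ge0// => i _; exact: normc_ge0.
Qed.

Lemma measurable_cenorm (f : 'rV[R]_n -> 'rV[R[i]]_l) :
  (forall m, cmeas (fun x => f x ord0 m)) -> measurable_fun setT (fun x => cenorm (f x)).
Proof.
move=> mf; apply: (measurableT_comp (f := @Num.sqrt R)).
  by apply: continuous_measurable_fun; exact: sqrt_continuous.
apply: measurable_sum => m; apply: measurable_funX; exact: cmeas_normc.
Qed.

Lemma L1n_le_L1_norm (f : 'rV[R]_n -> 'rV[R[i]]_l) m : L1_fun f ->
  ((L1n (fun x => f x ord0 m))%:E <= L1_norm f)%E.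
Proof.
move=> If; have I i := L1_fun_cintegrable i If.
rewrite -L1nE//; apply: le_integral_fin.
- exact: cmeas_normc (I m).1.
- by apply: measurable_cenorm => i; exact: (I i).1.
- by move=> x; exact: normc_ge0.
- by move=> x; exact: normc_le_cenorm.
Qed.

Lemma riesz_coordinate_bound (j : 'I_l) (c : R) : 0 <= c ->
  orthogonal_limit Omega (delta_mx ord0 j) -> exists2 D : R, 0 <= D &
  forall f, W1 Omega f -> forall x0 : 'rV[R]_n,
  (\int[mu]_x (enorm (x - x0) `^ (- a) *
     normc (riesz_conv a (fun y => f y ord0 j) c x))%:E <= D%:E * L1_norm f)%E.
Proof.
move=> c0 [Phi [C [C0 mP near decay orth]]].
have KB m := kernel_bound a_gt0 a_lt C0 (mP m) (near m) (decay m).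
pose M m := s2val (cid2 (KB m)).
have M0 m : 0 <= M m := s2valP (cid2 (KB m)).
have MP m := s2valP' (cid2 (KB m)).
exists (c * \sum_m 2 * M m).
  by rewrite mulr_ge0// sumr_ge0// => m _; rewrite mulr_ge0.
move=> f Wf x0; have If := Wf.1; have I m := L1_fun_cintegrable m If.
pose K m := potential_kernel a ((delta_mx ord0 j : 'rV[R[i]]_l) ord0 m) (Phi m)
  (fun y => f y ord0 m) x0.
have mK m := cmeas_potential_kernel a ((delta_mx ord0 j : 'rV[R[i]]_l) ord0 m)
  (mP m) (I m) x0.
have KM m := potential_kernel_le (mP m) (I m) x0 (M0 m) (MP m).
have aeK : {ae mu, forall x, forall m, cintegrable (K m x)}.
  apply: (@filter_forall _ 'I_l (fun m x => cintegrable (K m x))) => m.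
  by apply: (ae_cintegrable_slice (mK m)); rewrite (le_lt_trans (KM m))// ltry.
have mG m : measurable_fun setT (fun x => normc (cintegral (K m x))).
  by apply: cmeas_normc; exact: (cmeas_cintegral (mK m)).
have G0 m x : 0 <= normc (cintegral (K m x)) by exact: normc_ge0.
have GM m : (\int[mu]_x (normc (cintegral (K m x)))%:E <= (2 * M m)%:E * L1_norm f)%E.
  rewrite (le_trans (le_normc_cintegral_int (mK m)))// EFinM -muleA lee_wpmul2l//.
  rewrite (le_trans (KM m))// EFinM lee_wpmul2l ?lee_fin//.
  exact: L1n_le_L1_norm.
apply: (@le_trans _ _ (\int[mu]_x (c * \sum_m normc (cintegral (K m x)))%:E)%E).
  apply: ae_ge0_le_integral => //.
  - by move=> x _; rewrite lee_fin mulr_ge0 ?powR_ge0 ?normc_ge0.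
  - apply/measurable_EFinP; apply: measurable_funM.
      by apply: measurable_funpow; apply: measurable_enorm; exact: measurable_rVB.
    by apply: cmeas_normc; exact: cmeas_riesz_conv.
  - by move=> x _; rewrite lee_fin mulr_ge0// sumr_ge0.
  - by apply/measurable_EFinP; apply: measurable_funM => //; exact: measurable_sum.
  have aeN := @ae_neq R n (riesz_dim_gt0 a_gt0 a_lt) x0 (fun x => x != x0) (fun x h => h).
  apply: filterS2 aeK aeN => x IK xx0 _; rewrite lee_fin.
  apply: (@riesz_conv_kernel Phi j (fun m => normc ((delta_mx ord0 j : 'rV[R[i]]_l) ord0 m) + C)) => //.
  - by move=> m y; exact: near_decay_bounded.
  - by move=> r r0; exact: orth.
rewrite ge0_integralZ_fin//; last 2 first.
- exact: measurable_sum.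
- by move=> x; rewrite sumr_ge0.
rewrite [in leRHS]EFinM -muleA lee_wpmul2l ?lee_fin//.
under eq_integral do rewrite -sumEFin.
rewrite ge0_integral_sum//; last 2 first.
- by move=> m; exact/measurable_EFinP.
- by move=> m x _; rewrite lee_fin.
rewrite -sumEFin ge0_sume_distrl; last by move=> m _; rewrite lee_fin mulr_ge0.
by apply: lee_sum => m _; exact: GM.
Qed.

End coordinate.


Theorem corollary1p8 (R : realType) (d k l : nat)
    (k_gt0 : (1 <= k)%N) (k_le_l : (k <= l)%N) (d_gt0 : (1 <= d)%N)
    (Omega : sphere R d -> grassmannian R l k)
    (Omega_smooth : smooth_grassmannian_map Omega)
    (cancellation :
       \bigcap_(zeta in [set: sphere R d]) [set v | v \in val (Omega zeta)] =
       [set 0])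
    (alpha : R) (alpha_gt0 : 0 < alpha) (alpha_lt_d : alpha < d%:R) :
  exists C : R, forall f : 'rV[R]_d -> 'rV[R[i]]_l, W1 Omega f ->
    (exists g, is_riesz_potential alpha f g) /\
    forall g, is_riesz_potential alpha f g -> forall x0 : 'rV[R]_d,
      (\int[@lebesgue_rV R d]_x
         (cenorm (g x) / enorm (x - x0) `^ alpha)%:E <= C%:E * L1_norm f)%E.
Proof.
have [c c0 cE] := riesz_identity alpha_gt0 alpha_lt_d.
have H j := riesz_coordinate_bound alpha_gt0 alpha_lt_d c0
  (every_vector_orthogonal_limit Omega_smooth cancellation (delta_mx ord0 j)).
pose D j := s2val (cid2 (H j)).
have D0 j : 0 <= D j := s2valP (cid2 (H j)).
have DP j := s2valP' (cid2 (H j)).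
exists (\sum_j D j) => f Wf.
have I j := L1_fun_cintegrable j Wf.1.
pose g0 j := riesz_conv alpha (fun y => f y ord0 j) c.
have g0P j : is_distr_inv_fourier
    (fun xi => (enorm xi `^ (- alpha))%:C%C * vfourier f xi ord0 j) (g0 j).
  have -> : (fun xi => (enorm xi `^ (- alpha))%:C%C * vfourier f xi ord0 j) =
      fun xi => (enorm xi `^ (- alpha))%:C%C * fourier (fun y => f y ord0 j) xi.
    by apply/funext => xi; rewrite mxE.
  exact: riesz_conv_distr.
split.
  exists (fun x => \row_j g0 j x) => j.
  have -> : (fun x => (\row_j g0 j x) ord0 j) = g0 j by apply/funext => x; rewrite mxE.
  exact: g0P.
move=> g gP x0.
have mg j : cmeas (fun x => g x ord0 j) by have [_ [? _] _] := gP j.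
have mg0 j : cmeas (g0 j) by exact: cmeas_riesz_conv.
have mw : measurable_fun setT (fun x : 'rV[R]_d => enorm (x - x0) `^ (- alpha)).
  by apply: measurable_funpow; apply: measurable_enorm; exact: measurable_rVB.
have aeg : {ae lebesgue_rV R d, forall x, forall j, g x ord0 j = g0 j x}.
  apply: (@filter_forall _ 'I_l (fun j x => g x ord0 j = g0 j x)) => j.
  exact: (distr_inv_fourier_unique (gP j) (g0P j)).
have mT j : measurable_fun setT
    (fun x : 'rV[R]_d => enorm (x - x0) `^ (- alpha) * normc (g0 j x)).
  by apply: measurable_funM => //; exact: cmeas_normc.
have T0 j x : 0 <= enorm (x - x0) `^ (- alpha) * normc (g0 j x).
  by rewrite mulr_ge0 ?powR_ge0 ?normc_ge0.
apply: (@le_trans _ _ (\int[lebesgue_rV R d]_x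
    (\sum_j enorm (x - x0)%R `^ (- alpha) * normc (g0 j x))%:E)%E).
  apply: ae_ge0_le_integral => //.
  - by move=> x _; rewrite lee_fin divr_ge0 ?powR_ge0 ?sqrtr_ge0.
  - apply/measurable_EFinP; under eq_fun do rewrite -powRN.
    by apply: measurable_funM => //; exact: measurable_cenorm.
  - by move=> x _; rewrite lee_fin sumr_ge0.
  - by apply/measurable_EFinP; exact: measurable_sum.
  apply: filterS aeg => x gE _; rewrite lee_fin -powRN mulrC -mulr_sumr.
  rewrite ler_wpM2l ?powR_ge0// (le_trans (cenorm_le_sum _))//.
  by apply: ler_sum => j _; rewrite gE.
under eq_integral do rewrite -sumEFin.
rewrite ge0_integral_sum//; last 2 first.
- by move=> j; exact/measurable_EFinP.
- by move=> j x _; rewrite lee_fin.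
rewrite -sumEFin ge0_sume_distrl; last by move=> j _; rewrite lee_fin.
by apply: lee_sum => j _; exact: DP.
Qed.
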